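(* Assume that either (1) $\mathbf{X}$ is uniformly distributed on $\mathcal{X}$, where $\mathcal{X}\subseteq\mathbb{R}^n$ is bounded and convex, or (2) $\mathbf{X}\sim\mathcal{N}(\mathbf{0},\mathbf{I})$ on $\mathbb{R}^n$ (so $\mathcal{X}=\mathbb{R}^n$). Let $\epsilon>0$ and $\|\mathbf{W}-\hat{\mathbf{W}}\|\le\epsilon$. Then there is a constant $C>0$, depending only on the distribution of $\mathbf{X}$ (in particular not on $f$, $k$, $N$, $\epsilon$ or $\hat{\mathbf{W}}$), such that for every integer $N\ge1$ $$\mathbb{E}\big[d_{\mathrm H}(\rho_{\mathrm{post}},\rho_{\mathrm{post},\hat g_N})\big]\le\sqrt{C}\,L\,(1+N^{-1/2})\Big(\epsilon(\lambda_1+\cdots+\lambda_k)^{1/2}+(\lambda_{k+1}+\cdots+\lambda_n)^{1/2}\Big),$$ where $L>0$ is given by $$L^2=\frac18\left(Z\exp\Big(-\int_{\mathcal{X}}f(\mathbf{x})\rho_{\mathbf{X}}(\mathbf{x})\,d\mathbf{x}\Big)\right)^{-1/2},\qquad Z=\int_{\mathcal{X}}\exp(-f(\mathbf{x}))\rho_{\mathbf{X}}(\mathbf{x})\,d\mathbf{x}.$$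
   Context: Let $n\ge2$ and let $\rho_{\mathbf{X}}:\mathbb{R}^n\to[0,\infty)$ be a probability density with respect to Lebesgue measure (the prior density). Put $\mathcal{X}=\{\mathbf{x}:\rho_{\mathbf{X}}(\mathbf{x})>0\}$; it is assumed that $\mathcal{X}$ is open, that $\partial\mathcal{X}$ has Lebesgue measure zero, and that $\rho_{\mathbf{X}}$ is bounded and continuous on $\mathcal{X}$. Let $\mathbf{X}$ be a random vector with density $\rho_{\mathbf{X}}$ on a probability space $(\Omega,\mathcal{A},\mathbb{P})$. Let $\mathcal{G}:\mathcal{X}\to\mathbb{R}^{m}$ be a model, $\mathbf{d}\in\mathbb{R}^m$ data, $\Gamma\in\mathbb{R}^{m\times m}$ a (symmetric positive definite) noise covariance matrix, and let $f(\mathbf{x})=\frac12\|\Gamma^{-1/2}(\mathbf{d}-\mathcal{G}(\mathbf{x}))\|^2$, $\mathbf{x}\in\mathcal{X}$, be the data misfit function. It is assumed that $f$ is measurable and has partial derivatives that are square integrable with respect to $\rho_{\mathbf{X}}$. Define $\mathbf{C}=\int_{\mathcal{X}}\nabla f(\mathbf{x})\nabla f(\mathbf{x})^\top\rho_{\mathbf{X}}(\mathbf{x})\,d\mathbf{x}=\mathbf{W}\Lambda\mathbf{W}^\top$, with $\Lambda=\mathrm{diag}(\lambda_1,\dots,\lambda_n)$, $\lambda_1\ge\dots\ge\lambda_n\ge0$, and $\mathbf{W}$ an orthogonal matrix of eigenvectors. Fix $k\in\{1,\dots,n-1\}$. Let $\hat{\mathbf{W}}=[\hat{\mathbf{W}}_1\;\hat{\mathbf{W}}_2]$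 be an orthogonal $n\times n$ matrix (a perturbation of $\mathbf{W}$) with $\hat{\mathbf{W}}_1\in\mathbb{R}^{n\times k}$, $\hat{\mathbf{W}}_2\in\mathbb{R}^{n\times(n-k)}$. $\|\cdot\|$ is the Euclidean norm, and for matrices the induced operator norm. Put $\hat{\mathcal{Y}}=\hat{\mathbf{W}}_1^\top\mathcal{X}$, $\rho_{\hat{\mathbf{Y}}}(\hat{\mathbf{y}})=\int_{\mathbb{R}^{n-k}}\rho_{\mathbf{X}}(\hat{\mathbf{W}}_1\hat{\mathbf{y}}+\hat{\mathbf{W}}_2\hat{\mathbf{z}})\,d\hat{\mathbf{z}}$, and for $\hat{\mathbf{y}}\in\hat{\mathcal{Y}}$ (where $\rho_{\hat{\mathbf{Y}}}(\hat{\mathbf{y}})>0$) put $\rho_{\hat{\mathbf{Z}}|\hat{\mathbf{Y}}}(\hat{\mathbf{z}}|\hat{\mathbf{y}})=\rho_{\mathbf{X}}(\hat{\mathbf{W}}_1\hat{\mathbf{y}}+\hat{\mathbf{W}}_2\hat{\mathbf{z}})/\rho_{\hat{\mathbf{Y}}}(\hat{\mathbf{y}})$; let $\mathbb{P}^{\hat{\mathbf{y}}}_{\hat{\mathbf{Z}}|\hat{\mathbf{Y}}}$ be the probability measure on $\mathbb{R}^{n-k}$ with this density. It is assumed that $\hat{\mathbf{z}}\mapsto f(\hat{\mathbf{W}}_1\hat{\mathbf{y}}+\hat{\mathbf{W}}_2\hat{\mathbf{z}})$ is integrable with respect to this measure for every $\hat{\mathbf{y}}\in\hat{\mathcal{Y}}$.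 For $\hat{\mathbf{y}}\in\hat{\mathcal{Y}}$ define $$\hat g_N(\hat{\mathbf{y}},\omega)=\frac1N\sum_{j=1}^N f(\hat{\mathbf{W}}_1\hat{\mathbf{y}}+\hat{\mathbf{W}}_2\hat{\mathbf{Z}}^{\hat{\mathbf{y}}}_j(\omega)),$$ where, for each $\hat{\mathbf{y}}$, $\hat{\mathbf{Z}}^{\hat{\mathbf{y}}}_1,\dots,\hat{\mathbf{Z}}^{\hat{\mathbf{y}}}_N$ are i.i.d. random vectors on $\Omega$ with law $\mathbb{P}^{\hat{\mathbf{y}}}_{\hat{\mathbf{Z}}|\hat{\mathbf{Y}}}$, and each map $(\hat{\mathbf{y}},\omega)\mapsto\hat{\mathbf{Z}}^{\hat{\mathbf{y}}}_j(\omega)$ is $\mathcal{B}(\hat{\mathcal{Y}})\otimes\mathcal{A}$-measurable. For $\mathbf{x}\in\mathcal{X}$ put $f_{\hat g_N}(\mathbf{x},\omega)=\hat g_N(\hat{\mathbf{W}}_1^\top\mathbf{x},\omega)$. The posterior and its approximation on $\mathcal{X}$ are $$\rho_{\mathrm{post}}(\mathbf{x})=\frac{\exp(-f(\mathbf{x}))\rho_{\mathbf{X}}(\mathbf{x})}{Z},\qquad \rho_{\mathrm{post},\hat g_N}(\mathbf{x},\omega)=\frac{\exp(-f_{\hat g_N}(\mathbf{x},\omega))\rho_{\mathbf{X}}(\mathbf{x})}{Z_{\hat g_N}(\omega)},$$ where $Z$, $Z_{\hat g_N}(\omega)$ are the normalizing constants making these probability densities in $\mathbf{x}$. The Hellinger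 distance of densities $p,q$ on $\mathcal{X}$ is $d_{\mathrm H}(p,q)=\big(\frac12\int_{\mathcal{X}}(\sqrt{p}-\sqrt{q})^2d\mathbf{x}\big)^{1/2}$. $\mathbb{E}$ is integration over $\omega$ with respect to $\mathbb{P}$. *)

(* Defs.v *)
From HB Require Import structures.
From mathcomp Require Import all_boot all_order all_algebra.
From mathcomp Require Import all_classical all_reals all_analysis.
Set Implicit Arguments.
Unset Strict Implicit.
Unset Printing Implicit Defensive.
Import Order.TTheory GRing.Theory Num.Theory.
Import numFieldNormedType.Exports.
Local Open Scope classical_set_scope.
Local Open Scope ring_scope.

Section cV_measurable.
Variables (R : realType) (n : nat).

Let coors : 'I_n -> 'cV[R]_n -> R := fun i x => x i ord0.

Let cV_set0 : g_sigma_preimage coors set0.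
Proof. exact: sigma_algebra0. Qed.

Let cV_setC A : g_sigma_preimage coors A -> g_sigma_preimage coors (~` A).
Proof. exact: sigma_algebraC. Qed.

Let cV_bigcup (F : _^nat) : (forall i, g_sigma_preimage coors (F i)) ->
  g_sigma_preimage coors (\bigcup_i (F i)).
Proof. exact: sigma_algebra_bigcup. Qed.

(* The sigma-algebra on R^n generated by the coordinates, i.e. the product
   sigma-algebra; it is the Borel sigma-algebra of R^n. *)
HB.instance Definition _ := @isMeasurable.Build default_measure_display
  'cV[R]_n (g_sigma_preimage coors) cV_set0 cV_setC cV_bigcup.

Lemma measurable_coor (i : 'I_n) :
  measurable_fun [set: 'cV[R]_n] (fun x : 'cV[R]_n => x i ord0).
Proof.
move=> _ Y mY; rewrite setTI; apply: sub_sigma_algebra => /=.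
rewrite -bigcup_seq/=; exists i => /=; first by rewrite mem_index_enum.
by exists Y => //; rewrite setTI.
Qed.

Lemma measurable_fun_coorP d (T : measurableType d) (f : T -> 'cV[R]_n) :
  measurable_fun [set: T] f <->
  forall i, measurable_fun [set: T] (fun t => f t i ord0).
Proof.
split=> [mf i|mf].
  by apply: (measurableT_comp (measurable_coor i)).
have H : g_sigma_preimage (fun i => coors i \o f) `<=` measurable.
  apply: smallest_sub; first exact: sigma_algebra_measurable.
  rewrite -bigcup_seq/=; apply: bigcup_sub => i _ A [B mB <-]; exact: mf.
rewrite g_sigma_preimage_comp in H.
by move=> _ A mA; apply: H; exists A.
Qed.

End cV_measurable.

Section lebesgue_cV.
Variable R : realType.

Definition cons_cV n (p : measurableTypeR R * 'cV[R]_n) : 'cV[R]_n.+1 :=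
  col_mx (p.1 : R)%:M p.2.

Lemma measurable_cons_cV n : measurable_fun setT (@cons_cV n).
Proof.
apply/measurable_fun_coorP => i; rewrite /cons_cV.
case: (@splitP 1 n i) => j ij.
  rewrite (_ : (fun _ => _) = fst); first exact: measurable_fst.
  apply/funext => p.
  rewrite (_ : i = lshift n j); last exact: val_inj.
  by rewrite (@col_mxEu _ 1) ord1 mxE.
rewrite (_ : (fun _ => _) =
    (fun x : 'cV[R]_n => x j ord0) \o (@snd (measurableTypeR R) 'cV[R]_n)).
  exact: measurableT_comp (measurable_coor j) measurable_snd.
apply/funext => p /=.
rewrite (_ : i = rshift 1 j); last exact: val_inj.
by rewrite (@col_mxEd _ 1).
Qed.

HB.instance Definition _ n :=
  isMeasurableFun.Build _ _ _ _ (@cons_cV n) (@measurable_cons_cV n).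

Section lebesgue_cons.
Variables (n : nat) (m : {sigma_finite_measure set 'cV[R]_n -> \bar R}).

Definition lebesgue_cons : set 'cV[R]_n.+1 -> \bar R :=
  pushforward (@lebesgue_measure R \x m)%E (@cons_cV n).

Let lebesgue_cons0 : lebesgue_cons set0 = 0%E.
Proof. exact: measure0. Qed.

Let lebesgue_cons_ge0 A : (0 <= lebesgue_cons A)%E.
Proof. exact: measure_ge0. Qed.

Let lebesgue_cons_sigma_additive : semi_sigma_additive lebesgue_cons.
Proof. exact: measure_semi_sigma_additive. Qed.

HB.instance Definition _ := isMeasure.Build _ _ _ lebesgue_cons
  lebesgue_cons0 lebesgue_cons_ge0 lebesgue_cons_sigma_additive.

Let uncons (x : 'cV[R]_n.+1) : measurableTypeR R * 'cV[R]_n :=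
  (x ord0 ord0, dsubmx (x : 'cV_(1 + n))).

Let cons_cVK : cancel (@cons_cV n) uncons.
Proof.
move=> [a x]; rewrite /uncons /cons_cV /= col_mxKd; congr (_, _).
rewrite (_ : ord0 = lshift n (ord0 : 'I_1)); last exact: val_inj.
by rewrite (@col_mxEu _ 1) mxE.
Qed.

Let measurable_uncons : measurable_fun setT uncons.
Proof.
apply/measurable_fun_pairP; split; first exact: measurable_coor.
apply/measurable_fun_coorP => i.
rewrite (_ : (fun _ => _) = fun x : 'cV[R]_n.+1 => x (rshift 1 i) ord0).
  exact: measurable_coor.
by apply/funext => x; rewrite /= mxE.
Qed.

Let lebesgue_cons_sigma_finite : sigma_finite setT lebesgue_cons.
Proof.
have /sigma_finiteP[F [UF ndF Foo]] := sigma_finiteT (@lebesgue_measure R).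
have /sigma_finiteP[G [UG ndG Goo]] := sigma_finiteT m.
exists (fun i => uncons @^-1` (F i `*` G i)).
  rewrite -preimage_bigcup -[LHS](preimage_setT uncons); congr (_ @^-1` _).
  rewrite -setXTT UF UG predeqE => -[x y]; split.
    move=> [/= [i _ Fix] [j _ Gjy]]; exists (maxn i j) => //; split.
    - by move: x Fix; exact/subsetPset/ndF/leq_maxl.
    - by move: y Gjy; exact/subsetPset/ndG/leq_maxr.
  by move=> [i _ []/= ? ?]; split; exists i.
move=> i; have [mF Fioo] := Foo i; have [mG Gioo] := Goo i; split.
  by rewrite -[X in measurable X]setTI; apply: measurable_uncons => //;
    exact: measurableX.
rewrite /lebesgue_cons /pushforward (_ : _ @^-1` _ = F i `*` G i).
  by rewrite product_measure1E// lte_mul_pinfty// ge0_fin_numE.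
by apply/seteqP; split => p; rewrite /preimage /mkset cons_cVK.
Qed.

HB.instance Definition _ := Measure_isSigmaFinite.Build _ _ _ lebesgue_cons
  lebesgue_cons_sigma_finite.

End lebesgue_cons.

(* n-dimensional Lebesgue measure: the point mass for n = 0, and the product
   of the Lebesgue measures of R and R^n for n.+1. *)
Fixpoint lebesgue_cV n : {sigma_finite_measure set 'cV[R]_n -> \bar R} :=
  match n with
  | 0 => @dirac _ _ (0 : 'cV[R]_0) R
  | n'.+1 => lebesgue_cons (lebesgue_cV n')
  end.

Lemma lebesgue_cV_box n (a b : 'cV[R]_n) :
  (forall i, a i ord0 <= b i ord0) ->
  lebesgue_cV n [set x : 'cV[R]_n | forall i, x i ord0 \in `[a i ord0, b i ord0]] =
  (\prod_(i < n) (b i ord0 - a i ord0))%:E.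
Proof.
elim: n a b => [|n IH] a b ab.
  rewrite big_ord0 /= diracE mem_set//= => i; case: i => //.
pose a' := \col_(i < n) a (lift ord0 i) ord0.
pose b' := \col_(i < n) b (lift ord0 i) ord0.
rewrite big_ord_recl; set B := mkset _.
rewrite -[LHS]/((lebesgue_measure \x lebesgue_cV n)%E (@cons_cV n @^-1` B)).
rewrite (_ : @cons_cV n @^-1` B = ([set` `[a ord0 ord0, b ord0 ord0]] `*`
    [set x : 'cV[R]_n | forall i, x i ord0 \in `[a' i ord0, b' i ord0]])); last first.
  rewrite {}/B; apply/seteqP; split => -[t x]; rewrite /preimage /cons_cV /=.
    move=> h; split.
      have := h (lshift n (ord0 : 'I_1)).
      rewrite (@col_mxEu _ 1) mxE mulr1n.
      by rewrite (_ : lshift n (ord0 : 'I_1) = ord0 :> 'I_n.+1)//; exact: val_inj.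
    move=> i; have := h (rshift 1 i); rewrite (@col_mxEd _ 1) !mxE.
    by rewrite (_ : rshift 1 i = lift ord0 i :> 'I_n.+1)//; exact: val_inj.
  move=> [h0 h] i; case: (@splitP 1 n i) => j ij.
    rewrite (_ : i = lshift n j); last exact: val_inj.
    rewrite (@col_mxEu _ 1) ord1 mxE mulr1n.
    by rewrite (_ : lshift n (ord0 : 'I_1) = ord0 :> 'I_n.+1)//; exact: val_inj.
  rewrite (_ : i = rshift 1 j); last exact: val_inj.
  rewrite (@col_mxEd _ 1); have := h j; rewrite !mxE.
  by rewrite (_ : rshift 1 j = lift ord0 j :> 'I_n.+1)//; exact: val_inj.
rewrite product_measure1E//=; last first.
  rewrite (_ : mkset _ = \bigcap_(i in [set: 'I_n])
      ((fun x : 'cV[R]_n => x i ord0) @^-1` `[a' i ord0, b' i ord0])).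
    apply: fin_bigcap_measurable => // i _; rewrite -[X in measurable X]setTI.
    by apply: measurable_coor => //; exact: measurable_itv.
  by apply/seteqP; split => x /= h i; [move=> _; exact: h|exact: (h i I)].
rewrite IH; last by move=> i; rewrite !mxE.
rewrite lebesgue_measure_itv/= lte_fin EFinM.
congr (_ * _)%E; last by congr EFin; apply: eq_bigr => i _; rewrite !mxE.
have := ab ord0; rewrite le_eqVlt => /predU1P[->|->]; last by rewrite EFinB.
by rewrite ltxx subrr.
Qed.

End lebesgue_cV.


Section euclidean.
Variable R : realType.

Definition enorm n (x : 'cV[R]_n) : R := Num.sqrt (\sum_i x i ord0 ^+ 2).

Definition opnorm m n (A : 'M[R]_(m, n)) : R :=
  sup [set enorm (A *m x) | x in [set x : 'cV[R]_n | enorm x <= 1]].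

Definition orthogonal_mx n (A : 'M[R]_n) := A^T *m A = 1%:M.

Definition spd_mx n (A : 'M[R]_n) :=
  A^T = A /\
  forall x : 'cV[R]_n, x != 0 -> 0 < (x^T *m A *m x) ord0 ord0.

(* S = Gamma^{-1/2}: the unique symmetric positive definite square root of
   the inverse of Gamma. *)
Definition inv_sqrt_mx n (Gamma S : 'M[R]_n) :=
  spd_mx S /\ S *m S = invmx Gamma.

End euclidean.

Section density.
Variables (R : realType) (n : nat).
Implicit Types (rho f p q : 'cV[R]_n -> R) (X : set 'cV[R]_n).

Local Notation leb := (lebesgue_cV R n).

Definition is_density rho :=
  [/\ measurable_fun setT rho, forall x, 0 <= rho x &
      (\int[leb]_x (rho x)%:E = 1)%E].

Definition has_density (mu : probability 'cV[R]_n R) rho :=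
  forall A, measurable A -> mu A = (\int[leb]_(x in A) (rho x)%:E)%E.

Definition dsupp rho : set 'cV[R]_n := [set x : 'cV[R]_n | 0 < rho x].

Definition prior_assumptions rho :=
  [/\ is_density rho, open (dsupp rho),
      leb (closure (dsupp rho) `\` interior (dsupp rho)) = 0%E,
      exists M, forall x, dsupp rho x -> rho x <= M &
      {within dsupp rho, continuous rho}].

Definition uniform_on_convex rho :=
  [/\ bounded_set (dsupp rho), convex_set (dsupp rho) &
      forall x, dsupp rho x -> rho x = (fine (leb (dsupp rho)))^-1].

Definition std_gaussian rho :=
  forall x, rho x = expR (- (enorm x ^+ 2 / 2)) / Num.sqrt (2 * pi) ^+ n.

(* The data misfit on X, extended by 0 outside X, where the model is not
   defined: values of G outside X are irrelevant. *)
Definition misfit X m (S : 'M[R]_m) (dat : 'cV[R]_m) (G : 'cV[R]_n -> 'cV[R]_m)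
    : 'cV[R]_n -> R :=
  fun x => if x \in X then 2^-1 * enorm (S *m (dat - G x)) ^+ 2 else 0.

Definition gradient f (x : 'cV[R]_n) : 'cV[R]_n :=
  \col_i 'D_(delta_mx i ord0) f x.

Definition has_partials_on X f :=
  forall x i, X x -> derivable f x (delta_mx i ord0).

Definition partials_square_integrable rho f :=
  forall i, leb.-integrable (dsupp rho)
    (fun x => (gradient f x i ord0 ^+ 2 * rho x)%:E).

Definition gradient_mx rho f : 'M[R]_n :=
  \matrix_(i, j) \int[leb]_(x in dsupp rho)
    ((gradient f x *m (gradient f x)^T) i j * rho x).

Definition evidence rho f : R :=
  \int[leb]_(x in dsupp rho) (expR (- f x) * rho x).

Definition posterior rho f (x : 'cV[R]_n) : R :=
  expR (- f x) * rho x / evidence rho f.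

Definition hellinger X p q : R :=
  Num.sqrt (2^-1 * \int[leb]_(x in X) (Num.sqrt (p x) - Num.sqrt (q x)) ^+ 2).

End density.

Section active_subspace.
Variables (R : realType) (n k l : nat).
Variables (W1 : 'M[R]_(n, k)) (W2 : 'M[R]_(n, l)).

Definition recombine (y : 'cV[R]_k) (z : 'cV[R]_l) : 'cV[R]_n :=
  W1 *m y + W2 *m z.

Definition marginal (rho : 'cV[R]_n -> R) (y : 'cV[R]_k) : R :=
  \int[lebesgue_cV R l]_z rho (recombine y z).

Definition conditional (rho : 'cV[R]_n -> R) (y : 'cV[R]_k) (z : 'cV[R]_l) : R :=
  rho (recombine y z) / marginal rho y.

Definition active_set (X : set 'cV[R]_n) : set 'cV[R]_k :=
  [set W1^T *m x | x in X].

Definition mc_average (f : 'cV[R]_n -> R) (Omega : Type) N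
    (Zh : 'I_N -> 'cV[R]_k -> Omega -> 'cV[R]_l) (y : 'cV[R]_k) (w : Omega) : R :=
  N%:R^-1 * \sum_(j < N) f (recombine y (Zh j y w)).

End active_subspace.

Definition mutually_independent d (Omega : measurableType d) (R : realType)
    (P : probability Omega R) d' (T : measurableType d') N
    (Y : 'I_N -> Omega -> T) :=
  forall (J : {set 'I_N}) (A : 'I_N -> set T), (forall j, measurable (A j)) ->
  (P (\bigcap_(j in [set j | j \in J]) (Y j @^-1` A j)) =
   \prod_(j in J) P (Y j @^-1` A j))%E.

(* Main.v *)
Require Import Defs.
From HB Require Import structures.
From mathcomp Require Import all_boot all_order all_algebra.
From mathcomp Require Import all_classical all_reals all_analysis measurable_realfun.
From mathcomp Require Import ring lra.
Set Implicit Arguments.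
Unset Strict Implicit.
Unset Printing Implicit Defensive.
Import Order.TTheory GRing.Theory Num.Theory.
Import numFieldNormedType.Exports.
Local Open Scope classical_set_scope.
Local Open Scope ring_scope.

(* The squared Hellinger distance between the posteriors of f and g is at most
   2 L^2 S, where S is the prior mean of (f - g)^2. For the Monte Carlo
   approximation, Jensen's inequality over the samples
   bounds E[S] by the energy of f, i.e. the mean of (f(y,z) - f(y,z'))^2 over
   z, z' drawn independently from the conditional density given y. A Poincare
   inequality bounds this energy by a multiple of the mean of |W2^T grad f|^2, and
   this is the trace of W2^T C W2, to which the leading eigenvalues contribute at
   most with the factor eps^2 because W_i^T W2 = (W_i - What_i)^T W2.

   The Poincare inequality is proved by integrating the gradient along paths from
   z to z': segments in the convex case, and the rotation z cos t + z' sin t, which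
   preserves the product Gaussian, in the Gaussian case. As f only has partial
   derivatives, with no continuity, it is first truncated to a bounded function and
   mollified; the gradient of the mollification comes from integration by parts,
   which rests on a fundamental theorem of calculus for everywhere derivable
   functions. The mollification error in L^2 is controlled by the partial
   derivatives, on a smaller set that then exhausts the support. *)

(** * Lebesgue measure on Euclidean space *)

(** The main obstacle is that [f] has derivatives only along the coordinate axes, whereas the paths
    of the Poincare inequality run in the range of [W2], oblique to the axes; without continuity of
    the partial derivatives there is no chain rule along them. Mollification moves the derivative
    onto the kernel, where the chain rule holds. The energy of pairs stands for the conditional
    variance because it integrates a nonnegative function: Tonelli and monotone convergence apply
    with no integrability of [f] or of its square, and finiteness of the prior mean of [f] is itself
    read off from the Poincare inequality. The constant comes from geometry alone, a squared
    diameter or a squared angular speed times a Gaussian moment, and changes of variables in the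
    inactive space cost 2^l, at most 2^n; hence no dependence on [f], [k] or the frame. As Lebesgue
    measure is built as a product in the standard coordinates, splitting it along a rotated frame
    needs rotation invariance, which is derived from translation invariance by uniqueness up to a
    factor. *)

Section measurable_cV.
Context d (T : measurableType d) (R : realType).

Lemma measurable_fun_coor n (f : T -> 'cV[R]_n) i :
  measurable_fun setT f -> measurable_fun setT (fun t => f t i ord0).
Proof. by move/measurable_fun_coorP; exact. Qed.

Lemma measurable_cVD n (f g : T -> 'cV[R]_n) :
  measurable_fun setT f -> measurable_fun setT g ->
  measurable_fun setT (fun t => f t + g t).
Proof.
move=> mf mg; apply/measurable_fun_coorP => i; under eq_fun do rewrite mxE.
by apply: measurable_funD; exact: measurable_fun_coor.
Qed.

Lemma measurable_cVZ n (a : T -> R) (f : T -> 'cV[R]_n) :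
  measurable_fun setT a -> measurable_fun setT f ->
  measurable_fun setT (fun t => a t *: f t).
Proof.
move=> ma mf; apply/measurable_fun_coorP => i; under eq_fun do rewrite mxE.
by apply: measurable_funM => //; exact: measurable_fun_coor.
Qed.

Lemma measurable_cVN n (f : T -> 'cV[R]_n) :
  measurable_fun setT f -> measurable_fun setT (fun t => - f t).
Proof.
move=> mf; under eq_fun do rewrite -scaleN1r.
by apply: measurable_cVZ => //; exact: measurable_cst.
Qed.

Lemma measurable_cVB n (f g : T -> 'cV[R]_n) :
  measurable_fun setT f -> measurable_fun setT g ->
  measurable_fun setT (fun t => f t - g t).
Proof. by move=> mf mg; apply: measurable_cVD => //; exact: measurable_cVN. Qed.

Lemma measurable_mulmx m n (A : 'M[R]_(m, n)) (f : T -> 'cV[R]_n) :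
  measurable_fun setT f -> measurable_fun setT (fun t => A *m f t).
Proof.
move=> mf; apply/measurable_fun_coorP => i; under eq_fun do rewrite mxE.
apply: measurable_sum => j; apply: measurable_funM; first exact: measurable_cst.
exact: measurable_fun_coor.
Qed.

Lemma measurable_recombine n k l (W1 : 'M[R]_(n, k)) (W2 : 'M[R]_(n, l))
    (f : T -> 'cV[R]_k) (g : T -> 'cV[R]_l) :
  measurable_fun setT f -> measurable_fun setT g ->
  measurable_fun setT (fun t => recombine W1 W2 (f t) (g t)).
Proof. by move=> mf mg; apply: measurable_cVD; exact: measurable_mulmx. Qed.

End measurable_cV.

Section lebesgue_1d.
Variable R : realType.
Local Open Scope ereal_scope.
Local Notation mu := (@lebesgue_measure R).

Lemma integral_lebesgue_shift (a : R) (h : R -> \bar R) :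
  measurable_fun setT h -> (forall x, 0 <= h x) ->
  \int[mu]_t h (a + t)%R = \int[mu]_t h t.
Proof.
move=> mh h0; pose phi : measurableTypeR R -> measurableTypeR R := fun t => (a + t)%R.
have mphi : measurable_fun setT phi by apply: measurable_funD.
have -> : \int[mu]_t h (a + t)%R = \int[pushforward mu phi]_t h t.
  by rewrite ge0_integral_pushforward.
apply: eq_measure_integral => A mA _; apply/esym/lebesgue_measure_unique => //.
move=> _ [[x y]] _ <- /=; rewrite /pushforward.
have -> : phi @^-1` [set` `]x, y]] = [set` `](x - a)%R, (y - a)%R]].
  by apply/seteqP; split=> t /=; rewrite !in_itv/= /phi; lra.
by rewrite !lebesgue_measure_itv/= !lte_fin ltrD2r -!EFinD opprB addrA subrK.
Qed.

End lebesgue_1d.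

Section lebesgue_translation.
Variable R : realType.
Local Open Scope ereal_scope.
Local Notation leb := (lebesgue_cV R).

Lemma integral_lebesgue_cVS n (h : 'cV[R]_n.+1 -> \bar R) :
  measurable_fun setT h -> (forall x, 0 <= h x) ->
  \int[leb n.+1]_x h x = \int[lebesgue_measure]_t \int[leb n]_x h (cons_cV (t, x)).
Proof.
move=> mh h0.
transitivity (\int[lebesgue_measure \x leb n]_p h (cons_cV p)).
  exact: (ge0_integral_pushforward (@measurable_cons_cV R n) _ measurableT mh).
rewrite fubini_tonelli1//.
exact: measurableT_comp mh (@measurable_cons_cV R n).
Qed.

Lemma cons_cVD n (t s : R) (x y : 'cV[R]_n) :
  (cons_cV (t, x) + cons_cV (s, y))%R = cons_cV ((t + s)%R, (x + y)%R).
Proof.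
apply: etrans (@add_col_mx _ 1 n 1 _ _ _ _) _.
by congr (@col_mx _ 1 n 1 _ _); rewrite -raddfD.
Qed.

Lemma cons_cV_usub n (v : 'cV[R]_n.+1) :
  v = cons_cV (v ord0 ord0, dsubmx (v : 'cV_(1 + n))).
Proof.
rewrite /cons_cV; apply: etrans (esym (@vsubmxK _ 1 n 1 v)) _.
congr (@col_mx _ 1 n 1 _ _).
apply/matrixP => i j; rewrite !ord1 !mxE mulr1n; congr (v _ _); exact: val_inj.
Qed.

Lemma integral_lebesgue_cV_shift n (v : 'cV[R]_n) (h : 'cV[R]_n -> \bar R) :
  measurable_fun setT h -> (forall x, 0 <= h x) ->
  \int[leb n]_x h (v + x)%R = \int[leb n]_x h x.
Proof.
elim: n v h => [|n IH] v h mh h0.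
  by apply: eq_integral => x _; rewrite [v]flatmx0 add0r.
have mv m (u : 'cV[R]_m) : measurable_fun setT (fun x : 'cV[R]_m => u + x)%R.
  by apply: measurable_cVD => //; exact: measurable_cst.
rewrite !integral_lebesgue_cVS//; last exact: measurableT_comp mh (mv _ _).
rewrite [v]cons_cV_usub; set a := v _ _; set w := dsubmx _.
under eq_integral => t _.
  under eq_integral do rewrite cons_cVD.
  rewrite (IH w (fun x => h (cons_cV ((a + t)%R, x))))//; last first.
    apply: measurableT_comp mh _; apply: measurableT_comp (@measurable_cons_cV R n) _.
    exact: measurable_pair1.
  over.
apply: (integral_lebesgue_shift a (h := fun t => \int[leb n]_x h (cons_cV (t, x)))).
  apply: (measurable_fun_fubini_tonelli_F (h \o @cons_cV R n)) => [|x]; last exact: h0.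
  exact: measurableT_comp mh (@measurable_cons_cV R n).
by move=> t; apply: integral_ge0 => x _; exact: h0.
Qed.

End lebesgue_translation.

Lemma mulIe (R : realType) (c x y : \bar R) :
  c \is a fin_num -> (0 < c -> x * c = y * c -> x = y)%E.
Proof.
move=> cfin c0 E; apply/eqP.
by rewrite eq_le -(lee_pmul2r cfin c0) -[X in _ && X](lee_pmul2r cfin c0) E lexx.
Qed.

(** * Uniqueness of translation-invariant measures up to a factor *)

Section haar_uniqueness.
Context d (T : measurableType d) (R : realType) (n : nat).
Local Open Scope ereal_scope.
Local Notation leb := (lebesgue_cV R).
Variables (nu : {sigma_finite_measure set T -> \bar R}) (pi : T -> 'cV[R]_n).
Hypothesis mpi : measurable_fun setT pi.
Hypothesis pi_shift : forall (v : 'cV[R]_n) (h : 'cV[R]_n -> \bar R),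
  measurable_fun setT h -> (forall x, 0 <= h x) ->
  \int[nu]_t h (v + pi t)%R = \int[nu]_t h (pi t).

(* Both sides are the double integral of h(x + y) 1_B(y) against the image of
   nu in x and Lebesgue measure in y, one variable being translated away. *)
Lemma translation_invariant_unique (B : set 'cV[R]_n) (h : 'cV[R]_n -> \bar R) :
  measurable B -> (forall x, B x -> B (- x)%R) ->
  measurable_fun setT h -> (forall x, 0 <= h x) ->
  (\int[nu]_t h (pi t)) * leb n B = (\int[leb n]_x h x) * nu (pi @^-1` B).
Proof.
move=> mB symB mh h0.
have mI : measurable_fun setT (fun x : 'cV[R]_n => (\1_B x)%:E : \bar R).
  exact/measurable_EFinP/measurable_indic.
have symI x : \1_B (- x)%R = \1_B x :> R.
  rewrite !indicE; congr ((_ : bool)%:R); apply/idP/idP; rewrite !inE => /symB//.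
  by rewrite opprK.
pose k p : \bar R := h (p.2 + pi p.1)%R * (\1_B p.2)%:E.
have mk : measurable_fun setT (k : T * 'cV[R]_n -> _).
  apply: emeasurable_funM; last exact: measurableT_comp mI measurable_snd.
  apply: measurableT_comp mh _; apply: measurable_cVD; first exact: measurable_snd.
  exact: measurableT_comp mpi measurable_fst.
have k0 p : 0 <= k p by rewrite mule_ge0 ?h0 ?lee_fin.
have mhv v : measurable_fun setT (fun x : 'cV[R]_n => h (x + v)%R).
  by apply: measurableT_comp mh _; apply: measurable_cVD => //; exact: measurable_cst.
have mvh v : measurable_fun setT (fun x : 'cV[R]_n => h (v + x)%R).
  by apply: measurableT_comp mh _; apply: measurable_cVD => //; exact: measurable_cst.
have mhpi : measurable_fun setT (fun t => h (pi t)) by exact: measurableT_comp.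
transitivity (\int[leb n]_y \int[nu]_t k (t, y)).
  rewrite /k/=; under [RHS]eq_integral => y _.
    rewrite ge0_integralZr//; last exact: measurableT_comp (mvh y) mpi.
    rewrite pi_shift//.
    over.
  rewrite ge0_integralZl//; last first.
  - exact: integral_ge0.
  - by rewrite integral_indic// setIT.
rewrite -fubini_tonelli//.
(* Replacing y by y - pi t puts all of the shift into the indicator; the symmetry of [B] turns y -
   pi t into pi t - y, which is a translate of pi t and so is covered by [pi_shift]. *)
transitivity (\int[nu]_t \int[leb n]_y (h y * (\1_B (pi t - y)%R)%:E)).
  apply: eq_integral => t _; rewrite /k/=.
  rewrite -[LHS](@integral_lebesgue_cV_shift _ _ (- pi t)%R); last 2 first.
  - by apply: emeasurable_funM => //; exact: mhv.
  - by move=> x; rewrite mule_ge0 ?h0 ?lee_fin.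
  apply: eq_integral => y _.
  by rewrite addrAC addNr add0r -symI opprD opprK.
rewrite (fubini_tonelli (fun p : T * 'cV[R]_n => h p.2 * (\1_B (pi p.1 - p.2)%R)%:E)).
- transitivity (\int[leb n]_y (h y * \int[nu]_t (\1_B (pi t))%:E)).
    apply: eq_integral => y _; rewrite /= ge0_integralZl//; last first.
      by apply: measurableT_comp mI _; apply: measurable_cVB.
    by under eq_integral do rewrite addrC; rewrite (pi_shift (- y)%R mI).
  rewrite ge0_integralZr//; last first.
    by apply: integral_ge0 => t _; rewrite lee_fin.
  congr (_ * _); rewrite -[X in nu X]setIT -integral_indic//.
  by rewrite -(setTI (_ @^-1` _)); exact: mpi.
- apply: emeasurable_funM; first exact: measurableT_comp mh measurable_snd.
  apply: measurableT_comp mI _; apply: measurable_cVB; last exact: measurable_snd.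
  exact: measurableT_comp mpi measurable_fst.
- by move=> p; rewrite mule_ge0 ?h0 ?lee_fin.
Qed.

End haar_uniqueness.

(** * Euclidean balls, invariance under rotation, behaviour under scaling *)

Section euclidean_norm.
Variable R : realType.

Definition nsq n (x : 'cV[R]_n) : R := \sum_i x i ord0 ^+ 2.

Lemma nsq_ge0 n (x : 'cV[R]_n) : 0 <= nsq x.
Proof. by apply: sumr_ge0 => i _; exact: sqr_ge0. Qed.

Lemma enorm_sqr n (x : 'cV[R]_n) : enorm x ^+ 2 = nsq x.
Proof. by rewrite sqr_sqrtr// nsq_ge0. Qed.

Lemma nsqE n (x : 'cV[R]_n) : nsq x = (x^T *m x) ord0 ord0.
Proof. by rewrite mxE; apply: eq_bigr => i _; rewrite mxE expr2. Qed.

Lemma nsqN n (x : 'cV[R]_n) : nsq (- x) = nsq x.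
Proof. by apply: eq_bigr => i _; rewrite mxE sqrrN. Qed.

Lemma nsqZ n a (x : 'cV[R]_n) : nsq (a *: x) = a ^+ 2 * nsq x.
Proof. by rewrite /nsq mulr_sumr; apply: eq_bigr => i _; rewrite mxE exprMn. Qed.

Lemma nsq0 n : nsq (0 : 'cV[R]_n) = 0.
Proof. by rewrite /nsq big1// => i _; rewrite mxE expr0n. Qed.

Lemma coor_nsq n (x : 'cV[R]_n) i : x i ord0 ^+ 2 <= nsq x.
Proof.
by rewrite /nsq (bigD1 i)//= lerDl sumr_ge0// => j _; exact: sqr_ge0.
Qed.

Lemma nsq_orthogonal m n (A : 'M[R]_(m, n)) (x : 'cV[R]_n) :
  A^T *m A = 1%:M -> nsq (A *m x) = nsq x.
Proof. by move=> AA; rewrite !nsqE trmx_mul mulmxA -(mulmxA x^T) AA mulmx1. Qed.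

Lemma nsq_col_mx k l (y : 'cV[R]_k) (z : 'cV[R]_l) :
  nsq (col_mx y z) = nsq y + nsq z.
Proof. by rewrite !nsqE tr_col_mx mul_row_col mxE. Qed.

Lemma measurable_nsq n : measurable_fun setT (@nsq n).
Proof.
apply: measurable_sum => i; apply: measurable_funX; exact: measurable_coor.
Qed.

End euclidean_norm.

Section lebesgue_ball.
Variables (R : realType) (n : nat).
Local Open Scope ereal_scope.
Local Notation leb := (lebesgue_cV R).

(** Two reference sets for the uniqueness argument: the cube has an explicit volume at every scale,
    the ball is preserved by orthogonal maps. In [cball] the parameter is the squared radius. *)
Definition cube (r : R) : set 'cV[R]_n := [set x | forall i, (`|x i ord0| <= r)%R].
Definition cball (r : R) : set 'cV[R]_n := [set x | (nsq x <= r)%R].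

Lemma measurable_cube r : measurable (cube r).
Proof.
rewrite (_ : cube r = \bigcap_(i in [set: 'I_n])
    ((fun x : 'cV[R]_n => x i ord0) @^-1` [set` `[- r, r]%R])).
  apply: fin_bigcap_measurable => // i _; rewrite -[X in measurable X]setTI.
  by apply: measurable_coor => //; exact: measurable_itv.
apply/seteqP; split=> x /= h i; first by move=> _; rewrite /= in_itv/= -ler_norml.
by have := h i I; rewrite /= in_itv/= -ler_norml.
Qed.

Lemma measurable_cball r : measurable (cball r).
Proof.
rewrite (_ : cball r = setT `&` (@nsq R n) @^-1` [set` `]-oo, r]%R]).
  by apply: measurable_nsq => //; exact: measurable_itv.
by rewrite setTI; apply/seteqP; split=> x /=; rewrite in_itv.
Qed.

Lemma lebesgue_cube r : (0 <= r)%R -> leb n (cube r) = ((2 * r) ^+ n)%:E.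
Proof.
move=> r0; have := @lebesgue_cV_box R n (const_mx (- r)%R) (const_mx r).
under [in RHS]eq_bigr do rewrite !mxE.
rewrite prodr_const card_ord opprK -mulr2n mulr_natl => <-.
  by congr (leb n _); apply/seteqP; split=> x /= h i; have := h i;
    rewrite !mxE in_itv/= ler_norml.
by move=> i; rewrite !mxE; lra.
Qed.

Lemma lebesgue_cball_lty r : leb n (cball r) < +oo.
Proof.
have [r0|r0] := ltP r 0%R.
  rewrite (_ : cball r = set0) ?measure0//; apply/seteqP; split=> x //=.
  by rewrite /cball/= leNgt (lt_le_trans r0)// nsq_ge0.
apply: (@le_lt_trans _ _ (leb n (cube (Num.sqrt r)))).
  apply: le_measure; rewrite ?inE; [exact: measurable_cball|exact: measurable_cube|].
  move=> x xr i; rewrite -sqrtr_sqr ler_sqrt//.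
  exact: le_trans (coor_nsq _ _) xr.
by rewrite lebesgue_cube ?sqrtr_ge0// ltry.
Qed.

Lemma cball_ge_cube r : (0 < r)%R ->
  exists2 s : R, (0 < s)%R & cube s `<=` cball r.
Proof.
move=> r0; have r1 : (0 < r / n.+1%:R)%R by rewrite divr_gt0.
(* Each of the n squared coordinates is at most r / (n + 1); the denominator n + 1 also covers n =
   0. *)
exists (Num.sqrt (r / n.+1%:R)); first by rewrite sqrtr_gt0.
move=> x xs; rewrite /cball/= /nsq.
apply: (@le_trans _ _ (\sum_(i < n) r / n.+1%:R)%R).
  apply: ler_sum => i _; rewrite -real_normK ?num_real//.
  by rewrite -[leRHS](sqr_sqrtr (ltW r1)) ler_pXn2r// nnegrE sqrtr_ge0.
rewrite sumr_const card_ord -[leLHS]mulr_natr mulrAC ler_pdivrMr// ler_pM2l// ler_nat.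
exact: leqnSn.
Qed.

Lemma lebesgue_cball_gt0 r : (0 < r)%R -> 0 < leb n (cball r).
Proof.
move=> /cball_ge_cube[s s0 sr]; apply: (@lt_le_trans _ _ (leb n (cube s))).
  by rewrite lebesgue_cube ?ltW// lte_fin exprn_gt0// mulr_gt0.
by apply: le_measure; rewrite ?inE//; [exact: measurable_cube|exact: measurable_cball].
Qed.

End lebesgue_ball.

Section lebesgue_rotation.
Variable R : realType.
Local Open Scope ereal_scope.
Local Notation leb := (lebesgue_cV R).

Lemma cons_cV_col_mx k l (t : R) (y : 'cV[R]_k) (z : 'cV[R]_l) :
  col_mx (cons_cV (t, y)) z = cons_cV (t, col_mx y z) :> 'cV[R]_(k + l).+1.
Proof.
apply/matrixP => i j; rewrite !ord1 /cons_cV.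
case: (@splitP k.+1 l i) => i' ii'.
  rewrite (_ : i = lshift l i'); last exact: val_inj.
  rewrite (@col_mxEu _ k.+1) {ii' i}; case: (@splitP 1 k i') => i ii'.
    rewrite (_ : i' = lshift k i); last exact: val_inj.
    rewrite (@col_mxEu _ 1) (_ : lshift l (lshift k i) = lshift (k + l) i); last exact: val_inj.
    by rewrite (@col_mxEu _ 1).
  rewrite (_ : i' = rshift 1 i); last exact: val_inj.
  rewrite (@col_mxEd _ 1) (_ : lshift l (rshift 1 i) = rshift 1 (lshift l i)); last exact: val_inj.
  by rewrite (@col_mxEd _ 1) col_mxEu.
rewrite (_ : i = rshift k.+1 i'); last exact: val_inj.
rewrite (@col_mxEd _ k.+1) (_ : rshift k.+1 i' = rshift 1 (rshift k i')); last exact: val_inj.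
by rewrite (@col_mxEd _ 1) col_mxEd.
Qed.

Lemma measurable_col_mx d (T : measurableType d) k l
    (f : T -> 'cV[R]_k) (g : T -> 'cV[R]_l) :
  measurable_fun setT f -> measurable_fun setT g ->
  measurable_fun setT (fun t => col_mx (f t) (g t)).
Proof.
move=> mf mg; apply/measurable_fun_coorP => i; case: (splitP i) => j ij.
  rewrite (_ : i = lshift l j); last exact: val_inj.
  by under eq_fun do rewrite col_mxEu; exact: measurable_fun_coor.
rewrite (_ : i = rshift k j); last exact: val_inj.
by under eq_fun do rewrite col_mxEd; exact: measurable_fun_coor.
Qed.

Lemma integral_col_mx k l (h : 'cV[R]_(k + l) -> \bar R) :
  measurable_fun setT h -> (forall x, 0 <= h x) ->
  \int[leb (k + l)]_x h x = \int[leb k]_y \int[leb l]_z h (col_mx y z).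
Proof.
elim: k h => [|k IH] h mh h0.
  rewrite [RHS]integral_dirac//; last first.
    apply: (measurable_fun_fubini_tonelli_F
      (fun p : 'cV[R]_0 * 'cV[R]_l => h (col_mx p.1 p.2))) => //.
    apply: measurableT_comp mh _.
    by apply: measurable_col_mx; [exact: measurable_fst|exact: measurable_snd].
  rewrite diracT mul1e; apply: eq_integral => x _; congr h.
  apply/matrixP => i j; rewrite ord1 -[in RHS](_ : rshift 0 i = i); last exact: val_inj.
  by rewrite (@col_mxEd _ 0).
have mc2 t : measurable_fun setT
    (fun p : 'cV[R]_k * 'cV[R]_l => h (col_mx (cons_cV (t, p.1)) p.2)).
  apply: measurableT_comp mh _; apply: measurable_col_mx; last exact: measurable_snd.
  apply: measurableT_comp (@measurable_cons_cV R k) _.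
  by apply: measurable_fun_pair; [exact: measurable_cst|exact: measurable_fst].
rewrite [LHS](@integral_lebesgue_cVS R (k + l) h mh h0).
rewrite integral_lebesgue_cVS; last 2 first.
- apply: (measurable_fun_fubini_tonelli_F
    (fun p : 'cV[R]_k.+1 * 'cV[R]_l => h (col_mx p.1 p.2))) => //.
  apply: measurableT_comp mh _.
  by apply: measurable_col_mx; [exact: measurable_fst|exact: measurable_snd].
- by move=> x; apply: integral_ge0.
apply: eq_integral => t _; rewrite IH.
- apply: eq_integral => y _; apply: eq_integral => z _.
  by rewrite cons_cV_col_mx.
- apply: measurableT_comp mh _; apply: measurableT_comp (@measurable_cons_cV R _) _.
  exact: measurable_pair1.
- by move=> x; exact: h0.
Qed.

Lemma cube_sym n r (x : 'cV[R]_n) : cube r x -> cube r (- x)%R.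
Proof. by move=> h1 i; rewrite mxE normrN. Qed.

Lemma cball_sym n r (x : 'cV[R]_n) : cball r x -> cball r (- x)%R.
Proof. by rewrite /cball/= nsqN. Qed.

(** The image of Lebesgue measure under [W] is again translation invariant, hence proportional to
    it. The factor is 1 because [W] preserves the unit ball, whose volume is positive and finite. *)
Lemma integral_orthogonal n (W : 'M[R]_n) (h : 'cV[R]_n -> \bar R) :
  orthogonal_mx W -> measurable_fun setT h -> (forall x, 0 <= h x) ->
  \int[leb n]_x h (W *m x) = \int[leb n]_x h x.
Proof.
move=> oW mh h0; have oW' := mulmx1C oW.
have mc : measurable_fun setT (fun x : 'cV[R]_n => W *m x) by exact: measurable_mulmx.
have pis (v : 'cV[R]_n) (h' : 'cV[R]_n -> \bar R) :
  measurable_fun setT h' -> (forall x, 0 <= h' x) ->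
  \int[leb n]_t h' (v + W *m t)%R = \int[leb n]_t h' (W *m t).
  move=> mh' h'0.
  rewrite -(integral_lebesgue_cV_shift (W^T *m v) (h := fun x => h' (W *m x)))//.
    by apply: eq_integral => x _; rewrite mulmxDr mulmxA oW' mul1mx.
  exact: measurableT_comp.
have := translation_invariant_unique mc pis (@measurable_cball R n 1) (@cball_sym n 1) mh h0.
rewrite (_ : _ @^-1` _ = cball 1); last first.
  by apply/seteqP; split=> x; rewrite /cball/= nsq_orthogonal.
apply: mulIe; last exact: lebesgue_cball_gt0.
by rewrite ge0_fin_numE// lebesgue_cball_lty.
Qed.

(** Tonelli in the rotated coordinates (y, z). Passages between the full space and the active and
    inactive variables rest on it. *)
Lemma integral_recombine k l n (hkl : (k + l)%N = n)
    (W1 : 'M[R]_(n, k)) (W2 : 'M[R]_(n, l)) (h : 'cV[R]_n -> \bar R) :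
  orthogonal_mx (castmx (erefl n, hkl) (row_mx W1 W2)) ->
  measurable_fun setT h -> (forall x, 0 <= h x) ->
  \int[leb n]_x h x = \int[leb k]_y \int[leb l]_z h (recombine W1 W2 y z).
Proof.
case: n / hkl W1 W2 h => W1 W2 h; rewrite castmx_id => oW mh h0.
rewrite -(integral_orthogonal oW)// integral_col_mx//.
  by apply: eq_integral => y _; apply: eq_integral => z _; rewrite mul_row_col.
by apply: measurableT_comp mh _; exact: measurable_mulmx.
Qed.

(** Same uniqueness argument as for rotations, with the factor read off on the unit cube: its
    preimage is the cube of half-side 1/a. *)
Lemma integral_lebesgue_cVZ n (a : R) (h : 'cV[R]_n -> \bar R) : (0 < a)%R ->
  measurable_fun setT h -> (forall x, 0 <= h x) ->
  \int[leb n]_x h (a *: x)%R = (a^-1 ^+ n)%:E * \int[leb n]_x h x.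
Proof.
move=> a0 mh h0.
have mc : measurable_fun setT (fun x : 'cV[R]_n => a *: x)%R.
  by apply: measurable_cVZ => //; exact: measurable_cst.
have pis (v : 'cV[R]_n) (h' : 'cV[R]_n -> \bar R) :
  measurable_fun setT h' -> (forall x, 0 <= h' x) ->
  \int[leb n]_t h' (v + a *: t)%R = \int[leb n]_t h' (a *: t)%R.
  move=> mh' h'0.
  rewrite -(integral_lebesgue_cV_shift (a^-1 *: v)%R (h := fun x => h' (a *: x)%R))//.
    by apply: eq_integral => x _; rewrite scalerDr scalerA divff ?scale1r// gt_eqF.
  exact: measurableT_comp.
have := translation_invariant_unique mc pis (@measurable_cube R n 1) (@cube_sym n 1) mh h0.
have -> : (fun x : 'cV[R]_n => a *: x)%R @^-1` cube 1 = cube a^-1.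
  apply/seteqP; split=> x h1 i; have := h1 i; rewrite mxE normrM (gtr0_norm a0).
    by rewrite mulrC -ler_pdivlMr// div1r.
  by rewrite mulrC -ler_pdivlMr// div1r.
rewrite !lebesgue_cube ?invr_ge0 ?ltW// mulr1 exprMn mulrC EFinM muleA => H.
by rewrite [RHS]muleC; apply: mulIe H => //; rewrite lte_fin exprn_gt0.
Qed.

End lebesgue_rotation.

(** * Fundamental theorem of calculus for everywhere derivable functions *)

Section ftc_everywhere_derivable.
Variable R : realType.
Local Open Scope ereal_scope.
Local Notation mu := (@lebesgue_measure R).

Lemma is_derive_slope_lt (F : R -> R) (x f D : R) : (f < D)%R ->
  is_derive x 1%R F f ->
  exists2 d : R, (0 < d)%R & forall t, (x < t < x + d)%R -> (F t - F x <= D * (t - x))%R.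
Proof.
move=> fD [/cvg_ex[l Hl] E].
have lf : l = f by rewrite -E; apply/esym/cvg_lim.
rewrite {}lf in Hl.
have /cvgrPdist_lt/(_ (D - f)%R)[|d/= d0 Hd] := Hl; first by rewrite subr_gt0.
exists d => // t /andP[xt td].
have tx0 : (0 < t - x)%R by rewrite subr_gt0.
have /(_ _ _)/= := Hd (t - x)%R.
rewrite sub0r normrN (gtr0_norm tx0) scaler1 subrK => /(_ _ _).
have -> : (t - x < d)%R by lra.
rewrite gt_eqF// => /(_ isT isT); rewrite ltr_norml => /andP[H _].
have : ((t - x)^-1 * (F t - F x) <= D)%R by rewrite /GRing.scale/= in H; lra.
by rewrite mulrC ler_pdivrMr.
Qed.

(** Real induction on the end point. The inequality passes to the supremum [s] of the points where
    it holds because [F] is continuous at [s], and it extends beyond [s] because just to the right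
    [F] grows by at most [D s] per unit length while [v] is at least [D s]. *)
Lemma le_integral_of_lsc_majorant (F f D : R -> R) (v : R -> \bar R) (a b : R) :
  (a <= b)%R -> measurable_fun setT v -> (forall x, 0 <= v x) ->
  (forall x, (a <= x <= b)%R -> is_derive x 1%R F (f x)) ->
  (forall x, (a <= x <= b)%R -> (f x < D x)%R) ->
  (forall x, (a <= x <= b)%R -> exists2 d : R, (0 < d)%R &
    forall t, (x < t < x + d)%R -> (D x)%:E <= v t) ->
  (F b - F a)%:E <= \int[mu]_(x in `]a, b]) v x.
Proof.
move=> ab mv v0 dF fD Dv.
pose H t := \int[mu]_(x in `]a, t]) v x.
have mvD (A : set R) : measurable_fun A v by exact: measurable_funS mv.
have H_mono t s : (t <= s)%R -> H t <= H s.
  move=> ts; apply: ge0_subset_integral => //=; first exact: mvD.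
  by apply: subset_itvl; rewrite bnd_simp.
pose S := [set t | (a <= t <= b)%R /\ (F t - F a)%:E <= H t].
have Sa : S a.
  by split; rewrite ?lexx//= subrr integral_ge0.
have hS : has_sup S by split; [exists a|exists b => t [/andP[]]].
pose s := sup S.
have as_ : (a <= s)%R by exact: sup_ubound hS.2 _ Sa.
have sb : (s <= b)%R by apply: sup_le_ub; [exists a|move=> t [/andP[]]].
have Ss : S s.
  split; first by rewrite as_ sb.
  apply/lee_addgt0Pr => e e0.
  have [dFs _] : is_derive s 1%R F (f s) by apply: dF; rewrite as_ sb.
  have /cvgrPdist_lt/(_ e e0)[d/= d0 Hd] : {for s, continuous F}.
    by apply: differentiable_continuous; exact/derivable1_diffP.
  have [t St dt] := sup_adherent d0 hS.
  have ts : (t <= s)%R by exact: sup_ubound hS.2 _ St.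
  have : (`|F s - F t| < e)%R by apply: Hd; rewrite /ball_/= ger0_norm; rewrite ?subr_ge0//; rewrite -/s in dt; lra.
  move=> /ltr_normlW Fst.
  apply: (@le_trans _ _ ((F t - F a)%:E + e%:E)); first by rewrite -EFinD lee_fin; lra.
  by rewrite leeD2r//; apply: le_trans St.2 _; exact: H_mono.
have [sb'|] := ltP s b; last first.
  move=> bs; have <- : s = b by apply/eqP; rewrite eq_le sb.
  exact: Ss.2.
exfalso.
have asb : (a <= s <= b)%R by rewrite as_ sb.
have [d1 d10 H1] := Dv _ asb.
have [d2 d20 H2] := is_derive_slope_lt (fD _ asb) (dF _ asb).
pose e := Num.min (Num.min d1 d2) (b - s)%R.
have e0 : (0 < e)%R by rewrite !lt_min d10 d20 subr_gt0.
have [e1 [e2 e3]] : (e <= d1 /\ e <= d2 /\ e <= b - s)%R.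
  by rewrite /e; split; [|split]; rewrite !ge_min ?lexx ?orbT.
pose t := (s + e / 2)%R.
have st : (s < t)%R by rewrite /t; lra.
have : S t.
  split; first by rewrite /t; lra.
  have -> : H t = H s + \int[mu]_(x in `]s, t]) v x.
    rewrite /H -ge0_integral_setU//=.
    - congr (integral mu _ v); apply/seteqP; split=> x/=; rewrite !in_itv/=.
        by have [|] := leP x s; [left|right]; lra.
      by case; lra.
    - exact: mvD.
    - apply/disj_setPS => x []/=; rewrite !in_itv/=; lra.
  apply: (@le_trans _ _ ((F s - F a)%:E + (D s * (t - s))%:E)).
    rewrite -EFinD lee_fin; have := H2 t; have -> : (s < t < s + d2)%R by rewrite /t; lra.
    by move=> /(_ isT); lra.
  apply: leeD; first exact: Ss.2.
  (* A negative slope bound needs no help from [v], which is nonnegative. *)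
  have [Ds0|Ds0] := leP 0%R (D s); last first.
    apply: (@le_trans _ _ 0); last exact: integral_ge0.
    by rewrite lee_fin mulr_le0_ge0 ?ltW ?subr_gt0.
  have -> : (D s * (t - s))%:E = \int[mu]_(x in `]s, t]) cst (D s)%:E x.
    by rewrite integral_cst//= lebesgue_measure_itv/= lte_fin st -EFinB EFinM.
  apply: ge0_le_integral => //=.
  - exact: mvD.
  - move=> x xst; apply: H1; have : (s < x <= t)%R by move: xst; rewrite ?inE/= ?in_itv/=.
    by rewrite /t; lra.
by move=> /(sup_ubound hS.2); rewrite leNgt -/s st.
Qed.

(** The sum is e times the number of levels e, 2e, ..., ne lying below y. The second bound serves
    the induction: when the level (n + 1)e is reached, the earlier terms amount to at most ne. *)
Lemma sum_level_le (e y : R) n : (0 <= e)%R -> (0 <= y)%R ->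
  (\sum_(j < n) e * (j.+1%:R * e <= y)%R%:R <= y /\
   \sum_(j < n) e * (j.+1%:R * e <= y)%R%:R <= n%:R * e)%R.
Proof.
move=> e0 y0; elim: n => [|n [IH1 IH2]]; first by rewrite big_ord0 mul0r.
rewrite big_ord_recr/=; set s := (\sum_(j < n) _)%R in IH1 IH2 *.
have ne : (n.+1%:R * e = n%:R * e + e)%R by rewrite -natr1 mulrDl mul1r.
by case: (leP (n.+1%:R * e)%R y) => H; rewrite ?mulr1 ?mulr0; lra.
Qed.

(* Layer-cake cover: V_j is an open set slightly larger than the level set
   {g >= (j+1)e}, so that e sum_j 1_{V_j} + 2e majorizes f + e near every
   point while its integral barely exceeds that of g. *)
Lemma le_integral_of_derivative_le (F f g : R -> R) (a b : R) :
  (a <= b)%R -> measurable_fun `[a, b] g -> (forall x, 0 <= g x)%R ->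
  (forall x, (a <= x <= b)%R -> is_derive x 1%R F (f x)) ->
  (forall x, (a <= x <= b)%R -> (f x <= g x)%R) ->
  (F b - F a)%:E <= \int[mu]_(x in `[a, b]) (g x)%:E.
Proof.
move=> ab mg g0 dF fg.
have mI : measurable (`[a, b]%classic : set (measurableTypeR R)) by exact: measurable_itv.
(* The error has two sources: the open sets [V j] exceed the level sets by measures at most
   2^-(j+1), which weighted by e add up to e, and the constant 2e contained in [v] integrates to
   2e(b - a). *)
suff key (e : R) : (0 < e)%R -> (F b - F a)%:E <=
    \int[mu]_(x in `[a, b]) (g x)%:E + (e * (1 + 2 * (b - a)))%:E.
  apply/lee_addgt0Pr => e e0.
  have c0 : (0 < 1 + 2 * (b - a))%R by lra.
  by have := key (e / (1 + 2 * (b - a)))%R; rewrite divfK ?gt_eqF//; apply; exact: divr_gt0.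
move=> e0.
pose E (j : nat) := `[a, b] `&` [set x | (j.+1%:R * e <= g x)%R].
have mE j : measurable (E j : set (measurableTypeR R)).
  rewrite /E (_ : [set x | _] = g @^-1` [set` `[(j.+1%:R * e)%R, +oo[]).
    by apply: mg => //; exact: measurable_itv.
  by apply/seteqP; split=> x /=; rewrite in_itv/= andbT.
have Eoo j : mu (E j) < +oo.
  apply: (@le_lt_trans _ _ (mu `[a, b])).
    by apply: le_measure; rewrite ?inE//; exact: subIsetl.
  by rewrite lebesgue_measure_itv/=; case: ifP; rewrite ?ltry// -EFinB ltry.
have /choice[V HV] j : exists U : set R, [/\ open U, E j `<=` U &
    mu (U `\` E j) < (1 / (2 ^ j.+1)%:R)%:E].
  by apply: lebesgue_regularity_outer; [exact: mE|exact: Eoo|rewrite divr_gt0// ltr0n expn_gt0].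
have mV j : measurable (V j : set (measurableTypeR R)).
  by have [oV _ _] := HV j; exact: open_measurable.
pose u (j : nat) (x : measurableTypeR R) : \bar R := (e * \1_(V j) x)%:E.
have u0 j x : 0 <= u j x by rewrite lee_fin mulr_ge0// ltW.
have mu_ j : measurable_fun setT (u j).
  by apply/measurable_EFinP; apply: measurable_funM => //; exact: measurable_indic.
pose v x := (\sum_(j <oo) u j x) + (2 * e)%:E.
have muS : measurable_fun setT (fun x => \sum_(j <oo) u j x).
  by apply: ge0_emeasurable_sum => //.
have v0 x : 0 <= v x.
  by rewrite adde_ge0 ?nneseries_ge0// lee_fin mulr_ge0// ltW.
have mv : measurable_fun setT v by apply: emeasurable_funD.
apply: (@le_trans _ _ (\int[mu]_(x in `]a, b]) v x)).
  apply: (@le_integral_of_lsc_majorant F f (fun x => f x + e)%R) => //.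
    by move=> x _; lra.
  (* [x] lies in the level sets of index below [k], hence the corresponding open sets contain a
     common neighbourhood of [x], on which v is at least ke + 2e. Since g x < (k + 1)e, this exceeds
     f x + e. *)
  move=> x axb; pose k := Num.truncn (g x / e)%R.
  have /andP[k1 k2] : (k%:R <= g x / e < k.+1%:R)%R.
    by apply: truncn_itv; rewrite divr_ge0// ltW.
  have Vx (j : 'I_k) : \forall t \near x, V j t.
    have [oV EV _] := HV j; apply: open_nbhs_nbhs; split => //; apply: EV.
    split; first by rewrite /= in_itv.
    rewrite /= -ler_pdivlMr//; apply: le_trans k1.
    by rewrite ler_nat.
  have /nbhs_ballP[d/= d0 Hd] : \forall t \near x, forall j : 'I_k, V j t.
    exact: filter_forall Vx.
  exists d => // t /andP[xt td].
  have Vt : forall j : 'I_k, V j t by apply: Hd; rewrite /ball/= ltr0_norm; lra.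
  apply: (@le_trans _ _ ((k%:R * e)%:E + (2 * e)%:E)).
    rewrite -EFinD lee_fin; have := fg _ axb.
    move: k2; rewrite ltr_pdivrMr// -natr1 mulrDl mul1r; lra.
  rewrite leeD2r//; apply: le_trans (nneseries_lim_ge k _) => //.
  rewrite big_mkord (eq_bigr (fun=> e%:E)); last first.
    by move=> j _; rewrite /u indicE mem_set ?mulr1//; exact: Vt.
  by rewrite sumEFin sumr_const card_ord mulr_natl.
rewrite integral_itv_obnd_cbnd//; last exact: measurable_funS mv.
rewrite ge0_integralD//=; last 3 first.
- by move=> x _; rewrite nneseries_ge0.
- exact: measurable_funS muS.
- by move=> x _; rewrite lee_fin mulr_ge0// ltW.
rewrite integral_cst//= integral_nneseries//; last first.
  by move=> j; exact: measurable_funS (mu_ j).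
have -> : mu `[a, b] = (b - a)%:E.
  rewrite lebesgue_measure_itv/= lte_fin; move: ab; rewrite le_eqVlt => /predU1P[->|->].
    by rewrite ltxx subrr.
  by rewrite EFinB.
have -> : (e * (1 + 2 * (b - a)))%:E = e%:E + (2 * e)%:E * (b - a)%:E.
  by rewrite -EFinM -EFinD; congr EFin; ring.
rewrite addeA leeD2r//.
have intu j : \int[mu]_(x in `[a, b]) u j x <= e%:E * mu (E j) + (e / (2 ^ j.+1)%:R)%:E.
  rewrite /u; under eq_integral do rewrite EFinM.
  rewrite ge0_integralZl//; last 2 first.
  - by apply/measurable_EFinP; exact: measurable_indic.
  - by rewrite lee_fin ltW.
  rewrite integral_indic// EFinM -ge0_muleDr ?lee_fin ?invr_ge0 ?ler0n//.
  rewrite lee_pmul2l//.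
  have [_ _ Vj] := HV j.
  apply: (@le_trans _ _ (mu (E j `|` (V j `\` E j)))).
    apply: le_measure; rewrite ?inE//.
    - exact: measurableI.
    - by apply: measurableU => //; exact: measurableD.
    - by move=> x [Vx _]; have [|] := pselect (E j x); [left|right].
  rewrite measureU//; last 2 first.
  - exact: measurableD.
  - by apply/seteqP; split=> x [] // ? [].
  by rewrite div1r in Vj; rewrite leeD2l//; exact: ltW.
apply: le_trans (lee_nneseries _ (fun j _ => intu j)) _ => //.
  by move=> j _ _; apply: integral_ge0 => x _; exact: u0.
apply: le_trans (@epsilon_trick R (fun j => e%:E * mu (E j)) e xpredT _ _) _.
- by move=> j; rewrite mule_ge0// lee_fin ltW.
- exact: ltW.
rewrite leeD2r//.
rewrite [leLHS](_ : _ = \int[mu]_(x in `[a, b]) \sum_(j <oo) (e * \1_(E j) x)%:E); last first.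
  rewrite integral_nneseries//.
  - apply: eq_eseriesr => j _; under eq_integral do rewrite EFinM.
    rewrite ge0_integralZl//; last 2 first.
    + by apply/measurable_EFinP; exact: measurable_indic.
    + by rewrite lee_fin ltW.
    by rewrite integral_indic// setIidl//; exact: subIsetl.
  - by move=> j; apply/measurable_EFinP; apply: measurable_funM => //; exact: measurable_indic.
  - by move=> j x _; rewrite lee_fin mulr_ge0// ltW.
apply: ge0_le_integral => //.
- by move=> x _; apply: nneseries_ge0 => j _ _; rewrite lee_fin mulr_ge0// ltW.
- apply: ge0_emeasurable_sum => //.
    by move=> j x _ _; rewrite lee_fin mulr_ge0// ltW.
  by move=> j _; apply/measurable_EFinP; apply: measurable_funM => //; exact: measurable_indic.
- exact/measurable_EFinP.
move=> x axb; apply: lime_le; first by apply: is_cvg_nneseries => j _ _; rewrite lee_fin mulr_ge0// ltW.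
apply: nearW => n; rewrite big_mkord sumEFin lee_fin.
rewrite (eq_bigr (fun j : 'I_n => e * (j.+1%:R * e <= g x)%R%:R)%R).
  by have [] := @sum_level_le e (g x) n (ltW e0) (g0 x).
move=> j _; congr (_ * _)%R; rewrite indicE; congr ((_ : bool)%:R).
by apply/idP/idP; rewrite inE; [case|split].
Qed.

(** Adding M x to [F] gives the derivative f + M, which is bounded by the nonnegative function max(f
    + M, 0). This exceeds f + M by [r M], whose integral tends to 0 by dominated convergence as M
    grows. *)
Lemma le_Rintegral_derivative (F f : R -> R) (a b : R) :
  (a <= b)%R -> (forall x, (a <= x <= b)%R -> is_derive x 1%R F (f x)) ->
  mu.-integrable `[a, b] (EFin \o f) ->
  (F b - F a)%:E <= \int[mu]_(x in `[a, b]) (f x)%:E.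
Proof.
move=> ab dF intf.
have mI : measurable (`[a, b]%classic : set (measurableTypeR R)) by exact: measurable_itv.
have mf : measurable_fun `[a, b] f by have /integrableP[/measurable_EFinP] := intf.
have muI : mu `[a, b] = (b - a)%:E.
  rewrite lebesgue_measure_itv/= lte_fin; move: ab; rewrite le_eqVlt => /predU1P[->|->].
    by rewrite ltxx subrr.
  by rewrite EFinB.
pose r (M : nat) (x : measurableTypeR R) : \bar R := (Num.max (- f x - M%:R) 0)%:E.
have mr M : measurable_fun `[a, b] (r M).
  apply/measurable_EFinP; apply: measurable_maxr; last exact: measurable_cst.
  by apply: measurable_funB; [exact: measurableT_comp|exact: measurable_cst].
have r_ub M x : `|r M x| <= `|(f x)%:E|.
  rewrite /r abse_EFin lee_fin ger0_norm ?le_max ?lexx ?orbT// ge_max normr_ge0 andbT.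
  by rewrite -normrN (le_trans _ (ler_norm _))// gerBl.
have intr M : mu.-integrable `[a, b] (r M).
  apply: (le_integrable mI (mr M) _ intf) => x _; exact: r_ub.
have rlim : \int[mu]_(x in `[a, b]) r M x @[M --> \oo] --> 0.
  rewrite (_ : 0 = \int[mu]_(x in `[a, b]) cst 0 x); last by rewrite integral0.
  apply: (@dominated_cvg _ _ _ mu _ mI r (cst 0) (fun x => `|(f x)%:E|)) => //.
  - move=> x _; apply: cvg_near_cst; near=> M; rewrite /r.
    have -> // : Num.max (- f x - M%:R)%R 0%R = 0%R.
    apply/max_idPr; rewrite subr_le0; near: M; exact: nbhs_infty_ger.
  - exact: integrable_abse.
have key M : (F b - F a)%:E <= \int[mu]_(x in `[a, b]) (f x)%:E + \int[mu]_(x in `[a, b]) r M x.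
  rewrite -(leeD2rE (x := (M%:R * (b - a))%:E))// -addeA (addeC (\int[mu]_(x in _) r M x)).
  have intc : mu.-integrable `[a, b] (EFin \o cst M%:R : measurableTypeR R -> _).
    apply: measurable_bounded_integrable => //; last exact: bounded_cst.
    by have := ltry (b - a)%R; rewrite -muI.
  have cstE : \int[mu]_(x in `[a, b]) (EFin \o cst M%:R) x = (M%:R * (b - a))%:E.
    by rewrite EFinM -muI -integral_cst.
  rewrite -[X in _ <= _ + (X + _)]cstE addeA -!integralD//; last exact: integrableD.
  rewrite [leRHS](_ : _ = \int[mu]_(x in `[a, b]) (Num.max (f x + M%:R) 0)%:E); last first.
    apply: eq_integral => x _; rewrite /r -!EFinD; congr EFin.
    by rewrite maxEle; case: ifPn; rewrite maxEle; case: ifPn; rewrite -?ltNge; lra.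
  rewrite -EFinD.
  have -> : (F b - F a + M%:R * (b - a) = (F b + M%:R * b) - (F a + M%:R * a))%R by ring.
  apply: (@le_integral_of_derivative_le (fun x => F x + M%:R * x)%R (fun x => f x + M%:R)%R) => //.
  - apply: measurable_maxr; last exact: measurable_cst.
    by apply: measurable_funD => //; exact: measurable_cst.
  - by move=> x; rewrite le_max lexx orbT.
  - move=> x /dF dFx; apply: is_deriveD.
    by rewrite -[X in is_derive _ _ _ X]mulr1; apply: is_deriveZ.
  - by move=> x _; rewrite le_max lexx.
have H : \int[mu]_(x in `[a, b]) (f x)%:E + \int[mu]_(x in `[a, b]) r M x @[M --> \oo] -->
    \int[mu]_(x in `[a, b]) (f x)%:E + 0.
  by apply: cvgeD => //; [exact: fin_num_adde_defl|exact: cvg_cst].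
rewrite -[leRHS]adde0; apply: (cvge_to_ge H).
exact: nearW.
Unshelve. all: end_near. Qed.

Lemma Rintegral_derivative (F f : R -> R) (a b : R) :
  (a <= b)%R -> (forall x, (a <= x <= b)%R -> is_derive x 1%R F (f x)) ->
  mu.-integrable `[a, b] (EFin \o f) ->
  \int[mu]_(x in `[a, b]) (f x)%:E = (F b - F a)%:E.
Proof.
move=> ab dF intf; apply/eqP; rewrite eq_le le_Rintegral_derivative// andbT.
have mI : measurable (`[a, b]%classic : set (measurableTypeR R)) by exact: measurable_itv.
have := @le_Rintegral_derivative (fun x => - F x)%R (fun x => - f x)%R a b ab.
under [X in _ -> _ -> _ <= X]eq_integral do rewrite EFinN.
rewrite [X in _ -> _ -> _ <= X]integralN; last exact: integrable_add_def.
move=> /(_ _ _)H; rewrite -leeN2; apply: le_trans (H _ _).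
- by rewrite -EFinN lee_fin; lra.
- by move=> x /dF dFx; exact: is_deriveN.
- exact: (integrableN intf).
Qed.

(** Cauchy-Schwarz on the unit interval in linearised form: with s = |F 1 - F 0|, each |f t| is at
    most (A t / s + s) / 2, so that measurability is asked of the majorant [A] only. Integrating
    yields s <= a / (2s) + s / 2, where a is the integral of [A]. *)
Lemma sqr_increment_le (F f : R -> R) (A : R -> R) :
  (forall t : R, (0 <= t <= 1)%R -> is_derive t 1%R F (f t)) ->
  (forall t, (0 <= t <= 1)%R -> (f t ^+ 2 <= A t)%R) ->
  (forall t, 0 <= A t)%R -> measurable_fun setT A ->
  ((F 1 - F 0) ^+ 2)%:E <= \int[mu]_(t in `[0%R, 1%R]) (A t)%:E.
Proof.
move=> dF fA A0 mAT; have mA : measurable_fun `[(0%R : R), 1%R] A by exact: measurable_funS mAT.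
set x := (F 1 - F 0)%R.
have IA0 : 0 <= \int[mu]_(t in `[0%R, 1%R]) (A t)%:E.
  by apply: integral_ge0 => t _; rewrite lee_fin.
have [->|x0] := eqVneq x 0%R; first by rewrite expr0n.
have [Aoo|] := ltP (\int[mu]_(t in `[0%R, 1%R]) (A t)%:E) +oo; last first.
  by rewrite leye_eq => /eqP ->; rewrite leey.
pose s := `|x|%R; have s0 : (0 < s)%R by rewrite normr_gt0.
pose g t := ((A t / s + s) / 2)%R.
have mg : measurable_fun `[(0%R : R), 1%R] g.
  by apply: measurable_funM => //; apply: measurable_funD => //; apply: measurable_funM.
have g0 t : (0 <= g t)%R by rewrite /g divr_ge0// addr_ge0 ?divr_ge0// ltW.
have fg t : (0 <= t <= 1)%R -> (`|f t| <= g t)%R.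
  move=> /fA fAt; rewrite /g ler_pdivlMr// -(ler_pM2r s0) mulrDl divfK ?gt_eqF//.
  rewrite -real_normK ?num_real// in fAt.
  by have := sqr_ge0 (`|f t| - s)%R; rewrite sqrrB; lra.
have xg : s%:E <= \int[mu]_(t in `[0%R, 1%R]) (g t)%:E.
  have [xp|xn] := leP 0%R x.
    rewrite /s ger0_norm//; apply: (@le_integral_of_derivative_le F f g) => //.
    by move=> t /fg; apply: le_trans; exact: ler_norm.
  rewrite /s ltr0_norm// (_ : - x = - F 1 - - F 0)%R; last by rewrite /x; ring.
  apply: (@le_integral_of_derivative_le (fun t => - F t)%R (fun t => - f t)%R g) => //.
  - by move=> t /dF dFt; exact: is_deriveN.
  - by move=> t /fg; apply: le_trans; rewrite -normrN; exact: ler_norm.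
have intg : \int[mu]_(t in `[0%R, 1%R]) (g t)%:E =
    ((2 * s)^-1)%:E * \int[mu]_(t in `[0%R, 1%R]) (A t)%:E + (s / 2)%:E.
  transitivity (\int[mu]_(t in `[0%R, 1%R]) (((2 * s)^-1 * A t)%:E + (s / 2)%:E)).
    apply: eq_integral => t _; rewrite -EFinD /g; congr EFin.
    by rewrite invfM mulrDl; ring.
  rewrite ge0_integralD//=.
  - rewrite integral_cst//= lebesgue_measure_itv/= lte01 oppr0 adde0 mule1.
    congr (_ + _); under eq_integral do rewrite EFinM.
    rewrite ge0_integralZl//.
    + exact/measurable_EFinP.
    + by move=> t _; rewrite lee_fin.
    + by rewrite lee_fin invr_ge0 mulr_ge0// ltW.
  - by move=> t _; rewrite lee_fin mulr_ge0// invr_ge0 mulr_ge0// ltW.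
  - by apply/measurable_EFinP; exact: measurable_funM.
  - by move=> t _; rewrite lee_fin divr_ge0// ltW.
move: xg; rewrite {}intg; have : \int[mu]_(t in `[0%R, 1%R]) (A t)%:E \is a fin_num.
  by rewrite ge0_fin_numE.
move=> /fineK <-; set a := fine _; rewrite -EFinM -EFinD !lee_fin => H.
have : (s * (2 * s) <= ((2 * s)^-1 * a + s / 2) * (2 * s))%R.
  by rewrite ler_pM2r// mulr_gt0.
have s20 : (2 * s != 0)%R by rewrite gt_eqF ?mulr_gt0.
have -> : (((2 * s)^-1 * a + s / 2) * (2 * s) = a + s ^+ 2)%R by field; exact: lt0r_neq0.
by rewrite -(real_normK (num_real x)) -/s; lra.
Qed.

End ftc_everywhere_derivable.

(** * Derivatives along lines, domination of integrals, Jensen's inequality *)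

Section directional_derivative.
Variable R : realType.

Lemma is_derive_line (V : normedModType R) (f : V -> R) (x v : V) (s a : R) :
  is_derive (x + s *: v) v f a -> is_derive s 1 (fun t : R => f (x + t *: v)) a.
Proof.
move=> [/cvg_ex[l Hl] E].
have la : l = a by rewrite -E; apply/esym/cvg_lim.
rewrite {}la {E} in Hl.
suff H : h^-1 *: (((fun t : R => f (x + t *: v)) \o shift s) (h *: 1) - f (x + s *: v)) @[h --> 0^'] --> a.
  by split; [apply/cvg_ex; exists a|apply/cvg_lim].
rewrite (_ : (fun h => _) = (fun h => h^-1 *: ((f \o shift (x + s *: v)) (h *: v) - f (x + s *: v))))//.
apply/funext => h /=; rewrite scaler1 scalerDl; congr (_ *: (f _ - _)).
by rewrite addrCA addrA.
Qed.

Lemma is_derive_quadratic (F : R -> R) (x A C : R) :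
  (forall h, `|F (x + h) - F x - A * h| <= C * h ^+ 2) -> is_derive x 1 F A.
Proof.
move=> H.
suff L : h^-1 *: ((F \o shift x) (h *: 1) - F x) @[h --> 0^'] --> A.
  by split; [apply/cvg_ex; exists A|apply/cvg_lim].
apply/cvgrPdist_le => e e0; near=> h.
have h0 : h != 0 by near: h; exact: nbhs_dnbhs_neq.
have hp : 0 < `|h| by rewrite normr_gt0.
rewrite /= scaler1 (addrC h) -(ler_pM2r hp) -normrM mulrBl.
rewrite {1}/GRing.scale/= mulrAC mulVf// mul1r distrC.
apply: le_trans (H h) _; rewrite -real_normK ?num_real// expr2 mulrA ler_pM2r//.
apply: (@le_trans _ _ (`|C| * `|h|)); first by rewrite ler_wpM2r// ler_norm.
apply: (@le_trans _ _ (`|C| * (e / (`|C| + 1)))).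
  by rewrite ler_wpM2l//; near: h; apply: dnbhs0_le; rewrite divr_gt0// ltr_wpDl.
rewrite mulrCA ler_piMr//; first exact: ltW.
by rewrite ler_pdivrMr ?ltr_wpDl// mul1r lerDl.
Unshelve. all: end_near. Qed.

(** Squaring the positive part removes its corner at 0, so that a compactly supported bump built
    from it is differentiable everywhere. *)
Definition pos_sqr (s : R) := Num.max 0 s ^+ 2.

Lemma is_derive_pos_sqr (s : R) : is_derive s 1 pos_sqr (2 * Num.max 0 s).
Proof.
apply: (@is_derive_quadratic _ _ _ 1) => h; rewrite /pos_sqr mul1r ler_norml.
rewrite !maxEle; have [H1|H1] := leP 0 (s + h); have [H2|H2] := leP 0 s;
  apply/andP; split.
all: rewrite ?expr0n/= ?mulr0 ?mul0r ?subr0.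
all: have := sqr_ge0 h; have := sqr_ge0 s; have := sqr_ge0 (s + h); nra.
Qed.

End directional_derivative.

(** Comparison straight from the definition of the integral as a supremum over simple functions. It
    therefore covers integrands not known to be measurable, such as the Hellinger distance as a
    function of the sample point. *)
Lemma ge0_le_integral_dom d (T : measurableType d) (R : realType)
    (mu : {measure set T -> \bar R}) (D : set T) (f g : T -> \bar R) :
  (forall x, D x -> 0 <= f x)%E -> (forall x, D x -> f x <= g x)%E ->
  (\int[mu]_(x in D) f x <= \int[mu]_(x in D) g x)%E.
Proof.
move=> f0 fg; rewrite !ge0_integralE//; last by move=> x Dx; exact: le_trans (f0 x Dx) (fg x Dx).
apply: ge_ereal_sup => _ [h /= hf <-]; apply: ereal_sup_ubound; exists h => // x /=.
apply: le_trans (hf x) _; rewrite /patch; case: ifPn => // xD.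
by apply: fg; rewrite inE in xD.
Qed.

Section jensen.
Local Open Scope ereal_scope.
Context d (T : measurableType d) (R : realType) (mu : {measure set T -> \bar R}).

(** Jensen for the square, obtained by expanding the integral of p (b - m)^2 at the mean m. When the
    right-hand side is finite, |b| <= 1 + b^2 makes p b integrable. *)
Lemma sqr_Rintegral_le (p b : T -> R) :
  measurable_fun setT p -> measurable_fun setT b -> (forall x, 0 <= p x)%R ->
  \int[mu]_x (p x)%:E = 1 ->
  (((\int[mu]_x (p x * b x))%R ^+ 2)%:E <= \int[mu]_x (p x * b x ^+ 2)%:E).
Proof.
move=> mp mb p0 p1.
have pb0 x : (0 <= p x * b x ^+ 2)%R by rewrite mulr_ge0// sqr_ge0.
have mpb2 : measurable_fun setT (fun x => p x * b x ^+ 2)%R.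
  by apply: measurable_funM => //; exact: measurable_funX.
have mpb : measurable_fun setT (fun x => p x * b x)%R by exact: measurable_funM.
have [Aoo|] := ltP (\int[mu]_x (p x * b x ^+ 2)%:E) +oo; last first.
  by rewrite leye_eq => /eqP ->; rewrite leey.
have ip : mu.-integrable setT (EFin \o p).
  apply/integrableP; split; first exact/measurable_EFinP.
  by under eq_integral do rewrite /= ger0_norm//; rewrite p1 ltry.
have ipb2 : mu.-integrable setT (EFin \o (fun x => p x * b x ^+ 2)%R).
  apply/integrableP; split; first exact/measurable_EFinP.
  by under eq_integral do rewrite /= ger0_norm//.
have ipb : mu.-integrable setT (EFin \o (fun x => p x * b x)%R).
  apply: (le_integrable measurableT _ _ (integrableD measurableT ip ipb2)).
    exact/measurable_EFinP.
  move=> x _; rewrite -[leRHS]/(`|(p x + p x * b x ^+ 2)%:E|) -[leLHS]/(`|(p x * b x)%:E|) !abse_EFin lee_fin.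
  rewrite normrM (ger0_norm (p0 x)) [X in (_ <= X)%R]ger0_norm ?addr_ge0//.
  rewrite -{2}(mulr1 (p x)) -mulrDr ler_wpM2l// -real_normK ?num_real//.
  by have := sqr_ge0 (`|b x| - 1)%R; rewrite sqrrB; have := normr_ge0 (b x); nra.
set m := (\int[mu]_x (p x * b x))%R.
have mE : \int[mu]_x (p x * b x)%:E = m%:E by rewrite /m /Rintegral fineK// integrable_fin_num.
have : 0 <= \int[mu]_x (p x * (b x - m) ^+ 2)%:E.
  by apply: integral_ge0 => x _; rewrite lee_fin mulr_ge0// sqr_ge0.
have -> : \int[mu]_x (p x * (b x - m) ^+ 2)%:E =
  \int[mu]_x ((p x * b x ^+ 2)%:E + ((- (2 * m))%:E * (p x * b x)%:E + (m ^+ 2)%:E * (p x)%:E)).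
  apply: eq_integral => x _; rewrite -!EFinM -!EFinD; congr EFin; ring.
have i1 := integrableZl measurableT (- (2 * m))%R ipb.
have i2 := integrableZl measurableT (m ^+ 2)%R ip.
rewrite integralD//; last exact: integrableD.
rewrite integralD// !integralZl// mE p1 mule1.
have : \int[mu]_x (p x * b x ^+ 2)%:E \is a fin_num by exact: integrable_fin_num.
by move=> /fineK <-; rewrite -!EFinM -!EFinD !lee_fin; lra.
Qed.

End jensen.

(** * Integration by parts and smoothing *)

Section integration_by_parts.
Variables (R : realType) (n : nat).
Local Open Scope ereal_scope.
Local Notation leb := (lebesgue_cV R n).
Local Notation mu := (@lebesgue_measure R).
Local Notation I01 := ([set` `[(0%R : R), 1%R]] : set (measurableTypeR R)).

Lemma is_derive_of_line (V : normedModType R) (f : V -> R) (x v : V) (a : R) :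
  is_derive (0%R : R) 1%R (fun t : R => f (x + t *: v)%R) a -> is_derive x v f a.
Proof.
move=> [/cvg_ex[l Hl] E].
have la : l = a by rewrite -E; apply/esym/cvg_lim.
rewrite {}la {E} in Hl.
suff H : (h^-1 *: ((f \o shift x) (h *: v) - f x))%R @[h --> 0^'%R] --> a.
  by split; [apply/cvg_ex; exists a|apply/cvg_lim].
rewrite (_ : (fun h => _) = (fun h : R => h^-1 *: (((fun t : R => f (x + t *: v)) \o shift 0) (h *: 1) - f (x + 0 *: v))))%R//.
by apply/funext => h /=; rewrite scaler1 addr0 scale0r addr0 (addrC x).
Qed.

Lemma integral_indicE d (T : measurableType d) (m : {measure set T -> \bar R})
    (D : set T) (f : T -> \bar R) :
  \int[m]_(x in D) f x = \int[m]_x (f x * (\1_D x)%:E).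
Proof. by rewrite integral_mkcond epatch_indic. Qed.

Lemma integral_line_shift (v : 'cV[R]_n) (h : 'cV[R]_n -> \bar R) :
  measurable_fun setT h -> (forall x, 0 <= h x) ->
  \int[leb]_w \int[mu]_(s in I01) h (w + s *: v)%R = \int[leb]_w h w.
Proof.
move=> mh h0.
under eq_integral do rewrite integral_indicE.
pose k (p : 'cV[R]_n * measurableTypeR R) := h (p.1 + p.2 *: v)%R * (\1_I01 p.2)%:E.
have mk : measurable_fun setT k.
  apply: emeasurable_funM.
    apply: measurableT_comp mh _; apply: measurable_cVD => //.
    by apply: measurable_cVZ => //; exact: measurable_cst.
  apply/measurable_EFinP; apply: measurableT_comp => //; exact: measurable_indic.
rewrite (fubini_tonelli k)//; last by move=> p; rewrite mule_ge0// lee_fin.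
rewrite /k/=.
under eq_integral => s _.
  rewrite ge0_integralZr//; last first.
    apply: measurableT_comp mh _; apply: measurable_cVD => //; exact: measurable_cst.
  under eq_integral do rewrite addrC.
  rewrite integral_lebesgue_cV_shift//.
  over.
rewrite ge0_integralZl//; last 2 first.
- by apply/measurable_EFinP; exact: measurable_indic.
- exact: integral_ge0.
by rewrite integral_indic// setIT [X in _ * X]lebesgue_measure_itv/= lte01 oppr0 adde0 mule1.
Qed.

Lemma measurable_integral_line (v : 'cV[R]_n) (h : 'cV[R]_n -> \bar R) :
  measurable_fun setT h -> (forall x, 0 <= h x) ->
  measurable_fun setT (fun w : 'cV[R]_n => \int[mu]_(s in I01) h (w + s *: v)%R).
Proof.
move=> mh h0; under eq_fun do rewrite integral_indicE.
apply: (measurable_fun_fubini_tonelli_F (fun p : 'cV[R]_n * measurableTypeR R =>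
  h (p.1 + p.2 *: v)%R * (\1_I01 p.2)%:E)).
  apply: emeasurable_funM.
    apply: measurableT_comp mh _; apply: measurable_cVD => //.
    by apply: measurable_cVZ => //; exact: measurable_cst.
  apply/measurable_EFinP; apply: measurableT_comp => //; exact: measurable_indic.
by move=> p; rewrite mule_ge0// lee_fin.
Qed.

(* Translation invariance makes the integral of H(x + v) - H(x) vanish, while by the
   fundamental theorem of calculus along lines it is also the integral of G. *)
Lemma integral_derivative0 (v : 'cV[R]_n) (H G : 'cV[R]_n -> R) :
  measurable_fun setT H -> measurable_fun setT G -> (forall x, 0 <= H x)%R ->
  \int[leb]_x (H x)%:E < +oo -> \int[leb]_x `|(G x)%:E| < +oo ->
  (forall w, is_derive w v H (G w)) ->
  \int[leb]_x (G x)%:E = 0.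
Proof.
move=> mH mG H0 Hoo Goo dH.
have mGE : measurable_fun setT (EFin \o G) by exact/measurable_EFinP.
have mGp := measurable_funepos mGE.
have mGm := measurable_funeneg mGE.
have mline (h : 'cV[R]_n -> \bar R) w : measurable_fun setT h ->
    measurable_fun setT (fun s : measurableTypeR R => h (w + s *: v)%R).
  move=> mh; apply: measurableT_comp mh _; apply: measurable_cVD => //.
  by apply: measurable_cVZ => //; exact: measurable_cst.
pose J (h : 'cV[R]_n -> \bar R) w := \int[mu]_(s in I01) h (w + s *: v)%R.
have mJ h : measurable_fun setT h -> (forall x, 0 <= h x) -> measurable_fun setT (J h).
  exact: measurable_integral_line.
have J0 h w : (forall x, 0 <= h x) -> 0 <= J h w by move=> h0; exact: integral_ge0.
pose aG x := `|(EFin \o G) x|.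
have maG : measurable_fun setT aG by exact: measurableT_comp.
have aG0 x : 0 <= aG x by exact: abse_ge0.
have iJ : leb.-integrable setT (J aG).
  apply/integrableP; split; first by apply: mJ => // x; exact: abse_ge0.
  under eq_integral do rewrite gee0_abs ?(J0 _ _ aG0)//.
  by rewrite /J integral_line_shift.
(* The fundamental theorem on the segment from w to w + v, with the negative part of [G] moved to
   the left: both sides are then nonnegative and can be integrated over w without subtracting
   infinities. *)
have key : ae_eq leb setT (fun w => (H (w + v))%:E + J (EFin \o G)^\- w)
                          (fun w => (H w)%:E + J (EFin \o G)^\+ w).
  apply: filterS (integrable_ae measurableT iJ) => w /(_ I) Jfin _.
  have iG : mu.-integrable I01 (EFin \o (fun s => G (w + s *: v)%R)).
    apply/integrableP; split.
      by apply: measurable_funS (mline _ w mGE).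
    by move: Jfin; rewrite ge0_fin_numE ?(J0 _ _ aG0).
  have := @Rintegral_derivative _ (fun s => H (w + s *: v)%R) _ 0%R 1%R ler01 _ iG.
  move=> /(_ (fun t _ => is_derive_line (dH _))); rewrite scale0r addr0 scale1r => E.
  have JpE : J (EFin \o G)^\+ w = \int[mu]_(s in I01) (EFin \o (fun s => G (w + s *: v)%R))^\+ s.
    by apply: eq_integral => s _; rewrite !funeposE.
  have JmE : J (EFin \o G)^\- w = \int[mu]_(s in I01) (EFin \o (fun s => G (w + s *: v)%R))^\- s.
    by apply: eq_integral => s _; rewrite !funenegE.
  have p1 : J (EFin \o G)^\+ w \is a fin_num by rewrite JpE; exact: integrable_pos_fin_num iG.
  have m1 : J (EFin \o G)^\- w \is a fin_num by rewrite JmE; exact: integrable_neg_fin_num iG.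
  rewrite [LHS]integralE -JpE -JmE in E.
  move: E; rewrite -(fineK p1) -(fineK m1) -EFinB -!EFinD => -[E].
  by congr EFin; move: E; lra.
have mHs : measurable_fun setT (fun w : 'cV[R]_n => (H (w + v)%R)%:E).
  apply/measurable_EFinP; apply: measurableT_comp mH _; exact: measurable_cVD.
have mHE : measurable_fun setT (fun w => (H w)%:E) by exact/measurable_EFinP.
have mJm : measurable_fun setT (J (EFin \o G)^\-) by exact: mJ.
have mJp : measurable_fun setT (J (EFin \o G)^\+) by exact: mJ.
have : \int[leb]_w ((H (w + v)%R)%:E + J (EFin \o G)^\- w) =
       \int[leb]_w ((H w)%:E + J (EFin \o G)^\+ w).
  by apply: (ae_eq_integral _ _ _ _ _ key) => //; exact: emeasurable_funD.
have J0m w : 0 <= J (EFin \o G)^\- w by exact: J0.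
have J0p w : 0 <= J (EFin \o G)^\+ w by exact: J0.
have IJm : \int[leb]_w J (EFin \o G)^\- w = \int[leb]_w (EFin \o G)^\- w.
  by rewrite /J integral_line_shift.
have IJp : \int[leb]_w J (EFin \o G)^\+ w = \int[leb]_w (EFin \o G)^\+ w.
  by rewrite /J integral_line_shift.
move: (J (EFin \o G)^\-) (J (EFin \o G)^\+) mJm mJp J0m J0p IJm IJp => Jm Jp mJm mJp J0m J0p IJm IJp.
rewrite ge0_integralD//; last by move=> w _; rewrite lee_fin.
rewrite ge0_integralD//; last by move=> w _; rewrite lee_fin.
rewrite IJm IJp.
have -> : \int[leb]_w (H (w + v)%R)%:E = \int[leb]_w (H w)%:E.
  under eq_integral do rewrite addrC.
  by rewrite (integral_lebesgue_cV_shift v mHE)// => x; rewrite lee_fin.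
have Hfin : \int[leb]_w (H w)%:E \is a fin_num.
  by rewrite ge0_fin_numE// integral_ge0// => x _; rewrite lee_fin.
have iG : leb.-integrable setT (EFin \o G) by apply/integrableP.
have p1 := integrable_pos_fin_num measurableT iG.
have m1 := integrable_neg_fin_num measurableT iG.
rewrite [X in _ -> X = _]integralE -(fineK Hfin) -(fineK p1) -(fineK m1) -!EFinD => -[E].
by congr EFin; move: E; lra.
Qed.

End integration_by_parts.

(** * The mollifier and its derivatives *)

Section bump.
Variables (R : realType) (n : nat) (d : R).
Hypothesis d0 : 0 < d.
Local Notation leb := (lebesgue_cV R n).

Lemma measurable_pos_sqr : measurable_fun setT (@pos_sqr R).
Proof. by apply: measurable_funX; apply: measurable_maxr. Qed.

(** [d] is the squared radius of the support. *)
Definition bump0 (u : 'cV[R]_n) : R := pos_sqr (d - nsq u).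
Definition bump_mass : R := fine (\int[leb]_u (bump0 u)%:E)%E.
Definition mbump (u : 'cV[R]_n) : R := bump0 u / bump_mass.
(** The i-th partial derivative of [mbump]; the 4 collects one factor 2 from [pos_sqr] and one from
    [nsq]. *)
Definition dbump (i : 'I_n) (u : 'cV[R]_n) : R :=
  - (4 / bump_mass * Num.max 0 (d - nsq u) * u i ord0).

Lemma measurable_bump0 : measurable_fun setT bump0.
Proof.
apply: measurableT_comp measurable_pos_sqr _; apply: measurable_funB => //.
exact: measurable_nsq.
Qed.

Lemma bump0_ge0 u : 0 <= bump0 u. Proof. exact: sqr_ge0. Qed.

Lemma bump0_le u : bump0 u <= d ^+ 2 * \1_(cball d) u.
Proof.
rewrite /bump0 /pos_sqr indicE; have := nsq_ge0 u.
have [ud|ud] := pselect (cball d u); last first.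
  move=> _; rewrite memNset// mulr0 (_ : Num.max _ _ = 0) ?expr0n//.
  by apply/max_idPl; rewrite subr_le0 ltW// ltNge; apply/negP.
rewrite mem_set// mulr1 => u0; have d0' := ltW d0.
by rewrite ler_pXn2r ?nnegrE ?le_max ?lexx// ge_max d0'/= gerBl.
Qed.

Lemma bump_mass_gt0 : 0 < bump_mass /\ (\int[leb]_u (bump0 u)%:E = bump_mass%:E)%E.
Proof.
have mb : measurable_fun setT (EFin \o bump0) by apply/measurable_EFinP; exact: measurable_bump0.
have foo : (\int[leb]_u (bump0 u)%:E < +oo)%E.
  apply: (@le_lt_trans _ _ (\int[leb]_u ((d ^+ 2)%:E * (\1_(cball d) u)%:E))%E).
    apply: ge0_le_integral => //.
    - by move=> u _; rewrite lee_fin bump0_ge0.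
    - apply: emeasurable_funM => //; apply/measurable_EFinP; by apply: measurable_indic; exact: measurable_cball.
    - by move=> u _; rewrite -EFinM lee_fin bump0_le.
  rewrite ge0_integralZl//.
  - rewrite integral_indic// ?setIT; last exact: measurable_cball.
    by rewrite lte_mul_pinfty ?lee_fin ?sqr_ge0//; exact: lebesgue_cball_lty.
  - by apply/measurable_EFinP; by apply: measurable_indic; exact: measurable_cball.
  - by rewrite lee_fin sqr_ge0.
have pos : (0 < \int[leb]_u (bump0 u)%:E)%E.
  apply: (@lt_le_trans _ _ (\int[leb]_u (((d / 2) ^+ 2)%:E * (\1_(cball (d / 2)) u)%:E))%E).
    rewrite ge0_integralZl//.
    - rewrite integral_indic// ?setIT; last exact: measurable_cball.
      rewrite mule_gt0// ?lte_fin ?exprn_gt0 ?divr_gt0//.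
      by apply: lebesgue_cball_gt0; rewrite divr_gt0.
    - by apply/measurable_EFinP; by apply: measurable_indic; exact: measurable_cball.
    - by rewrite lee_fin sqr_ge0.
  apply: ge0_le_integral => //.
  - by move=> u _; rewrite mule_ge0// lee_fin// sqr_ge0.
  - apply: emeasurable_funM => //; apply/measurable_EFinP; by apply: measurable_indic; exact: measurable_cball.
  - move=> u _; rewrite -EFinM lee_fin indicE; case: (boolP (u \in _)) => [|_]; last first.
      by rewrite mulr0 bump0_ge0.
    rewrite inE /cball/= mulr1 => ud; rewrite /bump0 /pos_sqr ler_pXn2r ?nnegrE ?le_max ?lexx//.
      by apply/orP; right; lra.
    by rewrite divr_ge0// ltW.
have fin : (\int[leb]_u (bump0 u)%:E \is a fin_num)%E by rewrite ge0_fin_numE// ltW.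
by rewrite /bump_mass fineK// -lte_fin fineK.
Qed.

Let c0 : 0 < bump_mass. Proof. exact: bump_mass_gt0.1. Qed.

Lemma measurable_bump : measurable_fun setT mbump.
Proof. by apply: measurable_funM => //; exact: measurable_bump0. Qed.

Lemma bump_ge0 u : 0 <= mbump u.
Proof. by rewrite divr_ge0 ?bump0_ge0// ltW. Qed.

Lemma bump_le u : mbump u <= d ^+ 2 / bump_mass * \1_(cball d) u.
Proof. by rewrite /mbump [leRHS]mulrAC ler_pM2r ?invr_gt0// bump0_le. Qed.

Lemma bump_eq0 u : d <= nsq u -> mbump u = 0.
Proof.
move=> du; rewrite /mbump /bump0 /pos_sqr (_ : Num.max _ _ = 0) ?expr0n ?mul0r//.
by apply/max_idPl; rewrite subr_le0.
Qed.

Lemma integral_bump : (\int[leb]_u (mbump u)%:E = 1)%E.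
Proof.
rewrite /mbump; under eq_integral do rewrite mulrC EFinM.
rewrite ge0_integralZl//.
- by rewrite bump_mass_gt0.2 -EFinM mulVf// gt_eqF.
- by apply/measurable_EFinP; exact: measurable_bump0.
- by move=> u _; rewrite lee_fin bump0_ge0.
- by rewrite lee_fin invr_ge0 ltW.
Qed.

Lemma measurable_dbump i : measurable_fun setT (dbump i).
Proof.
apply: measurableT_comp => //; apply: measurable_funM; last exact: measurable_coor.
apply: measurable_funM => //; apply: measurable_maxr => //.
by apply: measurable_funB => //; exact: measurable_nsq.
Qed.

Lemma dbump_le i u : `|dbump i u| <= (4 / bump_mass * d * (1 + d)) * \1_(cball d) u.
Proof.
have k0 : 0 <= 4 / bump_mass by rewrite divr_ge0// ltW.
move: k0; rewrite /dbump; move: (4 / bump_mass) => k k0.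
rewrite normrN !normrM (ger0_norm k0) indicE.
have [ud|ud] := pselect (cball d u); last first.
  rewrite memNset// mulr0 (_ : Num.max _ _ = 0) ?normr0 ?mulr0 ?mul0r//.
  by apply/max_idPl; rewrite subr_le0 ltW// ltNge; apply/negP.
rewrite mem_set// mulr1; apply: ler_pM => //.
- by rewrite mulr_ge0.
- rewrite ler_wpM2l// ger0_norm ?le_max ?lexx// ge_max ltW//= gerBl; exact: nsq_ge0.
- have := le_trans (coor_nsq u i) ud; rewrite -real_normK ?num_real//.
  have := normr_ge0 (u i ord0); have := sqr_ge0 (`|u i ord0| - 1); rewrite sqrrB.
  by have := sqr_ge0 d; nra.
Qed.

Lemma dbump_eq0 i u : d <= nsq u -> dbump i u = 0.
Proof.
move=> du; rewrite /dbump (_ : Num.max _ _ = 0) ?mulr0 ?mul0r ?oppr0//.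
by apply/max_idPl; rewrite subr_le0.
Qed.

(** The chain rule along an arbitrary curve with derivable coordinates. The mollified function
    inherits it from the kernel. *)
Lemma is_derive_bump (p : R -> 'cV[R]_n) (p' : 'cV[R]_n) (t : R) :
  (forall i, is_derive t 1 (fun s => p s i ord0) (p' i ord0)) ->
  is_derive t 1 (fun s => mbump (p s)) (\sum_i dbump i (p t) * p' i ord0).
Proof.
move=> dp.
have dnsq : is_derive t 1 (fun s => nsq (p s)) (\sum_i 2 * p t i ord0 * p' i ord0).
  rewrite /nsq (_ : (fun s => _) = \sum_(i < n) (fun s => p s i ord0 ^+ 2)); last first.
    by apply/funext => s; rewrite fct_sumE.
  apply: is_derive_sum => i /=.
  rewrite (_ : (fun s => _) = (fun s => p s i ord0) ^+ 2); last first.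
    by apply/funext => s; rewrite !expr2.
  by apply: is_derive_eq (is_deriveX 2 (dp i)) _; rewrite expr1.
have dq : is_derive t 1 (fun s => d - nsq (p s)) (- \sum_i 2 * p t i ord0 * p' i ord0).
  by rewrite -[X in is_derive _ _ _ X]add0r; apply: is_deriveD.
have db0 : is_derive t 1 (fun s => bump0 (p s))
    ((2 * Num.max 0 (d - nsq (p t))) * - (\sum_i 2 * p t i ord0 * p' i ord0)).
  exact: (is_derive1_comp (is_derive_pos_sqr _) dq).
have := is_deriveM db0 (is_derive_cst (bump_mass^-1) t 1).
rewrite /= scaler0 add0r => H.
have -> : (fun s => mbump (p s)) = (fun s => bump0 (p s)) * cst bump_mass^-1 by apply/funext.
apply: is_derive_eq H _.
have -> : \sum_i dbump i (p t) * p' i ord0 =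
    - (2 / bump_mass * Num.max 0 (d - nsq (p t))) * \sum_i 2 * p t i ord0 * p' i ord0.
  by rewrite mulr_sumr; apply: eq_bigr => i _; rewrite /dbump; ring.
move: (\sum_(i < n) _) => S; rewrite -[LHS]/(bump_mass^-1 * (_ * - S)); ring.
Qed.

End bump.

(** Induction on (s + b)^2 <= 2 s^2 + 2 b^2. The constant may be crude: it enters only a finiteness
    claim and an error term that tends to 0 with the mollification radius. *)
Lemma sqr_sum_le (R : realDomainType) n (a : 'I_n -> R) :
  (\sum_i a i) ^+ 2 <= 2 ^+ n * \sum_i a i ^+ 2.
Proof.
elim: n a => [|n IH] a; first by rewrite !big_ord0 expr0n mulr0.
rewrite !big_ord_recr/=; set s := \sum_(i < n) _; set q := \sum_(i < n) _; set b := a ord_max.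
have := IH (fun i => a (widen_ord (leqnSn n) i)); rewrite -/s -/q => H.
have p1 : 1 <= 2 ^+ n :> R by rewrite exprn_ege1// ler1n.
have pb : b ^+ 2 <= 2 ^+ n * b ^+ 2 by rewrite ler_peMl// sqr_ge0.
by have := sqr_ge0 (s - b); rewrite [2 ^+ n.+1]exprS sqrrB sqrrD; nra.
Qed.

Lemma nsq_add_delta (R : realType) n (a : 'cV[R]_n) (t : R) i :
  nsq (a + t *: delta_mx i ord0) = nsq a + 2 * t * a i ord0 + t ^+ 2.
Proof.
rewrite /nsq (bigD1 i)//= [X in _ = X + _ + _](bigD1 i)//= !mxE !eqxx mulr1.
rewrite (eq_bigr (fun j => a j ord0 ^+ 2)); first by rewrite sqrrD; ring.
by move=> j ji; rewrite !mxE (negbTE ji) mulr0 addr0.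
Qed.

Section Rintegral_sum.
Context d (T : measurableType d) (R : realType) (m : {measure set T -> \bar R}).
Context n (a : 'I_n -> R) (f : 'I_n -> T -> R).
Hypothesis intf : forall i, m.-integrable setT (EFin \o f i).

Lemma integrable_sumZ : m.-integrable setT (EFin \o (fun x => \sum_i a i * f i x)).
Proof.
rewrite (_ : EFin \o _ = (fun x => \sum_i (a i * f i x)%:E)%E); last first.
  by apply/funext => x; rewrite /= sumEFin.
apply: integrable_sum => // i _.
rewrite (_ : (fun x => _) = (fun x => (a i)%:E * (EFin \o f i) x)%E); last first.
  by apply/funext => x; rewrite /= EFinM.
exact: integrableZl.
Qed.

Lemma Rintegral_sumZ :
  \int[m]_x (\sum_i a i * f i x) = \sum_i a i * \int[m]_x f i x.
Proof.
rewrite /Rintegral; under eq_integral do rewrite -sumEFin.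
rewrite integral_sum//; last first.
  move=> i; rewrite (_ : (fun x => _) = (fun x => (a i)%:E * (EFin \o f i) x)%E); last first.
    by apply/funext => x; rewrite /= EFinM.
  exact: integrableZl.
rewrite -sum_fine; last first.
  move=> i _; under eq_integral do rewrite EFinM.
  exact: (integrable_fin_num measurableT (integrableZl measurableT (a i) (intf i))).
apply: eq_bigr => i _; under eq_integral do rewrite EFinM.
by rewrite (integralZl measurableT (intf i)) fineM//; exact: integrable_fin_num (intf i).
Qed.

End Rintegral_sum.

Section smoothing.
Variables (R : realType) (n : nat) (d : R).
Hypothesis d0 : 0 < d.
Local Notation leb := (lebesgue_cV R n).
Local Notation mu := (@lebesgue_measure R).
Local Notation I01 := ([set` `[(0%R : R), 1%R]] : set (measurableTypeR R)).
Variables (U : set 'cV[R]_n) (h : 'cV[R]_n -> R) (g : 'I_n -> 'cV[R]_n -> R) (M : R).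
Hypothesis mh : measurable_fun setT h.
Hypothesis mg : forall i, measurable_fun setT (g i).
Hypothesis h0 : forall x, 0 <= h x.
Hypothesis hM : forall x, h x <= M.
Hypothesis dh : forall x, U x -> forall i, is_derive x (delta_mx i ord0) h (g i x).
Hypothesis g2 : forall i, (\int[leb]_x (g i x ^+ 2)%:E < +oo)%E.

Definition inner x := forall u : 'cV[R]_n, nsq u <= d -> U (x + u).

Local Notation mbump := (@mbump R n d).
Local Notation dbump := (@dbump R n d).

(** The point x appears in the kernel only, so that differentiating under the integral sign never
    touches [h]. *)
Definition smooth (x : 'cV[R]_n) : R := \int[leb]_w (h w * mbump (w - x)).

Let M0 : 0 <= M. Proof. exact: le_trans (h0 0) (hM 0). Qed.


Let measurable_sub (x : 'cV[R]_n) : measurable_fun setT (fun w : 'cV[R]_n => w - x).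
Proof. by apply: measurable_cVB => //; exact: measurable_cst. Qed.

Lemma nsq_le_trans (w x : 'cV[R]_n) : nsq w <= 2 * nsq (w - x) + 2 * nsq x.
Proof.
rewrite /nsq !mulr_sumr -big_split/=; apply: ler_sum => i _; rewrite !mxE.
by have := sqr_ge0 (w i ord0 - 2 * x i ord0); nra.
Qed.

Lemma integrable_cball_bounded (f : 'cV[R]_n -> R) (C r : R) :
  measurable_fun setT f -> (forall w, `|f w| <= C * \1_(cball r) w) ->
  leb.-integrable setT (EFin \o f).
Proof.
move=> mf fC.
have mI : measurable_fun setT (EFin \o (fun w : 'cV[R]_n => C * \1_(cball r) w)).
  apply/measurable_EFinP; apply: measurable_funM => //.
  by apply: measurable_indic; exact: measurable_cball.
apply: (@le_integrable _ _ _ leb _ measurableT _ (EFin \o (fun w : 'cV[R]_n => `|C| * \1_(cball r) w))).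
- exact/measurable_EFinP.
- by move=> w _; rewrite /= lee_fin (le_trans (fC w))// normrM normr_id (ger0_norm (_ : 0 <= \1__ w))// ler_wpM2r// ler_norm.
- apply/integrableP; split.
    apply/measurable_EFinP; apply: measurable_funM => //.
    by apply: measurable_indic; exact: measurable_cball.
  rewrite (eq_integral (fun w => `|C|%:E * (\1_(cball r) w)%:E)%E); last first.
    by move=> w _; rewrite /= ger0_norm ?mulr_ge0.
  rewrite ge0_integralZl//; last first.
    by apply/measurable_EFinP; apply: measurable_indic; exact: measurable_cball.
  rewrite integral_indic ?setIT//; last exact: measurable_cball.
  by rewrite lte_mul_pinfty ?lee_fin//; exact: lebesgue_cball_lty.
Qed.

Lemma integrable_g_bump i x : leb.-integrable setT (EFin \o (fun w => g i w * mbump (w - x))).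
Proof.
set k := d ^+ 2 / bump_mass n d.
have k0 : 0 <= k by rewrite divr_ge0 ?sqr_ge0// ltW// (bump_mass_gt0 n d0).1.
have mgb : measurable_fun setT (fun w : 'cV[R]_n => g i w * mbump (w - x)).
  by apply: measurable_funM => //; exact: measurableT_comp (@measurable_bump R n d) (measurable_sub x).
have ig2 : leb.-integrable setT (EFin \o (fun w => g i w ^+ 2)).
  apply/integrableP; split; first by apply/measurable_EFinP; exact: measurable_funX.
  by under eq_integral do rewrite /= ger0_norm ?sqr_ge0//; exact: g2.
have ib : leb.-integrable setT (EFin \o (fun w => k ^+ 2 * \1_(cball (2 * d + 2 * nsq x)) w)).
  apply: (@integrable_cball_bounded _ (k ^+ 2) (2 * d + 2 * nsq x)).
    apply: measurable_funM => //; apply: measurable_indic; exact: measurable_cball.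
  by move=> w; rewrite ger0_norm// mulr_ge0// sqr_ge0.
apply: (le_integrable measurableT _ _ (integrableD measurableT ig2 ib)).
  exact/measurable_EFinP.
move=> w _; rewrite -[leRHS]/(`|(g i w ^+ 2 + k ^+ 2 * \1_(cball (2 * d + 2 * nsq x)) w)%:E|)%E.
rewrite -[leLHS]/(`|(g i w * mbump (w - x))%:E|)%E !abse_EFin lee_fin.
rewrite [leRHS]ger0_norm; last by rewrite addr_ge0 ?sqr_ge0// mulr_ge0// sqr_ge0.
have bk := bump_le d0 (w - x); have b0 := bump_ge0 d0 (w - x).
have bI : mbump (w - x) ^+ 2 <= k ^+ 2 * \1_(cball (2 * d + 2 * nsq x)) w.
  rewrite indicE; case: (boolP (w \in _)) => [_|/negP wB].
    rewrite mulr1 ler_pXn2r ?nnegrE//; apply: le_trans bk _; by rewrite -/k ler_piMr.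
  rewrite mulr0 bump_eq0 ?expr0n// leNgt; apply/negP => wd; apply: wB.
  by rewrite inE /cball/=; apply: le_trans (nsq_le_trans w x) _; rewrite lerD2r ler_pM2l// ltW.
rewrite normrM (ger0_norm b0); apply: le_trans (lerD (lexx _) bI).
rewrite -[in leRHS](real_normK (num_real (g i w))).
by have := sqr_ge0 (`|g i w| - mbump (w - x)); have := sqr_ge0 `|g i w|; have := sqr_ge0 (mbump (w - x)); rewrite sqrrB; lra.
Qed.

Lemma integrable_h_cball (f : 'cV[R]_n -> R) (C : R) x : measurable_fun setT f ->
  (forall u, `|f u| <= C * \1_(cball d) u) ->
  leb.-integrable setT (EFin \o (fun w => h w * f (w - x))).
Proof.
move=> mf fC.
apply: (@integrable_cball_bounded _ (M * `|C|) (2 * d + 2 * nsq x)).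
  by apply: measurable_funM => //; exact: measurableT_comp mf (measurable_sub x).
move=> w; rewrite normrM (ger0_norm (h0 w)) -mulrA ler_pM//.
apply: le_trans (fC _) _; apply: (@le_trans _ _ (`|C| * \1_(cball d) (w - x))).
  by rewrite ler_wpM2r// ler_norm.
rewrite ler_wpM2l// !indicE; case: (boolP (w - x \in _)) => //.
rewrite inE /cball/= => wd; rewrite mem_set//.
by apply: le_trans (nsq_le_trans w x) _; rewrite lerD2r ler_pM2l.
Qed.

Lemma integrable_h_bump x : leb.-integrable setT (EFin \o (fun w => h w * mbump (w - x))).
Proof.
apply: integrable_h_cball; first exact: measurable_bump.
by move=> u; rewrite ger0_norm ?bump_ge0//; exact: bump_le.
Qed.

Lemma integrable_h_dbump i x : leb.-integrable setT (EFin \o (fun w => h w * dbump i (w - x))).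
Proof.
apply: integrable_h_cball; first exact: measurable_dbump.
by move=> u; exact: dbump_le.
Qed.

(** The product of [h] and the translated bump is derivable along the i-th axis at every point of
    the space, with derivative [G]; the integral of [G] then vanishes by [integral_derivative0]. *)
Lemma bump_by_parts i x : inner x ->
  \int[leb]_w (g i w * mbump (w - x)) = - (\int[leb]_w (h w * dbump i (w - x)))%R.
Proof.
move=> Ux.
pose H (w : 'cV[R]_n) := h w * mbump (w - x).
pose G (w : 'cV[R]_n) := g i w * mbump (w - x) + h w * dbump i (w - x).
have mb : measurable_fun setT (fun w : 'cV[R]_n => mbump (w - x)).
  exact: measurableT_comp (@measurable_bump R n d) (measurable_sub x).
have mdb : measurable_fun setT (fun w : 'cV[R]_n => dbump i (w - x)).
  exact: measurableT_comp (@measurable_dbump R n d i) (measurable_sub x).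
have iG : leb.-integrable setT (EFin \o G).
  exact: (integrableD measurableT (integrable_g_bump i x) (integrable_h_dbump i x)).
have dH w : is_derive w (delta_mx i ord0) H (G w).
  apply: is_derive_of_line; set v := delta_mx i ord0.
  have dline : is_derive (0 : R) 1 (fun t : R => mbump (w + t *: v - x)) (dbump i (w - x)).
    have -> : dbump i (w - x) = \sum_j dbump j (w + 0 *: v - x) * v j ord0.
      rewrite scale0r addr0 (bigD1 i)//= big1 ?addr0.
        by rewrite mxE !eqxx mulr1.
      by move=> j ji; rewrite mxE (negbTE ji) mulr0.
    apply: is_derive_bump => // j.
    have -> : (fun s : R => (w + s *: v - x) j ord0) = (fun s : R => (w - x) j ord0 + v j ord0 * s).
      by apply/funext => s; rewrite !mxE; ring.
    apply: (@is_derive_quadratic _ _ _ _ 0) => s.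
    by rewrite add0r mulr0 addr0 (addrC _ (_ * s)) addrK subrr normr0 mul0r.
  have [Uw|nUw] := pselect (U w).
    have dhl : is_derive (0 : R) 1 (fun t : R => h (w + t *: v)) (g i w).
      by apply: is_derive_line; rewrite scale0r addr0; exact: dh.
    have := is_deriveM dhl dline.
    rewrite scale0r addr0 => HH; apply: is_derive_eq HH _.
    by rewrite /G /GRing.scale/=; ring.
  (* Since [U] contains the closed ball of squared radius [d] about x, a point outside [U] is
     strictly farther away. The bump is 0 around it, hence so is the product, however [h] behaves
     there. *)
  have dw : d < nsq (w - x).
    rewrite ltNge; apply/negP => /Ux; rewrite addrC subrK; exact: nUw.
  have -> : G w = 0 by rewrite /G bump_eq0 ?dbump_eq0 ?ltW// !mulr0 addr0.
  have cst0 : is_derive (0 : R) 1 (cst 0 : R -> R) 0 by exact: is_derive_cst.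
  apply: near_eq_is_derive cst0; rewrite ?oner_eq0//.
  set a := (w - x) i ord0.
  (* A move by t along the axis lowers the squared distance by at most 2|t||a|, which for |t| below
     this quotient keeps it above [d]. *)
  have dp : 0 < (nsq (w - x) - d) / (2 * `|a| + 1).
    by rewrite divr_gt0 ?subr_gt0// ltr_wpDl// mulr_ge0.
  near=> t; rewrite /H /cst bump_eq0 ?mulr0//.
  have -> : w + t *: v - x = (w - x) + t *: v by rewrite addrAC.
  rewrite nsq_add_delta -/a.
  have : `|t| <= (nsq (w - x) - d) / (2 * `|a| + 1).
    near: t; apply/nbhs_ballP; exists ((nsq (w - x) - d) / (2 * `|a| + 1)) => //= s.
    by rewrite /ball/= sub0r normrN => /ltW.
  rewrite ler_pdivlMr ?ltr_wpDl ?mulr_ge0// => H1.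
  have := ler_norm (- (t * a)); rewrite normrN normrM => H2.
  by have := sqr_ge0 t; have := normr_ge0 t; nra.
have := @integral_derivative0 R n (delta_mx i ord0) H G _ _ _ _ _ dH.
move=> /(_ _ _ _ _ _)E.
have : \int[leb]_w G w = 0.
  rewrite /Rintegral E//.
  - by apply: measurable_funM.
  - by apply: measurable_funD; apply: measurable_funM.
  - by move=> w; rewrite mulr_ge0// bump_ge0.
  - have /integrableP[_ bH] := integrable_h_bump x; apply: le_lt_trans bH.
    rewrite le_eqVlt; apply/orP; left; apply/eqP; apply: eq_integral => w _.
    by rewrite /= ger0_norm// mulr_ge0// bump_ge0.
  - by have /integrableP[] := iG.
rewrite /G RintegralD//; [|exact: integrable_g_bump|exact: integrable_h_dbump].
by move=> /eqP; rewrite addr_eq0 => /eqP ->.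
Unshelve. all: end_near. Qed.

(** The derivative falls on the bump and is carried over to [g] by parts at the time t alone, so
    that only [p t] has to be inner; the sign from w - p s cancels the sign of the integration by
    parts. The bounds are asked on ]-1, 2[, an open neighbourhood of [0, 1], to reach two-sided
    derivatives at the end points. *)
Lemma is_derive_smooth (p p' : R -> 'cV[R]_n) (B t : R) :
  (forall (s : R) i, is_derive s 1 (fun r => p r i ord0) (p' s i ord0)) ->
  (forall s, -1 < s < 2 -> nsq (p s) <= B /\ forall i, `|p' s i ord0| <= B) ->
  0 <= t <= 1 -> inner (p t) ->
  is_derive t 1 (fun s => smooth (p s))
    (\int[leb]_w (mbump (w - p t) * \sum_i p' t i ord0 * g i w)).
Proof.
move=> dp Bp t01 pt.
have It : `]-1, 2[%classic t by rewrite /= in_itv/=; move: t01; lra.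
have B0 : 0 <= B by apply: le_trans (nsq_ge0 (p t)) (Bp t _).1; move: t01; lra.
pose f s (w : 'cV[R]_n) := h w * mbump (w - p s).
have df (s : R) w : is_derive s 1 (f^~ w) (h w * \sum_i dbump i (w - p s) * - p' s i ord0).
  have := @is_derive_bump R n d (fun s => w - p s) (- p' s) s.
  under eq_bigr do rewrite mxE.
  move=> /(_ _)H; apply: is_derive_eq (is_deriveZ (h w) (H _)) _ => // i.
  rewrite (_ : (fun s : R => (w - p s) i ord0) = (fun s => w i ord0 - p s i ord0)); last first.
    by apply/funext => r; rewrite !mxE.
  by rewrite mxE -[X in is_derive _ _ _ X]add0r; apply: is_deriveB.
have d1E s w : partial1of2 f s w = h w * \sum_i dbump i (w - p s) * - p' s i ord0.
  by rewrite partial1of2E; apply: derive_val.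
set C := 4 / bump_mass n d * d * (1 + d).
have C0 : 0 <= C.
  by rewrite mulr_ge0 ?addr_ge0 ?ltW// mulr_gt0// divr_gt0// (bump_mass_gt0 n d0).1.
(* For every s in ]-1, 2[ the bump centred at [p s] is supported in the ball of squared radius 2d +
   2B about the origin; this gives one dominating function for all s. *)
pose G w := M * (n%:R * (C * B)) * \1_(cball (2 * d + 2 * B)) (w : 'cV[R]_n).
have G0 w : 0 <= G w by rewrite /G mulr_ge0// mulr_ge0// mulr_ge0// mulr_ge0.
have H := @cvg_differentiation_under_integral R _ _ leb f setT measurableT t (-1) 2 It
  (fun s _ => integrable_h_bump (p s)) (fun s w _ _ => @ex_derive _ _ _ _ _ _ _ (df s w)) G G0 _ _.
have Hc : h0^-1 *: (smooth (p (h0 + t)) - smooth (p t)) @[h0 --> 0^'] -->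
    \int[leb]_w (partial1of2 f t w).
  apply: H.
    apply: (@integrable_cball_bounded _ (M * (n%:R * (C * B))) (2 * d + 2 * B)).
      by apply: measurable_funM => //; apply: measurable_indic; exact: measurable_cball.
    by move=> w; rewrite ger0_norm.
  move=> s w Is _; rewrite d1E normrM (ger0_norm (h0 w)) /G -mulrA ler_pM//.
  have /Bp[ps p's] : -1 < s < 2 by move: Is; rewrite /= in_itv.
  apply: le_trans (ler_norm_sum _ _ _) _.
  apply: (@le_trans _ _ (\sum_(i < n) C * B * \1_(cball (2 * d + 2 * B)) w)); last first.
    by rewrite sumr_const card_ord -[leLHS]mulr_natl mulrA lexx.
  apply: ler_sum => i _; rewrite normrM (normrN (p' s i ord0)) [leRHS]mulrAC ler_pM//.
  apply: le_trans (dbump_le d0 i _) _; rewrite -/C ler_wpM2l// !indicE.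
  case: (boolP (w - p s \in _)) => //; rewrite inE /cball/= => wd; rewrite mem_set//.
  by apply: le_trans (nsq_le_trans w (p s)) _; rewrite lerD// ler_pM2l.
have -> : \int[leb]_w (mbump (w - p t) * \sum_i p' t i ord0 * g i w) = \int[leb]_w (partial1of2 f t w).
  transitivity (\int[leb]_w (\sum_i p' t i ord0 * (g i w * mbump (w - p t)))).
    by apply: eq_Rintegral => w _; rewrite mulr_sumr; apply: eq_bigr => i _; ring.
  rewrite Rintegral_sumZ; last by move=> i; exact: integrable_g_bump.
  transitivity (\int[leb]_w (\sum_i - p' t i ord0 * (h w * dbump i (w - p t)))).
    rewrite Rintegral_sumZ; last by move=> i; exact: integrable_h_dbump.
    by apply: eq_bigr => i _; rewrite bump_by_parts// mulrN mulNr.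
  by apply: eq_Rintegral => w _; rewrite d1E mulr_sumr; apply: eq_bigr => i _; ring.
have Hd : h0^-1 *: (((fun s => smooth (p s)) \o shift t) (h0 *: 1) - smooth (p t)) @[h0 --> 0^'] -->
    \int[leb]_w (partial1of2 f t w).
  by under eq_fun do rewrite /= scaler1.
by split; [apply/cvg_ex; eexists; exact: Hd|apply/cvg_lim].
Qed.

Lemma sqr_sum_g_lty (p' : 'cV[R]_n) x :
  (\int[leb]_w (mbump (w - x) * (\sum_i p' i ord0 * g i w) ^+ 2)%:E < +oo)%E.
Proof.
set k := d ^+ 2 / bump_mass n d.
have k0 : 0 <= k by rewrite divr_ge0 ?sqr_ge0// ltW// (bump_mass_gt0 n d0).1.
apply: (@le_lt_trans _ _ (\int[leb]_w (\sum_i ((k * 2 ^+ n * p' i ord0 ^+ 2)%:E * (g i w ^+ 2)%:E)))%E).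
  apply: ge0_le_integral => //.
  - by move=> w _; rewrite lee_fin mulr_ge0 ?bump_ge0 ?sqr_ge0.
  - apply/measurable_EFinP; apply: measurable_funM.
      exact: measurableT_comp (@measurable_bump R n d) (measurable_sub x).
    by apply: measurable_funX; apply: measurable_sum => i; apply: measurable_funM.
  - apply: emeasurable_sum => i; apply: emeasurable_funM => //.
    by apply/measurable_EFinP; exact: measurable_funX.
  - move=> w _; rewrite (eq_bigr (fun i => (k * 2 ^+ n * p' i ord0 ^+ 2 * g i w ^+ 2)%:E)); last first.
      by move=> i _; rewrite EFinM.
    rewrite sumEFin lee_fin.
    apply: (@le_trans _ _ (k * (\sum_i p' i ord0 * g i w) ^+ 2)).
      rewrite ler_wpM2r ?sqr_ge0//; apply: le_trans (bump_le d0 _) _.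
      by rewrite -/k ler_piMr.
    rewrite [leRHS](eq_bigr (fun i => k * (2 ^+ n * (p' i ord0 * g i w) ^+ 2))); last first.
      by move=> i _; rewrite exprMn; ring.
    by rewrite -mulr_sumr ler_wpM2l// -mulr_sumr; exact: sqr_sum_le.
have k2 i : 0 <= k * 2 ^+ n * p' i ord0 ^+ 2 by rewrite mulr_ge0 ?sqr_ge0// mulr_ge0.
rewrite ge0_integral_sum//.
- apply: lte_sum_pinfty => i _; rewrite ge0_integralZl ?lee_fin//.
  + by rewrite lte_mul_pinfty ?lee_fin//; exact: g2.
  + by apply/measurable_EFinP; exact: measurable_funX.
  + by move=> w _; rewrite lee_fin sqr_ge0.
- by move=> i; apply: emeasurable_funM => //; apply/measurable_EFinP; exact: measurable_funX.
- by move=> i w _; rewrite mule_ge0 ?lee_fin// sqr_ge0.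
Qed.

(** Jensen with respect to the bump bounds the squared derivative along the path, and
    [sqr_increment_le] integrates the bound. The substitution w = p t + u places the path inside the
    argument of [g], ready for averaging over its end points. *)
Lemma smooth_path_le (p p' : R -> 'cV[R]_n) (B : R) :
  measurable_fun setT (p : measurableTypeR R -> _) -> measurable_fun setT (p' : measurableTypeR R -> _) ->
  (forall (s : R) i, is_derive s 1 (fun r => p r i ord0) (p' s i ord0)) ->
  (forall s, -1 < s < 2 -> nsq (p s) <= B /\ forall i, `|p' s i ord0| <= B) ->
  (forall t, 0 <= t <= 1 -> inner (p t)) ->
  (((smooth (p 1) - smooth (p 0)) ^+ 2)%:E <=
  \int[mu]_(t in I01) \int[leb]_u (mbump u * (\sum_i p' t i ord0 * g i (p t + u)) ^+ 2)%:E)%E.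
Proof.
move=> mp mp' dp Bp pin.
have mb : measurable_fun setT (mbump : 'cV[R]_n -> R) by exact: measurable_bump.
pose k (q : measurableTypeR R * 'cV[R]_n) :=
  (mbump q.2 * (\sum_i p' q.1 i ord0 * g i (p q.1 + q.2)) ^+ 2)%:E.
have mk : measurable_fun setT k.
  apply/measurable_EFinP; apply: measurable_funM; first exact: measurableT_comp mb _.
  apply: measurable_funX; apply: measurable_sum => i; apply: measurable_funM.
    by apply: measurable_fun_coor; exact: measurableT_comp mp' _.
  apply: measurableT_comp (mg i) _; apply: measurable_cVD => //.
  exact: measurableT_comp mp _.
have k0 q : (0 <= k q)%E by rewrite lee_fin mulr_ge0 ?bump_ge0 ?sqr_ge0.
pose A t := (\int[leb]_u k (t, u))%E.
have mA : measurable_fun setT A by exact: (measurable_fun_fubini_tonelli_F k).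
have A0 t : (0 <= A t)%E by exact: integral_ge0.
have AE t : A t = (\int[leb]_w (mbump (w - p t) * (\sum_i p' t i ord0 * g i w) ^+ 2)%:E)%E.
  rewrite -[RHS](integral_lebesgue_cV_shift (p t)); last 2 first.
  - apply/measurable_EFinP; apply: measurable_funM.
      exact: measurableT_comp mb (measurable_sub _).
    by apply: measurable_funX; apply: measurable_sum => i; apply: measurable_funM.
  - by move=> w; rewrite lee_fin mulr_ge0 ?bump_ge0 ?sqr_ge0.
  by apply: eq_integral => u _; rewrite /k/= addrAC subrr add0r.
have Afin t : A t \is a fin_num by rewrite ge0_fin_numE// AE sqr_sum_g_lty.
rewrite (eq_integral (fun t => (fine (A t))%:E)); last by move=> t _; rewrite fineK.
apply: (@sqr_increment_le R (fun s => smooth (p s))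
  (fun t => \int[leb]_w (mbump (w - p t) * \sum_i p' t i ord0 * g i w)) (fun t => fine (A t))).
- move=> t t01; apply: (is_derive_smooth dp Bp t01); exact: pin.
- move=> t t01; rewrite -lee_fin fineK// AE.
  apply: (@sqr_Rintegral_le _ _ R leb (fun w => mbump (w - p t)) (fun w => \sum_i p' t i ord0 * g i w)).
  + exact: measurableT_comp mb (measurable_sub _).
  + by apply: measurable_sum => i; apply: measurable_funM.
  + by move=> w; exact: bump_ge0.
  + rewrite -(integral_bump n d0) -[RHS](integral_lebesgue_cV_shift (- p t)); last 2 first.
    * exact/measurable_EFinP.
    * by move=> w; rewrite lee_fin bump_ge0.
    by apply: eq_integral => w _; rewrite addrC.
- by move=> t; exact: fine_ge0.
- exact: measurableT_comp.
Qed.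

Lemma smoothE x : smooth x = \int[leb]_u (mbump u * h (x + u)).
Proof.
rewrite /smooth /Rintegral -(integral_lebesgue_cV_shift x); last 2 first.
- apply/measurable_EFinP; apply: measurable_funM => //.
  exact: measurableT_comp (@measurable_bump R n d) (measurable_sub _).
- by move=> w; rewrite lee_fin mulr_ge0 ?bump_ge0.
congr fine; apply: eq_integral => u _; congr EFin.
by rewrite addrAC subrr add0r mulrC.
Qed.

Lemma sqr_sub_smooth_le x :
  (((h x - smooth x) ^+ 2)%:E <= \int[leb]_u (mbump u * (h x - h (x + u)) ^+ 2)%:E)%E.
Proof.
have mb : measurable_fun setT (mbump : 'cV[R]_n -> R) by exact: measurable_bump.
have mhx : measurable_fun setT (fun u : 'cV[R]_n => h (x + u)).
  by apply: measurableT_comp mh _; apply: measurable_cVD => //; exact: measurable_cst.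
set k := d ^+ 2 / bump_mass n d.
have k0 : 0 <= k by rewrite divr_ge0 ?sqr_ge0// ltW// (bump_mass_gt0 n d0).1.
have ib (c : R) : leb.-integrable setT (EFin \o (fun u => mbump u * c)).
  apply: (@integrable_cball_bounded _ (k * `|c|) d); first exact: measurable_funM.
  move=> u; rewrite normrM mulrAC ler_wpM2r// ger0_norm ?bump_ge0//.
  exact: bump_le.
have ibh : leb.-integrable setT (EFin \o (fun u => mbump u * h (x + u))).
  apply: (@integrable_cball_bounded _ (k * M) d); first exact: measurable_funM.
  move=> u; rewrite normrM mulrAC ler_pM ?ger0_norm ?bump_ge0//.
  exact: bump_le.
have -> : h x - smooth x = \int[leb]_u (mbump u * (h x - h (x + u))).
  rewrite smoothE; under [RHS]eq_Rintegral do rewrite mulrBr.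
  rewrite RintegralB//; congr (_ - _).
  under eq_Rintegral do rewrite mulrC.
  rewrite RintegralZl//; last first.
    by have := ib 1; under eq_fun do rewrite mulr1.
  by rewrite /Rintegral (integral_bump n d0) mulr1.
apply: (@sqr_Rintegral_le _ _ R leb mbump (fun u => h x - h (x + u))) => //.
- by apply: measurable_funB.
- by move=> u; exact: bump_ge0.
- exact: integral_bump.
Qed.

Lemma nsq_le (u w : 'cV[R]_n) : (forall i, `|u i ord0| <= `|w i ord0|) -> nsq u <= nsq w.
Proof.
move=> uw; apply: ler_sum => i _; rewrite -(real_normK (num_real (u i ord0))).
by rewrite -(real_normK (num_real (w i ord0))) ler_pXn2r// nnegrE.
Qed.

(* One passes from x to x + u by a staircase of coordinate moves, because only
   coordinate partial derivatives of h are available. *)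
Lemma sqr_sub_shift_le (K : set 'cV[R]_n) (u : 'cV[R]_n) :
  measurable K -> K `<=` inner -> nsq u <= d ->
  (\int[leb]_(x in K) ((h x - h (x + u)) ^+ 2)%:E <=
   (2 ^+ n * d)%:E * \sum_i \int[leb]_x (g i x ^+ 2)%:E)%E.
Proof.
move=> mK Kin ud.
(* [S k] keeps the first k coordinates of u. The points of the i-th stair, S i + s v i with s in
   [0, 1], are coordinatewise no larger than u in absolute value, hence remain within squared radius
   [d], where [h] is derivable. *)
pose S (k : nat) : 'cV[R]_n := \col_j (if (j < k)%N then u j ord0 else 0).
pose v (i : 'I_n) : 'cV[R]_n := u i ord0 *: delta_mx i ord0.
have SS (i : 'I_n) : S i.+1 = S i + v i.
  apply/matrixP => j k; rewrite !mxE !ord1 eqxx andbT ltnS.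
  case: (ltngtP j i) => [ji|ij|/val_inj ->].
  - by rewrite (_ : j == i = false) ?mulr0 ?addr0// -val_eqE ltn_eqF.
  - by rewrite (_ : j == i = false) ?mulr0 ?addr0// -val_eqE gtn_eqF.
  - by rewrite eqxx mulr1 add0r.
have S0 : S 0%N = 0 by apply/matrixP => j k; rewrite !mxE.
have Sn : S n = u by apply/matrixP => j k; rewrite !mxE ltn_ord (ord1 k).
pose A (i : 'I_n) x s := (u i ord0 * g i (x + s *: v i + S i)) ^+ 2.
have mA i x : measurable_fun setT (A i x : measurableTypeR R -> R).
  apply: measurable_funX; apply: measurable_funM => //.
  apply: measurableT_comp (mg i) _; apply: measurable_cVD; last exact: measurable_cst.
  apply: measurable_cVD; first exact: measurable_cst.
  by apply: measurable_cVZ => //; exact: measurable_cst.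
have step x (i : 'I_n) : K x ->
    (((h (x + S i.+1) - h (x + S i)) ^+ 2)%:E <= \int[mu]_(s in I01) (A i x s)%:E)%E.
  move=> Kx.
  have := @sqr_increment_le R (fun s => h (x + S i + s *: v i))
    (fun s => u i ord0 * g i (x + s *: v i + S i)) (A i x).
  rewrite scale1r scale0r addr0 SS addrA; apply => //.
  - move=> t t01.
    rewrite (_ : (fun s => _) = (fun r => h (x + S i + r *: delta_mx i ord0)) \o (fun s => u i ord0 * s)); last first.
      by apply/funext => s; rewrite /v scalerA mulrC.
    rewrite mulrC; apply: is_derive1_comp; last first.
      by have := is_deriveZ (u i ord0) (is_derive_id t 1); rewrite /GRing.scale/= mulr1.
    apply: is_derive_line; rewrite (_ : (_ * _) *: _ = t *: v i); last by rewrite /v scalerA mulrC.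
    rewrite [x + t *: v i + S i]addrAC; apply: dh; rewrite -addrA; apply: Kin => //; apply: le_trans ud; apply: nsq_le => j.
    rewrite !mxE eqxx andbT; case: (ltngtP j i) => [ji|ij|/val_inj ->].
    + by rewrite (_ : j == i = false) ?mulr0 ?addr0// -val_eqE ltn_eqF.
    + by rewrite (_ : j == i = false) ?mulr0 ?addr0 ?normr0// -val_eqE gtn_eqF.
    + rewrite eqxx mulr1 add0r normrM ler_piMl// ger0_norm; move: t01; lra.
  - by move=> s; exact: sqr_ge0.
  - exact: mA.
have tel x : h (x + u) - h x = \sum_(i < n) (h (x + S i.+1) - h (x + S i)).
  rewrite -(big_mkord xpredT (fun i => h (x + S i.+1) - h (x + S i))).
  by rewrite telescope_sumr// Sn S0 addr0.
have mAi i : measurable_fun setT (fun w : 'cV[R]_n => ((u i ord0 * g i (w + S i)) ^+ 2)%:E).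
  apply/measurable_EFinP; apply: measurable_funX; apply: measurable_funM => //.
  by apply: measurableT_comp (mg i) _; apply: measurable_cVD => //; exact: measurable_cst.
have Ai0 i (w : 'cV[R]_n) : (0 <= ((u i ord0 * g i (w + S i)) ^+ 2)%:E)%E by rewrite lee_fin sqr_ge0.
have mkA i : measurable_fun setT (fun x : 'cV[R]_n => \int[mu]_(s in I01) (A i x s)%:E)%E.
  exact: measurable_integral_line (mAi i) (Ai0 i).
have IA0 i x : (0 <= \int[mu]_(s in I01) (A i x s)%:E)%E.
  by apply: integral_ge0 => s _; rewrite lee_fin sqr_ge0.
apply: (@le_trans _ _ (\int[leb]_(x in K) ((2 ^+ n)%:E * \sum_(i < n) \int[mu]_(s in I01) (A i x s)%:E))%E).
  apply: ge0_le_integral_dom; first by move=> x _; rewrite lee_fin sqr_ge0.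
  move=> x Kx; rewrite -sqrrN opprB tel.
    apply: (@le_trans _ _ (2 ^+ n * \sum_(i < n) (h (x + S i.+1) - h (x + S i)) ^+ 2)%:E).
      by rewrite lee_fin; exact: sqr_sum_le.
    rewrite EFinM lee_pmul2l ?lte_fin ?exprn_gt0// -sumEFin; apply: lee_sum => i _.
    exact: step.
apply: (@le_trans _ _ (\int[leb]_x ((2 ^+ n)%:E * \sum_(i < n) \int[mu]_(s in I01) (A i x s)%:E))%E).
  apply: ge0_subset_integral => //.
  - by apply: emeasurable_funM => //; exact: emeasurable_sum.
  - by move=> x _; rewrite mule_ge0 ?lee_fin// sume_ge0.
rewrite ge0_integralZl ?lee_fin//; [|exact: emeasurable_sum|by move=> x _; exact: sume_ge0].
rewrite EFinM -muleA lee_pmul2l ?lte_fin ?exprn_gt0// ge0_integral_sum//.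
rewrite ge0_sume_distrr; last by move=> i _; apply: integral_ge0 => x _; rewrite lee_fin sqr_ge0.
apply: lee_sum => i _.
have mg2 : measurable_fun setT (fun x => (g i x ^+ 2)%:E) by apply/measurable_EFinP; exact: measurable_funX.
have g20 x : (0 <= (g i x ^+ 2)%:E)%E by rewrite lee_fin sqr_ge0.
rewrite (integral_line_shift (v i) (mAi i) (Ai0 i)).
under eq_integral do rewrite exprMn EFinM.
rewrite ge0_integralZl ?lee_fin ?sqr_ge0//; last first.
  apply: measurableT_comp mg2 _; by apply: measurable_cVD => //; exact: measurable_cst.
under [in leLHS]eq_integral do rewrite addrC.
rewrite (integral_lebesgue_cV_shift (S i) mg2 g20) lee_wpmul2r//; first exact: integral_ge0.
by rewrite lee_fin; apply: le_trans ud; exact: coor_nsq.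
Qed.

(** By Jensen the mollification error is at most the bump average of the squared shifts, and each
    shift costs O(d) because |u|^2 <= d on the support of the bump. *)
Lemma sub_smooth_le (K : set 'cV[R]_n) : measurable K -> K `<=` inner ->
  (\int[leb]_(x in K) ((h x - smooth x) ^+ 2)%:E <=
   (2 ^+ n * d)%:E * \sum_i \int[leb]_x (g i x ^+ 2)%:E)%E.
Proof.
move=> mK Kin.
have mb : measurable_fun setT (mbump : 'cV[R]_n -> R) by exact: measurable_bump.
pose k (q : 'cV[R]_n * 'cV[R]_n) := (mbump q.2 * (h q.1 - h (q.1 + q.2)) ^+ 2)%:E.
have k0 q : (0 <= k q)%E by rewrite lee_fin mulr_ge0 ?bump_ge0 ?sqr_ge0.
have mk : measurable_fun setT k.
  apply/measurable_EFinP; apply: measurable_funM; first exact: measurableT_comp mb _.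
  apply: measurable_funX; apply: measurable_funB; first exact: measurableT_comp mh _.
  by apply: measurableT_comp mh _; exact: measurable_cVD.
have mkF := measurable_fun_fubini_tonelli_F (m2 := leb) k mk k0.
apply: (@le_trans _ _ (\int[leb]_(x in K) \int[leb]_u k (x, u))%E).
  apply: ge0_le_integral_dom => x _; first by rewrite lee_fin sqr_ge0.
  exact: sqr_sub_smooth_le.
have mK1 : measurable_fun setT (fun x : 'cV[R]_n => (\1_K x)%:E : \bar R).
  by apply/measurable_EFinP; exact: measurable_indic.
rewrite integral_indicE.
under eq_integral => x _.
  rewrite -ge0_integralZr ?lee_fin//; last exact: measurableT_comp mk (measurable_pair1 _).
  over.
rewrite (fubini_tonelli (fun q => k q * (\1_K q.1)%:E)%E); last 2 first.
- by apply: emeasurable_funM => //; exact: measurableT_comp mK1 _.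
- by move=> q; apply: mule_ge0; [exact: k0|rewrite lee_fin].
set c := (2 ^+ n * d)%:E; set s := (\sum_i _)%E.
have s0 : (0 <= s)%E by apply: sume_ge0 => i _; apply: integral_ge0 => x _; rewrite lee_fin sqr_ge0.
have c0 : (0 <= c)%E by rewrite lee_fin mulr_ge0 ?exprn_ge0// ltW.
apply: (@le_trans _ _ (\int[leb]_u ((mbump u)%:E * (c * s)))%E); last first.
  rewrite ge0_integralZr ?mule_ge0//.
  - by rewrite (integral_bump n d0) mul1e.
  - exact/measurable_EFinP.
  - by move=> u _; rewrite lee_fin bump_ge0.
apply: ge0_le_integral_dom => u _; first by apply: integral_ge0 => x _; apply: mule_ge0; [exact: k0|rewrite lee_fin].
have [ud|ud] := leP (nsq u) d; last first.
  rewrite bump_eq0 ?mul0e ?(ltW ud)// integral0_eq// => x _.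
  by rewrite /k/= bump_eq0 ?mul0r ?mul0e// ltW.
rewrite /k/= (eq_integral (fun x => (mbump u)%:E * (((h x - h (x + u)) ^+ 2)%:E * (\1_K x)%:E)))%E; last first.
  by move=> x _; rewrite EFinM muleA.
rewrite ge0_integralZl ?lee_fin ?bump_ge0//; last 2 first.
- apply: emeasurable_funM => //; apply/measurable_EFinP; apply: measurable_funX.
  apply: measurable_funB => //; apply: measurableT_comp mh _.
  by apply: measurable_cVD => //; exact: measurable_cst.
- by move=> x _; rewrite mule_ge0 ?lee_fin ?sqr_ge0.
rewrite -integral_indicE lee_wpmul2l ?lee_fin ?bump_ge0//.
exact: sqr_sub_shift_le.
Qed.

End smoothing.

(** * Energy of pairs sharing the active variable *)

Lemma cauchy_schwarz_sum (R : realFieldType) n (a b : 'I_n -> R) :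
  (\sum_i a i * b i) ^+ 2 <= (\sum_i a i ^+ 2) * (\sum_i b i ^+ 2).
Proof.
set p := \sum_i _ * _; set A := \sum_i a i ^+ 2; set B := \sum_i b i ^+ 2.
have B0 : 0 <= B by apply: sumr_ge0 => i _; exact: sqr_ge0.
have key t : 0 <= A - 2 * t * p + t ^+ 2 * B.
  rewrite [leRHS](_ : _ = \sum_i (a i - t * b i) ^+ 2).
    by apply: sumr_ge0 => i _; exact: sqr_ge0.
  rewrite /A /p /B !mulr_sumr -sumrN -!big_split/=; apply: eq_bigr => i _; ring.
have [B00|Bn0] := eqVneq B 0.
  have /(psumr_eq0P (fun i _ => sqr_ge0 (b i))) b0 : \sum_i b i ^+ 2 = 0 by [].
  rewrite /p big1 ?expr0n ?B00 ?mulr0// => i _.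
  by have /eqP := b0 i isT; rewrite sqrf_eq0 => /eqP ->; rewrite mulr0.
have Bp : 0 < B by rewrite lt_def Bn0.
have : 0 <= (A - 2 * (p / B) * p + (p / B) ^+ 2 * B) * B by rewrite mulr_ge0.
have -> : (A - 2 * (p / B) * p + (p / B) ^+ 2 * B) * B = A * B - p ^+ 2 by field.
by rewrite subr_ge0.
Qed.

Lemma measurable_funV d (T : measurableType d) (R : realType) (f : T -> R) :
  measurable_fun setT f -> (forall x, 0 <= f x) -> measurable_fun setT (fun x => (f x)^-1).
Proof.
move=> mf f0; rewrite (_ : (fun _ => _) = (fun x => f x `^ (- 1))); last first.
  by apply/funext => x; rewrite powR_inv1.
exact: measurableT_comp (measurable_powR _) mf.
Qed.

Lemma le_add_mul4 (R : realType) (a b c : \bar R) :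
  (a <= 2%:E * c)%E -> (b <= 2%:E * c)%E -> (a + b <= 4%:E * c)%E.
Proof.
move=> ac bc; rewrite (_ : 4%:E = 2%:E + 2%:E)%E; last by rewrite -EFinD; congr EFin; ring.
by rewrite ge0_muleDl ?lee_fin// leeD.
Qed.

Section pair_energy.
Variables (R : realType) (n k l : nat) (hkl : (k + l)%N = n).
Variables (W1 : 'M[R]_(n, k)) (W2 : 'M[R]_(n, l)).
Hypothesis oW : orthogonal_mx (castmx (erefl n, hkl) (row_mx W1 W2)).
Variable rho : 'cV[R]_n -> R.
Hypothesis mrho : measurable_fun setT rho.
Hypothesis rho0 : forall x, 0 <= rho x.
Local Notation leb := (lebesgue_cV R).
Local Notation rc := (recombine W1 W2).
Local Notation m := (marginal W1 W2 rho).
Local Notation T2 := ('cV[R]_k * 'cV[R]_l)%type.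
Local Notation T3 := (('cV[R]_k * 'cV[R]_l) * 'cV[R]_l)%type.

(* Density, in (y, z, z'), of two conditionally independent draws given y, restricted
   to both points lying in K; where the marginal vanishes the weight is 0 since x / 0 = 0. *)
Definition pair_weight (K : set 'cV[R]_n) y z z' : R :=
  rho (rc y z) * rho (rc y z') / m y * (\1_K (rc y z) * \1_K (rc y z')).

(** For [K = setT] and square-integrable [q] this is twice the prior mean of the conditional
    variance of [q] given y, in a form that stays meaningful when the moments of [q] are not known
    to be finite. *)
Definition pair_energy (K : set 'cV[R]_n) (q : 'cV[R]_n -> R) : \bar R :=
  (\int[leb k]_y \int[leb l]_z \int[leb l]_z'
    (pair_weight K y z z' * (q (rc y z) - q (rc y z')) ^+ 2)%:E)%E.

Lemma marginal_ge0 y : 0 <= m y.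
Proof. by apply: fine_ge0; apply: integral_ge0 => z _; rewrite lee_fin. Qed.

Lemma measurable_rc : measurable_fun setT (fun p : T2 => rc p.1 p.2).
Proof. by apply: measurable_recombine; [exact: measurable_fst|exact: measurable_snd]. Qed.

Lemma measurable_marginal : measurable_fun setT m.
Proof.
apply: measurableT_comp => //.
apply: (measurable_fun_fubini_tonelli_F (fun p : T2 => (rho (rc p.1 p.2))%:E)).
  by apply/measurable_EFinP; exact: measurableT_comp mrho measurable_rc.
by move=> p; rewrite lee_fin.
Qed.

Lemma measurable_rc1 : measurable_fun setT (fun p : T3 => rc p.1.1 p.1.2).
Proof. exact: measurableT_comp measurable_rc measurable_fst. Qed.

Lemma measurable_rc2 : measurable_fun setT (fun p : T3 => rc p.1.1 p.2).
Proof.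
apply: measurable_recombine; last exact: measurable_snd.
exact: measurableT_comp measurable_fst measurable_fst.
Qed.

Lemma measurable_pair_weight K : measurable K ->
  measurable_fun setT (fun p : T3 => pair_weight K p.1.1 p.1.2 p.2).
Proof.
move=> mK; have mI := @measurable_indic _ 'cV[R]_n R setT _ mK.
apply: measurable_funM; last first.
  by apply: measurable_funM; [exact: measurableT_comp mI measurable_rc1|exact: measurableT_comp mI measurable_rc2].
apply: measurable_funM; last first.
  apply: measurable_funV => [|p]; last exact: marginal_ge0.
  apply: measurableT_comp measurable_marginal _; exact: measurableT_comp measurable_fst measurable_fst.
by apply: measurable_funM; [exact: measurableT_comp mrho measurable_rc1|exact: measurableT_comp mrho measurable_rc2].
Qed.

Lemma pair_weight_ge0 K y z z' : 0 <= pair_weight K y z z'.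
Proof. by rewrite mulr_ge0 ?divr_ge0 ?mulr_ge0// marginal_ge0. Qed.

Lemma pair_weightC K y z z' : pair_weight K y z z' = pair_weight K y z' z.
Proof. by rewrite /pair_weight (mulrC (rho _)) (mulrC (\1_K _)). Qed.

Section triple.
Variable F : T3 -> \bar R.
Hypotheses (mF : measurable_fun setT F) (F0 : forall p, (0 <= F p)%E).

Lemma measurable_triple1 : measurable_fun setT (fun p : T2 => \int[leb l]_z' F (p, z'))%E.
Proof. exact: (measurable_fun_fubini_tonelli_F F). Qed.

Lemma measurable_triple2 :
  measurable_fun setT (fun y => \int[leb l]_z \int[leb l]_z' F ((y, z), z'))%E.
Proof.
apply: (measurable_fun_fubini_tonelli_F (fun p : T2 => \int[leb l]_z' F (p, z'))%E).
  exact: measurable_triple1.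
by move=> p; exact: integral_ge0.
Qed.

Lemma measurable_triple_section y :
  measurable_fun setT (fun p : 'cV[R]_l * 'cV[R]_l => F ((y, p.1), p.2)).
Proof.
apply: measurableT_comp mF _; apply: measurable_fun_pair; last exact: measurable_snd.
by apply: measurable_fun_pair; [exact: measurable_cst|exact: measurable_fst].
Qed.

Lemma triple_swap y :
  (\int[leb l]_z \int[leb l]_z' F ((y, z), z') = \int[leb l]_z' \int[leb l]_z F ((y, z), z'))%E.
Proof.
exact: (fubini_tonelli (fun p : 'cV[R]_l * 'cV[R]_l => F ((y, p.1), p.2)) (measurable_triple_section y)).
Qed.

End triple.

Lemma triple_integralD (F G : T3 -> \bar R) :
  measurable_fun setT F -> measurable_fun setT G ->
  (forall p, (0 <= F p)%E) -> (forall p, (0 <= G p)%E) ->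
  (\int[leb k]_y \int[leb l]_z \int[leb l]_z' (F ((y, z), z') + G ((y, z), z')) =
   \int[leb k]_y \int[leb l]_z \int[leb l]_z' F ((y, z), z') +
   \int[leb k]_y \int[leb l]_z \int[leb l]_z' G ((y, z), z'))%E.
Proof.
move=> mF mG F0 G0.
rewrite -ge0_integralD//; first last.
- exact: measurable_triple2.
- by move=> y _; apply: integral_ge0 => z _; exact: integral_ge0.
- exact: measurable_triple2.
- by move=> y _; apply: integral_ge0 => z _; exact: integral_ge0.
apply: eq_integral => y _; rewrite -ge0_integralD//; first last.
- exact: measurableT_comp (measurable_triple1 mG G0) (measurable_pair1 _).
- by move=> z _; exact: integral_ge0.
- exact: measurableT_comp (measurable_triple1 mF F0) (measurable_pair1 _).
- by move=> z _; exact: integral_ge0.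
apply: eq_integral => z _; rewrite -ge0_integralD//.
- exact: measurableT_comp mF (measurable_pair1 _).
- exact: measurableT_comp mG (measurable_pair1 _).
Qed.

Lemma triple_integralZl (F : T3 -> \bar R) (c : R) : 0 <= c ->
  measurable_fun setT F -> (forall p, (0 <= F p)%E) ->
  (\int[leb k]_y \int[leb l]_z \int[leb l]_z' (c%:E * F ((y, z), z')) =
   c%:E * \int[leb k]_y \int[leb l]_z \int[leb l]_z' F ((y, z), z'))%E.
Proof.
move=> c0 mF F0.
rewrite -ge0_integralZl//; first last.
- by move=> y _; apply: integral_ge0 => z _; exact: integral_ge0.
- exact: measurable_triple2.
apply: eq_integral => y _; rewrite -ge0_integralZl//; first last.
- by move=> z _; exact: integral_ge0.
- exact: measurableT_comp (measurable_triple1 mF F0) (measurable_pair1 _).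
apply: eq_integral => z _; rewrite -ge0_integralZl//.
exact: measurableT_comp mF (measurable_pair1 _).
Qed.

Lemma le_triple_integral (F G : T3 -> \bar R) :
  (forall p, (0 <= F p)%E) -> (forall p, (F p <= G p)%E) ->
  (\int[leb k]_y \int[leb l]_z \int[leb l]_z' F ((y, z), z') <=
   \int[leb k]_y \int[leb l]_z \int[leb l]_z' G ((y, z), z'))%E.
Proof.
move=> F0 FG.
do 3 (apply: ge0_le_integral_dom => ? _; first by repeat (apply: integral_ge0 => ? _)).
exact: FG.
Qed.

(** The mass is 1 where the marginal is nonzero. It is 0 elsewhere, also where the fibre integral is
    infinite and [fine] returns 0, since division by 0 gives 0; hence the inequality. *)
Lemma integral_conditional_le1 y : (\int[leb l]_z (rho (rc y z) / m y)%:E <= 1)%E.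
Proof.
have mr : measurable_fun setT (fun z => (rho (rc y z))%:E).
  apply/measurable_EFinP; apply: measurableT_comp mrho _.
  by apply: measurable_recombine => //; exact: measurable_cst.
under eq_integral do rewrite mulrC EFinM.
rewrite ge0_integralZl ?lee_fin ?invr_ge0 ?marginal_ge0//; last by move=> z _; rewrite lee_fin.
have [->|m0] := eqVneq (m y) 0; first by rewrite invr0 mul0e.
have fin : (\int[leb l]_z (rho (rc y z))%:E)%E \is a fin_num.
  move: m0; rewrite /marginal /Rintegral; case: (integral _ _ _) => //=; by rewrite eqxx.
by rewrite -(fineK fin) -EFinM mulVf.
Qed.

Lemma pair_weight_mass K (q : 'cV[R]_n -> R) : measurable K -> measurable_fun setT q ->
  (\int[leb k]_y \int[leb l]_z \int[leb l]_z' (pair_weight K y z z' * q (rc y z) ^+ 2)%:E <=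
   \int[leb n]_(x in K) (q x ^+ 2 * rho x)%:E)%E.
Proof.
move=> mK mq; rewrite [leRHS]integral_indicE.
have mI := @measurable_indic _ 'cV[R]_n R setT _ mK.
rewrite (integral_recombine oW); last 2 first.
- apply: emeasurable_funM; apply/measurable_EFinP => //.
  by apply: measurable_funM => //; exact: measurable_funX.
- by move=> x; rewrite mule_ge0 ?lee_fin// mulr_ge0 ?sqr_ge0.
apply: ge0_le_integral_dom => y _.
  by do 2 apply: integral_ge0 => ? _; rewrite lee_fin mulr_ge0 ?pair_weight_ge0 ?sqr_ge0.
apply: ge0_le_integral_dom => z _.
  by apply: integral_ge0 => ? _; rewrite lee_fin mulr_ge0 ?pair_weight_ge0 ?sqr_ge0.
set a := (_ * _)%E.
have a0 : (0 <= a)%E by rewrite mule_ge0 ?lee_fin// mulr_ge0 ?sqr_ge0.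
have mr : measurable_fun setT (fun z => (rho (rc y z) / m y)%:E).
  apply/measurable_EFinP; apply: measurable_funM => //; apply: measurableT_comp mrho _.
  by apply: measurable_recombine => //; exact: measurable_cst.
apply: (@le_trans _ _ (\int[leb l]_z' (a * (rho (rc y z') / m y)%:E))%E).
  apply: ge0_le_integral_dom => z' _.
    by rewrite lee_fin mulr_ge0 ?pair_weight_ge0 ?sqr_ge0.
  rewrite /a -!EFinM lee_fin /pair_weight.
  set A := rho (rc y z); set B := rho (rc y z'); set Q := q _ ^+ 2; set I := \1_K (rc y z).
  have : 0 <= Q * A * I * (B / m y).
    apply: mulr_ge0; last by apply: divr_ge0; [exact: rho0|exact: marginal_ge0].
    by apply: mulr_ge0; [apply: mulr_ge0; [exact: sqr_ge0|exact: rho0]|exact: ler0n].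
  have -> : A * B / m y * (I * \1_K (rc y z')) * Q = Q * A * I * (B / m y) * \1_K (rc y z') by ring.
  by move=> H; rewrite ler_piMr.
rewrite ge0_integralZl//; last by move=> z' _; rewrite lee_fin divr_ge0 ?marginal_ge0.
by rewrite -[leRHS]mule1 lee_wpmul2l// integral_conditional_le1.
Qed.

Lemma measurable_energy_density K (q : 'cV[R]_n -> R) (c : R) : measurable K -> measurable_fun setT q ->
  measurable_fun setT (fun p : T3 => (c * (pair_weight K p.1.1 p.1.2 p.2 *
    (q (rc p.1.1 p.1.2) - q (rc p.1.1 p.2)) ^+ 2))%:E).
Proof.
move=> mK mq; apply/measurable_EFinP; apply: measurable_funM => //.
apply: measurable_funM; first exact: measurable_pair_weight.
apply: measurable_funX; apply: measurable_funB.
  exact: measurableT_comp mq measurable_rc1.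
exact: measurableT_comp mq measurable_rc2.
Qed.

Lemma pair_energy_le K (q : 'cV[R]_n -> R) : measurable K -> measurable_fun setT q ->
  (pair_energy K q <= 4%:E * \int[leb n]_(x in K) (q x ^+ 2 * rho x)%:E)%E.
Proof.
move=> mK mq.
pose F (p : T3) := (2 * (pair_weight K p.1.1 p.1.2 p.2 * q (rc p.1.1 p.1.2) ^+ 2))%:E : \bar R.
pose G (p : T3) := (2 * (pair_weight K p.1.1 p.1.2 p.2 * q (rc p.1.1 p.2) ^+ 2))%:E : \bar R.
have w0 := @pair_weight_ge0 K.
have F0 p : (0 <= F p)%E by rewrite lee_fin mulr_ge0// mulr_ge0 ?w0 ?sqr_ge0.
have G0 p : (0 <= G p)%E by rewrite lee_fin mulr_ge0// mulr_ge0 ?w0 ?sqr_ge0.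
have mw := measurable_pair_weight mK.
have mF : measurable_fun setT F.
  apply/measurable_EFinP; do 2 apply: measurable_funM => //.
  by apply: measurable_funX; exact: measurableT_comp mq measurable_rc1.
have mG : measurable_fun setT G.
  apply/measurable_EFinP; do 2 apply: measurable_funM => //.
  by apply: measurable_funX; exact: measurableT_comp mq measurable_rc2.
have IF : (\int[leb k]_y \int[leb l]_z \int[leb l]_z' F ((y, z), z') <=
    2%:E * \int[leb n]_(x in K) (q x ^+ 2 * rho x)%:E)%E.
  rewrite (triple_integralZl (F := fun p => (pair_weight K p.1.1 p.1.2 p.2 * q (rc p.1.1 p.1.2) ^+ 2)%:E))//.
  - by rewrite lee_wpmul2l ?lee_fin// pair_weight_mass.
  - apply/measurable_EFinP; apply: measurable_funM => //.
    by apply: measurable_funX; exact: measurableT_comp mq measurable_rc1.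
  - by move=> p; rewrite lee_fin mulr_ge0 ?sqr_ge0.
apply: (@le_trans _ _ (\int[leb k]_y \int[leb l]_z \int[leb l]_z' (F ((y, z), z') + G ((y, z), z'))))%E.
  apply: (@le_triple_integral (fun p => (pair_weight K p.1.1 p.1.2 p.2 *
    (q (rc p.1.1 p.1.2) - q (rc p.1.1 p.2)) ^+ 2)%:E) (fun p => F p + G p)%E) => p.
    by rewrite lee_fin mulr_ge0 ?sqr_ge0.
  rewrite /F /G -EFinD lee_fin; have := w0 p.1.1 p.1.2 p.2.
  set w := pair_weight _ _ _ _; set a := q _; set b := q _ => wp.
  by have := mulr_ge0 wp (sqr_ge0 (a + b)); rewrite sqrrB sqrrD; nra.
rewrite triple_integralD//; apply: le_add_mul4; first exact: IF.
apply: le_trans IF; rewrite le_eqVlt; apply/orP; left; apply/eqP.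
apply: eq_integral => y _; rewrite (triple_swap mG G0 y); apply: eq_integral => z _; apply: eq_integral => z' _.
by rewrite /F /G/= pair_weightC.
Qed.

Lemma pair_energy_triangle K (q s : 'cV[R]_n -> R) :
  measurable K -> measurable_fun setT q -> measurable_fun setT s ->
  (pair_energy K q <= 2%:E * pair_energy K s + 2%:E * pair_energy K (fun x => q x - s x)%R)%E.
Proof.
move=> mK mq ms.
have w0 := @pair_weight_ge0 K.
have mqs : measurable_fun setT (fun x => q x - s x) by exact: measurable_funB.
have scale (r : 'cV[R]_n -> R) : measurable_fun setT r ->
    (\int[leb k]_y \int[leb l]_z \int[leb l]_z' (2 * (pair_weight K y z z' * (r (rc y z) - r (rc y z')) ^+ 2))%:E =
     2%:E * pair_energy K r)%E.
  move=> mr; rewrite (triple_integralZl (F := fun p => (pair_weight K p.1.1 p.1.2 p.2 *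
    (r (rc p.1.1 p.1.2) - r (rc p.1.1 p.2)) ^+ 2)%:E))//.
  - have := measurable_energy_density 1 mK mr; by under eq_fun do rewrite mul1r.
  - by move=> p; rewrite lee_fin mulr_ge0 ?sqr_ge0.
have eq_le (x y : \bar R) : x = y -> (x <= y)%E by move=> ->.
apply: le_trans (leeD (eq_le _ _ (scale _ ms)) (eq_le _ _ (scale _ mqs))).
rewrite -(@triple_integralD (fun p : T3 => (2 * (pair_weight K p.1.1 p.1.2 p.2 *
    (s (rc p.1.1 p.1.2) - s (rc p.1.1 p.2)) ^+ 2))%:E)
  (fun p : T3 => (2 * (pair_weight K p.1.1 p.1.2 p.2 *
    (q (rc p.1.1 p.1.2) - s (rc p.1.1 p.1.2) - (q (rc p.1.1 p.2) - s (rc p.1.1 p.2))) ^+ 2))%:E)).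
- apply: (@le_triple_integral (fun p => (pair_weight K p.1.1 p.1.2 p.2 *
    (q (rc p.1.1 p.1.2) - q (rc p.1.1 p.2)) ^+ 2)%:E)
    (fun p : T3 => (2 * (pair_weight K p.1.1 p.1.2 p.2 *
    (s (rc p.1.1 p.1.2) - s (rc p.1.1 p.2)) ^+ 2))%:E +
    (2 * (pair_weight K p.1.1 p.1.2 p.2 *
    (q (rc p.1.1 p.1.2) - s (rc p.1.1 p.1.2) - (q (rc p.1.1 p.2) - s (rc p.1.1 p.2))) ^+ 2))%:E)%E) => p.
    by rewrite lee_fin mulr_ge0 ?sqr_ge0.
  rewrite -EFinD lee_fin; have := w0 p.1.1 p.1.2 p.2.
  set w := pair_weight _ _ _ _; set a := q _; set b := q _; set c := s _; set e := s _ => wp.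
  have := mulr_ge0 wp (sqr_ge0 ((a - c - (b - e)) - (c - e))).
  have -> : a - b = (a - c - (b - e)) + (c - e) by ring.
  by move: (a - c - (b - e)) (c - e) => A B; rewrite sqrrB sqrrD; nra.
- exact: measurable_energy_density.
- exact: (measurable_energy_density 2 mK mqs).
- by move=> p; rewrite lee_fin mulr_ge0// mulr_ge0 ?w0 ?sqr_ge0.
- by move=> p; rewrite lee_fin mulr_ge0// mulr_ge0 ?w0 ?sqr_ge0.
Qed.

End pair_energy.

Section smooth_measurable.
Variables (R : realType) (n : nat) (d : R) (h : 'cV[R]_n -> R) (M : R).
Hypotheses (d0 : 0 < d) (mh : measurable_fun setT h) (h0 : forall x, 0 <= h x).

Lemma measurable_smooth : measurable_fun setT (smooth d h).
Proof.
apply: measurableT_comp => //.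
apply: (measurable_fun_fubini_tonelli_F
  (fun p : 'cV[R]_n * 'cV[R]_n => (h p.2 * @mbump R n d (p.2 - p.1))%:E)).
  apply/measurable_EFinP; apply: measurable_funM; first exact: measurableT_comp mh measurable_snd.
  apply: measurableT_comp (@measurable_bump R n d) _.
  by apply: measurable_cVB; [exact: measurable_snd|exact: measurable_fst].
by move=> p; rewrite lee_fin mulr_ge0// bump_ge0.
Qed.

End smooth_measurable.

Section poincare_limit.
Variables (R : realType) (n k l : nat) (hkl : (k + l)%N = n).
Variables (W1 : 'M[R]_(n, k)) (W2 : 'M[R]_(n, l)).
Hypothesis oW : orthogonal_mx (castmx (erefl n, hkl) (row_mx W1 W2)).
Variable rho : 'cV[R]_n -> R.
Hypothesis mrho : measurable_fun setT rho.
Hypothesis rho0 : forall x, 0 <= rho x.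
Local Notation leb := (lebesgue_cV R).
Variables (U : set 'cV[R]_n) (h : 'cV[R]_n -> R) (g : 'I_n -> 'cV[R]_n -> R) (M : R).
Hypothesis mh : measurable_fun setT h.
Hypothesis mg : forall i, measurable_fun setT (g i).
Hypothesis h0 : forall x, 0 <= h x.
Hypothesis hM : forall x, h x <= M.
Hypothesis dh : forall x, U x -> forall i, is_derive x (delta_mx i ord0) h (g i x).
Hypothesis g2 : forall i, (\int[leb n]_x (g i x ^+ 2)%:E < +oo)%E.

(** The energy of [h] is compared with that of its mollification and that of the difference, which
    by [pair_energy_le] is controlled by the error in L^2(rho). The bound [r] on the density turns
    this into a Lebesgue error of order d, which vanishes in the limit; the factor 2 is the price of
    the triangle inequality. *)
Lemma pair_energy_smooth_limit (K : set 'cV[R]_n) (r d1 : R) (B : \bar R) :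
  measurable K -> (forall x, rho x <= r) -> 0 < d1 ->
  (forall d, 0 < d -> d < d1 -> K `<=` inner d U) ->
  (forall d, 0 < d -> d < d1 -> (pair_energy W1 W2 rho K (smooth d h) <= B)%E) ->
  (pair_energy W1 W2 rho K h <= 2%:E * B)%E.
Proof.
move=> mK rr d10 KU EB.
pose s i := fine (\int[leb n]_x (g i x ^+ 2)%:E)%E.
have sE i : (\int[leb n]_x (g i x ^+ 2)%:E = (s i)%:E)%E.
  by rewrite fineK// ge0_fin_numE ?g2//; apply: integral_ge0 => x _; rewrite lee_fin sqr_ge0.
have s0 i : 0 <= s i.
  by apply: fine_ge0; apply: integral_ge0 => x _; rewrite lee_fin sqr_ge0.
pose S := \sum_i s i.
have S0 : 0 <= S by apply: sumr_ge0.
have r0 : 0 <= r by apply: le_trans (rho0 0) (rr 0).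
(* The 8 is 2 from the triangle inequality times 4 from [pair_energy_le]; d is then chosen with c d
   <= e, dividing by c + 1 since c may vanish. *)
pose c := 8 * (r * (2 ^+ n * S)).
have c0 : 0 <= c by rewrite /c mulr_ge0// mulr_ge0// mulr_ge0// exprn_ge0.
apply/lee_addgt0Pr => e e0.
pose d := Num.min (d1 / 2) (e / (c + 1)).
have c1 : 0 < c + 1 by rewrite ltr_wpDl.
have d0 : 0 < d by rewrite /d lt_min !divr_gt0.
have dd1 : d < d1 by rewrite /d gt_min ltr_pdivrMr// ltr_pMr// ltr1n.
have cd : c * d <= e.
  apply: (@le_trans _ _ (c * (e / (c + 1)))); first by rewrite ler_wpM2l// /d ge_min lexx orbT.
  by rewrite mulrCA ger_pMr// ler_pdivrMr// mul1r lerDl.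
have msm := measurable_smooth d0 mh h0.
have tri := @pair_energy_triangle R n k l W1 W2 rho mrho rho0 K h (smooth d h) mK mh msm.
apply: (le_trans tri).
apply: leeD; first by rewrite lee_wpmul2l ?lee_fin// EB.
have mq : measurable_fun setT (fun x => h x - smooth d h x) by exact: measurable_funB.
apply: (@le_trans _ _ (2%:E * (4%:E * (r%:E * ((2 ^+ n * d) * S)%:E)))%E); last first.
  by rewrite -!EFinM lee_fin; apply: le_trans cd; rewrite le_eqVlt; apply/orP; left; apply/eqP; rewrite /c; ring.
rewrite lee_wpmul2l ?lee_fin//.
apply: le_trans (pair_energy_le oW mrho rho0 mK mq) _.
rewrite lee_wpmul2l ?lee_fin//.
apply: (@le_trans _ _ (r%:E * \int[leb n]_(x in K) ((h x - smooth d h x) ^+ 2)%:E)%E).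
  rewrite -ge0_integralZl ?lee_fin//; last 2 first.
  - apply/measurable_EFinP; apply: measurable_funTS; exact: measurable_funX.
  - by move=> x _; rewrite lee_fin sqr_ge0.
  apply: ge0_le_integral_dom => x _; first by rewrite lee_fin mulr_ge0 ?sqr_ge0.
  by rewrite -EFinM lee_fin mulrC ler_wpM2r ?sqr_ge0.
rewrite lee_wpmul2l ?lee_fin// EFinM.
have sub := sub_smooth_le d0 mh mg h0 hM dh mK (KU _ d0 dd1).
apply: (le_trans sub).
by rewrite (eq_bigr (fun i => (s i)%:E))// sumEFin.
Qed.

End poincare_limit.

(** * Energy along paths in the inactive variable *)

Section recombine_orthogonal.
Variables (R : realType) (n k l : nat) (hkl : (k + l)%N = n).
Variables (W1 : 'M[R]_(n, k)) (W2 : 'M[R]_(n, l)).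
Hypothesis oW : orthogonal_mx (castmx (erefl n, hkl) (row_mx W1 W2)).

Lemma orthogonal_blocks :
  [/\ W1^T *m W1 = 1%:M, W1^T *m W2 = 0, W2^T *m W1 = 0 & W2^T *m W2 = 1%:M].
Proof.
move: W1 W2 oW; case: n / hkl => V1 V2; rewrite castmx_id /orthogonal_mx.
rewrite tr_row_mx mul_col_row (scalar_mx_block k l (1 : R)).
by case/eq_block_mx.
Qed.

Lemma nsq_recombine y z : nsq (recombine W1 W2 y z) = nsq y + nsq z.
Proof.
move: W1 W2 oW; case: n / hkl => V1 V2; rewrite castmx_id => oV.
by rewrite /recombine -mul_row_col nsq_orthogonal// nsq_col_mx.
Qed.

End recombine_orthogonal.

Lemma sum_mulmx_tr (R : comNzRingType) n l (W : 'M[R]_(n, l)) (p : 'cV[R]_l) (g : 'I_n -> R) :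
  \sum_i (W *m p) i ord0 * g i = \sum_j p j ord0 * (W^T *m \col_i g i) j ord0.
Proof.
have : ((W *m p)^T *m \col_i g i) ord0 ord0 = (p^T *m (W^T *m \col_i g i)) ord0 ord0.
  by rewrite trmx_mul mulmxA.
rewrite mxE [RHS]mxE; under eq_bigr do rewrite !mxE.
move=> H; transitivity (\sum_j (W *m p)^T ord0 j * g j).
  by apply: eq_bigr => i _; rewrite [X in _ = X * _]mxE.
transitivity (\sum_j p^T ord0 j * (W^T *m \col_i g i) j ord0); last first.
  by apply: eq_bigr => i _; rewrite mxE.
by rewrite -H; apply: eq_bigr => i _; rewrite !mxE.
Qed.

Lemma integral_cst_unit_itv (R : realType) (c : \bar R)
    (I01 := [set` `[(0%R : R), 1%R]] : set (measurableTypeR R)) :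
  (\int[@lebesgue_measure R]_t (c * (\1_I01 t)%:E) = c)%E.
Proof.
rewrite -integral_indicE.
have mI : measurable I01 by exact: measurable_itv.
rewrite (integral_cst _ mI).
have H : @lebesgue_measure R I01 = 1%E.
  by rewrite lebesgue_measure_itv/= lte_fin ltr01 oppr0 adde0.
by rewrite -[RHS]mule1; congr (_ * _)%E; exact: H.
Qed.

Section path_energy.
Variables (R : realType) (n k l : nat) (hkl : (k + l)%N = n).
Variables (W1 : 'M[R]_(n, k)) (W2 : 'M[R]_(n, l)).
Hypothesis oW : orthogonal_mx (castmx (erefl n, hkl) (row_mx W1 W2)).
Variable rho : 'cV[R]_n -> R.
Hypothesis mrho : measurable_fun setT rho.
Hypothesis rho0 : forall x, 0 <= rho x.
Local Notation leb := (lebesgue_cV R).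
Local Notation mu := (@lebesgue_measure R).
Local Notation I01 := ([set` `[(0%R : R), 1%R]] : set (measurableTypeR R)).
Local Notation rc := (recombine W1 W2).
Variables (U : set 'cV[R]_n) (h : 'cV[R]_n -> R) (g : 'I_n -> 'cV[R]_n -> R) (M : R).
Hypothesis mh : measurable_fun setT h.
Hypothesis mg : forall i, measurable_fun setT (g i).
Hypothesis h0 : forall x, 0 <= h x.
Hypothesis hM : forall x, h x <= M.
Hypothesis dh : forall x, U x -> forall i, is_derive x (delta_mx i ord0) h (g i x).
Hypothesis g2 : forall i, (\int[leb n]_x (g i x ^+ 2)%:E < +oo)%E.
Variable d : R.
Hypothesis d0 : 0 < d.

Definition grad2 (x : 'cV[R]_n) : R := nsq (W2^T *m \col_i g i x).

Definition avg_grad2 (x : 'cV[R]_n) : \bar R := (\int[leb n]_u (mbump d u * grad2 (x + u))%:E)%E.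

Lemma measurable_grad2 : measurable_fun setT grad2.
Proof.
apply: measurableT_comp (@measurable_nsq R l) _; apply: measurable_mulmx.
by apply/measurable_fun_coorP => i; under eq_fun do rewrite mxE; exact: mg.
Qed.

Lemma measurable_avg_grad2 : measurable_fun setT avg_grad2.
Proof.
apply: (measurable_fun_fubini_tonelli_F
  (fun p : 'cV[R]_n * 'cV[R]_n => (@mbump R n d p.2 * grad2 (p.1 + p.2))%:E)).
  apply/measurable_EFinP; apply: measurable_funM.
    exact: measurableT_comp (@measurable_bump R n d) measurable_snd.
  by apply: measurableT_comp measurable_grad2 _; exact: measurable_cVD.
by move=> p; rewrite lee_fin mulr_ge0 ?bump_ge0 ?nsq_ge0.
Qed.

Lemma avg_grad2_ge0 x : (0 <= avg_grad2 x)%E.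
Proof. by apply: integral_ge0 => u _; rewrite lee_fin mulr_ge0 ?bump_ge0 ?nsq_ge0. Qed.

(** Tonelli and the translation by u shift the mollification from [grad2] to the weight. What
    remains is to compare the weight [s] at x with [rho] at the points x + u reached by the bump. *)
Lemma integral_avg_grad2_le (s : 'cV[R]_n -> R) (c : R) : measurable_fun setT s ->
  0 <= c -> (forall x, 0 <= s x) ->
  (forall x u, nsq u <= d -> s x * grad2 (x + u) <= c * (rho (x + u) * grad2 (x + u))) ->
  (\int[leb n]_x ((s x)%:E * avg_grad2 x) <= c%:E * \int[leb n]_x (grad2 x * rho x)%:E)%E.
Proof.
move=> ms c0 s0 sc.
have mb : measurable_fun setT (@mbump R n d) by exact: measurable_bump.
pose F (p : 'cV[R]_n * 'cV[R]_n) := (s p.1 * (mbump d p.2 * grad2 (p.1 + p.2)))%:E.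
have F0 p : (0 <= F p)%E by rewrite lee_fin mulr_ge0// mulr_ge0 ?bump_ge0 ?nsq_ge0.
have mF : measurable_fun setT F.
  apply/measurable_EFinP; apply: measurable_funM; first exact: measurableT_comp ms _.
  apply: measurable_funM; first exact: measurableT_comp mb _.
  by apply: measurableT_comp measurable_grad2 _; exact: measurable_cVD.
have mgr : measurable_fun setT (fun x => (grad2 x * rho x)%:E).
  by apply/measurable_EFinP; apply: measurable_funM => //; exact: measurable_grad2.
rewrite (_ : (\int[leb n]_x _ = \int[leb n]_x \int[leb n]_u F (x, u))%E); last first.
  apply: eq_integral => x _; rewrite -ge0_integralZl ?lee_fin//.
    apply/measurable_EFinP; apply: measurable_funM => //.
    apply: measurableT_comp measurable_grad2 _; apply: measurable_cVD => //; exact: measurable_cst.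
  by move=> u _; rewrite lee_fin mulr_ge0 ?bump_ge0 ?nsq_ge0.
rewrite fubini_tonelli//.
set I := (c%:E * _)%E.
have I0 : (0 <= I)%E.
  rewrite mule_ge0 ?lee_fin//; apply: integral_ge0 => x _.
  by rewrite lee_fin mulr_ge0 ?nsq_ge0.
apply: (@le_trans _ _ (\int[leb n]_u ((mbump d u)%:E * I))%E); last first.
  rewrite ge0_integralZr ?integral_bump ?mul1e//; first exact/measurable_EFinP.
  by move=> u _; rewrite lee_fin bump_ge0.
apply: ge0_le_integral_dom => u _; first exact: integral_ge0.
have [ud|ud] := leP (nsq u) d; last first.
  by rewrite bump_eq0 ?mul0e ?(ltW ud)// integral0_eq// => x _; rewrite /F/= bump_eq0 ?mul0r ?mulr0// ltW.
rewrite /I -(integral_lebesgue_cV_shift u mgr); last first.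
  by move=> x; rewrite lee_fin mulr_ge0 ?nsq_ge0.
have mgu : measurable_fun setT (fun x => (grad2 (u + x) * rho (u + x))%:E).
  by apply: measurableT_comp mgr _; apply: measurable_cVD => //; exact: measurable_cst.
rewrite muleA -EFinM -ge0_integralZl//; last 2 first.
- by move=> x _; rewrite lee_fin mulr_ge0 ?nsq_ge0.
- by rewrite lee_fin mulr_ge0 ?bump_ge0.
apply: ge0_le_integral_dom => x _; first exact: F0.
rewrite /F -EFinM lee_fin/= (mulrCA (s x)) -(mulrA (mbump d u)); apply: ler_wpM2l; first exact: bump_ge0.
by rewrite (addrC u) (mulrC (grad2 _)) sc.
Qed.

Variables (a b a' b' : R -> R).
Hypothesis ma : measurable_fun setT (a : measurableTypeR R -> R).
Hypothesis mb : measurable_fun setT (b : measurableTypeR R -> R).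
Hypothesis ma' : measurable_fun setT (a' : measurableTypeR R -> R).
Hypothesis mb' : measurable_fun setT (b' : measurableTypeR R -> R).
Hypothesis da : forall s : R, is_derive s 1 a (a' s).
Hypothesis db : forall s : R, is_derive s 1 b (b' s).
Variable C : R.
Hypothesis ab_le : forall s, -1 < s < 2 ->
  [/\ `|a s| <= C, `|b s| <= C, `|a' s| <= C & `|b' s| <= C].
Hypothesis ab0 : a 0 = 1 /\ b 0 = 0.
Hypothesis ab1 : a 1 = 0 /\ b 1 = 1.

Lemma nsq_lin_le (z z' : 'cV[R]_l) s t : `|s| <= C -> `|t| <= C ->
  nsq (s *: z + t *: z') <= 2 * C ^+ 2 * (nsq z + nsq z').
Proof.
move=> sC tC; rewrite /nsq mulrDr !mulr_sumr -big_split/=; apply: ler_sum => i _.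
have C0 : 0 <= C by exact: le_trans (normr_ge0 _) sC.
have s2 : s ^+ 2 <= C ^+ 2 by rewrite -(real_normK (num_real s)) ler_sqr ?nnegrE.
have t2 : t ^+ 2 <= C ^+ 2 by rewrite -(real_normK (num_real t)) ler_sqr ?nnegrE.
rewrite !mxE; move: (z i ord0) (z' i ord0) => p q.
have := ler_wpM2r (sqr_ge0 p) s2; have := ler_wpM2r (sqr_ge0 q) t2.
by have := sqr_ge0 (s * p - t * q); rewrite sqrrB sqrrD !exprMn; nra.
Qed.

(** The path fixes y, so its velocity lies in the range of [W2] and meets the gradient only through
    W2^T; Cauchy-Schwarz separates the squared speed from [grad2]. The coefficients [a] and [b] stay
    abstract to cover both segments and rotations. *)
Lemma smooth_pair_le y z z' :
  (forall t, 0 <= t <= 1 -> inner d U (rc y (a t *: z + b t *: z'))) ->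
  (((smooth d h (rc y z) - smooth d h (rc y z')) ^+ 2)%:E <=
   \int[mu]_(t in I01) ((nsq (a' t *: z + b' t *: z'))%:E * avg_grad2 (rc y (a t *: z + b t *: z'))))%E.
Proof.
move=> pin; have [W11 W12 W21 W22] := orthogonal_blocks oW.
pose p t := rc y (a t *: z + b t *: z').
pose p' t := W2 *m (a' t *: z + b' t *: z').
have mcst m (v : 'cV[R]_m) : measurable_fun setT (fun _ : measurableTypeR R => v) by exact: measurable_cst.
have mp : measurable_fun setT (p : measurableTypeR R -> _).
  by apply: measurable_recombine => //; apply: measurable_cVD; exact: measurable_cVZ.
have mp' : measurable_fun setT (p' : measurableTypeR R -> _).
  by apply: measurable_mulmx; apply: measurable_cVD; exact: measurable_cVZ.
have dp (s : R) i : is_derive s 1 (fun r => p r i ord0) (p' s i ord0).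
  pose A := (W2 *m z) i ord0; pose B := (W2 *m z') i ord0.
  rewrite (_ : (fun r => _) = (fun r => (W1 *m y) i ord0 + (A * a r + B * b r))); last first.
    apply/funext => r; rewrite /p /recombine mxE; congr (_ + _).
    by rewrite mulmxDr -!scalemxAr mxE [X in X + _]mxE [X in _ + X]mxE mulrC (mulrC (b r)).
  rewrite (_ : p' s i ord0 = 0 + (A * a' s + B * b' s)); last first.
    by rewrite add0r /p' mulmxDr -!scalemxAr mxE [X in X + _]mxE [X in _ + X]mxE mulrC (mulrC (b' s)).
  by apply: is_deriveD; apply: is_deriveD; apply: is_deriveZ.
pose D := 2 * C ^+ 2 * (nsq z + nsq z').
have Bp s : -1 < s < 2 -> nsq (p s) <= nsq y + D + 1 /\ forall i, `|p' s i ord0| <= nsq y + D + 1.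
  move=> /ab_le[aC bC aC' bC']; split.
    by rewrite /p (nsq_recombine oW) -addrA lerD2l (le_trans (nsq_lin_le _ _ aC bC))// lerDl.
  move=> i; have : p' s i ord0 ^+ 2 <= D.
    apply: le_trans (coor_nsq _ _) _; rewrite /p' nsq_orthogonal//; exact: nsq_lin_le.
  rewrite -(real_normK (num_real _)) => H; have := nsq_ge0 y; have := sqr_ge0 (`|p' s i ord0| - 1).
  by rewrite sqrrB; nra.
have pin' t : 0 <= t <= 1 -> inner d U (p t) by exact: pin.
have H := smooth_path_le d0 mh mg h0 hM dh g2 mp mp' dp Bp pin'.
have [a0 b0] := ab0; have [a1 b1] := ab1.
have p0 : p 0 = rc y z by rewrite /p a0 b0 scale1r scale0r addr0.
have p1 : p 1 = rc y z' by rewrite /p a1 b1 scale1r scale0r add0r.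
rewrite -(sqrrN (_ - _)) opprB -p0 -p1.
apply: (le_trans H); apply: ge0_le_integral_dom => t _.
  by apply: integral_ge0 => u _; rewrite lee_fin mulr_ge0 ?bump_ge0 ?sqr_ge0.
rewrite /avg_grad2 -ge0_integralZl ?lee_fin ?nsq_ge0//; last 2 first.
- apply/measurable_EFinP; apply: measurable_funM; first exact: measurable_bump.
  apply: measurableT_comp measurable_grad2 _; apply: measurable_cVD => //; exact: measurable_cst.
- by move=> u _; rewrite lee_fin mulr_ge0 ?bump_ge0 ?nsq_ge0.
apply: ge0_le_integral_dom => u _; first by rewrite lee_fin mulr_ge0 ?bump_ge0 ?sqr_ge0.
rewrite -EFinM lee_fin [leRHS]mulrCA; apply: ler_wpM2l; first exact: bump_ge0.
rewrite /p' sum_mulmx_tr.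
exact: cauchy_schwarz_sum.
Qed.

(** Exchanging time with z and z' leaves an estimate at fixed y and t, the last hypothesis, where
    the geometry of the path enters. Time runs over an interval of length 1, so a bound [J] uniform
    in t passes through unchanged. *)
Lemma pair_energy_smooth_le (K : set 'cV[R]_n) (J : 'cV[R]_n -> \bar R) :
  measurable K -> measurable_fun setT J -> (forall x, 0 <= J x)%E ->
  (forall y z z' t, K (rc y z) -> K (rc y z') -> 0 <= t <= 1 ->
    inner d U (rc y (a t *: z + b t *: z'))) ->
  (forall y t, 0 <= t <= 1 ->
    (\int[leb l]_z \int[leb l]_z' ((pair_weight W1 W2 rho K y z z' * nsq (a' t *: z + b' t *: z'))%:E *
      avg_grad2 (rc y (a t *: z + b t *: z'))) <= \int[leb l]_z J (rc y z))%E) ->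
  (pair_energy W1 W2 rho K (smooth d h) <= \int[leb n]_x J x)%E.
Proof.
move=> mK mJ J0 Kin HJ; rewrite (integral_recombine oW)//.
apply: ge0_le_integral_dom => y _.
  by do 2 apply: integral_ge0 => ? _; rewrite lee_fin mulr_ge0 ?pair_weight_ge0 ?sqr_ge0.
pose P (q : ('cV[R]_l * 'cV[R]_l) * measurableTypeR R) := a q.2 *: q.1.1 + b q.2 *: q.1.2.
pose P' (q : ('cV[R]_l * 'cV[R]_l) * measurableTypeR R) := a' q.2 *: q.1.1 + b' q.2 *: q.1.2.
have m11 : measurable_fun setT (fun q : ('cV[R]_l * 'cV[R]_l) * measurableTypeR R => q.1.1).
  exact: measurableT_comp measurable_fst measurable_fst.
have m12 : measurable_fun setT (fun q : ('cV[R]_l * 'cV[R]_l) * measurableTypeR R => q.1.2).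
  exact: measurableT_comp measurable_snd measurable_fst.
have mP : measurable_fun setT P.
  by apply: measurable_cVD; apply: measurable_cVZ => //; exact: measurableT_comp _ measurable_snd.
have mP' : measurable_fun setT P'.
  by apply: measurable_cVD; apply: measurable_cVZ => //; exact: measurableT_comp _ measurable_snd.
pose G (q : ('cV[R]_l * 'cV[R]_l) * measurableTypeR R) :=
  ((nsq (P' q))%:E * avg_grad2 (rc y (P q)) * (\1_I01 q.2)%:E)%E.
have G0 q : (0 <= G q)%E.
  by rewrite mule_ge0 ?lee_fin// mule_ge0 ?avg_grad2_ge0// lee_fin nsq_ge0.
have mG : measurable_fun setT G.
  apply: emeasurable_funM; last first.
    apply/measurable_EFinP; apply: measurableT_comp measurable_snd.
    by apply: measurable_indic; exact: measurable_itv.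
  apply: emeasurable_funM; last first.
    by apply: measurableT_comp measurable_avg_grad2 _; apply: measurable_recombine => //; exact: measurable_cst.
  by apply/measurable_EFinP; exact: measurableT_comp (@measurable_nsq R l) _.
pose F (q : ('cV[R]_l * 'cV[R]_l) * measurableTypeR R) :=
  ((pair_weight W1 W2 rho K y q.1.1 q.1.2)%:E * G q)%E.
have F0 q : (0 <= F q)%E by apply: mule_ge0; [rewrite lee_fin pair_weight_ge0|exact: G0].
have mF : measurable_fun setT F.
  apply: emeasurable_funM => //; apply/measurable_EFinP.
  have mc : measurable_fun setT (fun q : ('cV[R]_l * 'cV[R]_l) * measurableTypeR R => ((y, q.1.1), q.1.2)).
    by apply: measurable_fun_pair => //; apply: measurable_fun_pair => //; exact: measurable_cst.
  have H := measurableT_comp (@measurable_pair_weight _ _ _ _ W1 W2 _ mrho rho0 _ mK) mc; exact: H.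
apply: (@le_trans _ _ (\int[leb l]_z \int[leb l]_z' \int[mu]_t F ((z, z'), t))%E).
  apply: ge0_le_integral_dom => z _.
    by apply: integral_ge0 => ? _; rewrite lee_fin mulr_ge0 ?pair_weight_ge0 ?sqr_ge0.
  apply: ge0_le_integral_dom => z' _; first by rewrite lee_fin mulr_ge0 ?pair_weight_ge0 ?sqr_ge0.
  have w0 := pair_weight_ge0 W1 W2 rho0 K y z z'.
  have [Kz|Kz] := pselect (K (rc y z) /\ K (rc y z')); last first.
    rewrite [X in X * _](_ : _ = 0) ?mul0r; first exact: integral_ge0.
    rewrite /pair_weight !indicE.
    by case/not_andP: Kz => Kz; rewrite (memNset Kz) ?mul0r !mulr0.
  have H := smooth_pair_le (fun t t01 => Kin y z z' t Kz.1 Kz.2 t01).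
  rewrite EFinM; apply: (le_trans (lee_wpmul2l _ H)); first by rewrite lee_fin.
  rewrite integral_indicE -ge0_integralZl//.
    have m1 : measurable_fun setT (fun t : measurableTypeR R => ((z, z'), t)) by exact: measurable_pair1.
    exact: (measurableT_comp mG m1).
  by move=> t _; exact: (G0 ((z, z'), t)).
under eq_integral => z _.
  rewrite (fubini_tonelli (fun q : 'cV[R]_l * measurableTypeR R => F ((z, q.1), q.2))); last 2 first.
  - apply: measurableT_comp mF _; apply: measurable_fun_pair; last exact: measurable_snd.
    by apply: measurable_fun_pair; [exact: measurable_cst|exact: measurable_fst].
  - by move=> q; exact: F0.
  over.
rewrite (fubini_tonelli (fun q : 'cV[R]_l * measurableTypeR R => \int[leb l]_z' F ((q.1, z'), q.2))%E); last 2 first.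
- apply: (measurable_fun_fubini_tonelli_F
    (fun p : ('cV[R]_l * measurableTypeR R) * 'cV[R]_l => F ((p.1.1, p.2), p.1.2))) => //.
  apply: measurableT_comp mF _; apply: measurable_fun_pair.
    apply: measurable_fun_pair; last exact: measurable_snd.
    exact: measurableT_comp measurable_fst measurable_fst.
  exact: measurableT_comp measurable_snd measurable_fst.
- by move=> q; exact: integral_ge0.
apply: (@le_trans _ _ (\int[mu]_t (\int[leb l]_z J (rc y z) * (\1_I01 t)%:E))%E); last first.
  by rewrite integral_cst_unit_itv.
apply: ge0_le_integral_dom => t _; first by do 2 apply: integral_ge0 => ? _.
have [t01|t01] := boolP (t \in I01); last first.
  rewrite indicE (negbTE t01) mule0 integral0_eq// => z _; apply: integral0_eq => z' _.
  by rewrite /F /G indicE/= (negbTE t01) !mule0.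
rewrite indicE t01 mule1; apply: le_trans (HJ y t _); last first.
  by move: t01; rewrite inE/= in_itv.
apply: ge0_le_integral_dom => z _; first by apply: integral_ge0.
apply: ge0_le_integral_dom => z' _; first exact: F0.
by rewrite /F /G indicE/= t01 mule1 EFinM muleA.
Qed.

End path_energy.

(** * Convex supports *)

(** The change of variables has factor t^-l, at most 2^l when t is at least 1/2. *)
Lemma integral_shrink_le (R : realType) l (q : 'cV[R]_l -> \bar R) (v : 'cV[R]_l) (t : R) :
  2^-1 <= t -> measurable_fun setT q -> (forall z, 0 <= q z)%E ->
  (\int[lebesgue_cV R l]_z q (v + t *: z)%R <= (2 ^+ l)%:E * \int[lebesgue_cV R l]_z q z)%E.
Proof.
move=> t2 mq q0.
have t0 : 0 < t by apply: lt_le_trans t2; rewrite invr_gt0.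
rewrite (integral_lebesgue_cVZ t0 (h := fun z => q (v + z)%R))//; last first.
  by apply: measurableT_comp mq _; apply: measurable_cVD => //; exact: measurable_cst.
rewrite integral_lebesgue_cV_shift//; apply: lee_wpmul2r; first exact: integral_ge0.
rewrite lee_fin lerXn2r ?nnegrE ?invr_ge0 ?(ltW t0)//.
by rewrite -[leRHS]invrK lef_pV2 ?posrE ?invr_gt0.
Qed.

Section convex_energy.
Variables (R : realType) (n k l : nat) (hkl : (k + l)%N = n).
Variables (W1 : 'M[R]_(n, k)) (W2 : 'M[R]_(n, l)).
Hypothesis oW : orthogonal_mx (castmx (erefl n, hkl) (row_mx W1 W2)).
Variable rho : 'cV[R]_n -> R.
Hypothesis mrho : measurable_fun setT rho.
Hypothesis rho0 : forall x, 0 <= rho x.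
Local Notation leb := (lebesgue_cV R).
Local Notation rc := (recombine W1 W2).
Variables (h : 'cV[R]_n -> R) (g : 'I_n -> 'cV[R]_n -> R) (M : R).
Hypothesis mh : measurable_fun setT h.
Hypothesis mg : forall i, measurable_fun setT (g i).
Hypothesis h0 : forall x, 0 <= h x.
Hypothesis hM : forall x, h x <= M.
Hypothesis dh : forall x, dsupp rho x -> forall i, is_derive x (delta_mx i ord0) h (g i x).
Hypothesis g2 : forall i, (\int[leb n]_x (g i x ^+ 2)%:E < +oo)%E.
Variables (c D : R).
Hypothesis rhoc : forall x, dsupp rho x -> rho x = c.
Hypothesis c0 : 0 < c.
Hypothesis D0 : 0 <= D.
Variable K : set 'cV[R]_n.
Hypothesis mK : measurable K.
Hypothesis KD : forall x x', K x -> K x' -> nsq (x' - x) <= D.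
Hypothesis Kconv : forall x x' t, K x -> K x' -> 0 <= t <= 1 -> K ((1 - t) *: x + t *: x').

Lemma recombine_segment y z z' t :
  rc y ((1 - t) *: z + t *: z') = (1 - t) *: rc y z + t *: rc y z'.
Proof.
rewrite /recombine !scalerDr mulmxDr -!scalemxAr addrACA; congr (_ + _).
by rewrite -scalerDl subrK scale1r.
Qed.

(* At time t of the segment from z to z', the endpoint whose weight is at least 1/2 is
   integrated first, so that the change of variables costs at most 2 ^ l. *)
Lemma segment_energy_slice (Q : 'cV[R]_n -> \bar R) y t :
  measurable_fun setT Q -> (forall x, 0 <= Q x)%E -> 0 <= t <= 1 ->
  (\int[leb l]_z \int[leb l]_z' ((pair_weight W1 W2 rho K y z z' * nsq (- 1 *: z + 1 *: z'))%:E *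
      Q (rc y ((1 - t) *: z + t *: z'))) <=
    \int[leb l]_z ((D * 2 ^+ l * c * \1_K (rc y z))%:E * Q (rc y z)))%E.
Proof.
move=> mQ Q0 t01.
have mI := @measurable_indic _ 'cV[R]_n R setT _ mK.
pose q z := ((\1_K (rc y z))%:E * Q (rc y z))%E.
have q0 z : (0 <= q z)%E by rewrite mule_ge0 ?lee_fin.
have mrc : measurable_fun setT (fun z : 'cV[R]_l => rc y z).
  by apply: measurable_recombine => //; exact: measurable_cst.
have mq : measurable_fun setT q.
  apply: emeasurable_funM; last exact: measurableT_comp mQ mrc.
  by apply/measurable_EFinP; exact: measurableT_comp mI mrc.
pose r z := rho (rc y z) / marginal W1 W2 rho y.
have r0 z : 0 <= r z by rewrite divr_ge0// marginal_ge0.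
have mr : measurable_fun setT (fun z => (r z)%:E).
  by apply/measurable_EFinP; apply: measurable_funM => //; exact: measurableT_comp mrho mrc.
pose F (p : 'cV[R]_l * 'cV[R]_l) := ((pair_weight W1 W2 rho K y p.1 p.2 * nsq (- 1 *: p.1 + 1 *: p.2))%:E *
      Q (rc y ((1 - t) *: p.1 + t *: p.2)))%E.
have F0 p : (0 <= F p)%E by rewrite mule_ge0// lee_fin mulr_ge0 ?nsq_ge0 ?pair_weight_ge0.
have mF : measurable_fun setT F.
  apply: emeasurable_funM.
    apply/measurable_EFinP; apply: measurable_funM; last first.
      apply: measurableT_comp (@measurable_nsq R l) _; apply: measurable_cVD; apply: measurable_cVZ => //.
    have mc : measurable_fun setT (fun p : 'cV[R]_l * 'cV[R]_l => ((y, p.1), p.2)).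
      by apply: measurable_fun_pair => //; apply: measurable_fun_pair => //; exact: measurable_cst.
    have H := measurableT_comp (@measurable_pair_weight _ _ _ _ W1 W2 _ mrho rho0 _ mK) mc; exact: H.
  apply: measurableT_comp mQ _; apply: measurable_recombine => //.
  by apply: measurable_cVD; apply: measurable_cVZ.
have rho_le x : rho x <= c.
  by have := rho0 x; rewrite le_eqVlt => /predU1P[<-|/rhoc ->//]; exact: ltW.
(* One of the two densities is kept, divided by the marginal, as a conditional density to be
   integrated last, and the other is bounded by [c]. Convexity puts the intermediate point in [K],
   which supplies the indicator inside [q]; which endpoint to keep depends on t. *)
have Fle (z z' : 'cV[R]_l) : (F (z, z') <= (r z)%:E * ((D * c)%:E * q ((1 - t) *: z + t *: z')%R))%E /\
    (F (z, z') <= (r z')%:E * ((D * c)%:E * q ((1 - t) *: z + t *: z')%R))%E.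
  rewrite /F /q/= recombine_segment !muleA -!EFinM.
  have [Kz|Kz] := pselect (K (rc y z) /\ K (rc y z')); last first.
    rewrite [X in X * _](_ : _ = 0) ?mul0r ?mul0e; last first.
      rewrite /pair_weight !indicE.
      by case/not_andP: Kz => Kz; rewrite (memNset Kz) ?mul0r !mulr0.
    by split; rewrite mule_ge0// lee_fin mulr_ge0// mulr_ge0// mulr_ge0// ltW.
  rewrite indicE (mem_set (Kconv Kz.1 Kz.2 t01)) mulr1.
  have nD : nsq (- 1 *: z + 1 *: z') <= D.
    have [_ _ _ W22] := orthogonal_blocks oW.
    rewrite scaleN1r scale1r addrC -(nsq_orthogonal (z' - z) W22).
    apply: le_trans (KD Kz.1 Kz.2); rewrite /recombine opprD addrACA subrr add0r mulmxBr.
    exact: lexx.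
  split; apply: lee_wpmul2r => //; rewrite lee_fin /pair_weight !indicE (mem_set Kz.1) (mem_set Kz.2) !mulr1.
    set N := nsq _ in nD *; have N0 : 0 <= N by exact: nsq_ge0.
    rewrite (_ : _ * _ / _ * N = r z * (N * rho (rc y z'))); last by rewrite /r; ring.
    by apply: ler_wpM2l => //; apply: ler_pM.
  set N := nsq _ in nD *; have N0 : 0 <= N by exact: nsq_ge0.
  rewrite (_ : _ * _ / _ * N = r z' * (N * rho (rc y z))); last by rewrite /r; ring.
  by apply: ler_wpM2l => //; apply: ler_pM.
have mcomb (z : 'cV[R]_l) s u : measurable_fun setT (fun z' : 'cV[R]_l => (s *: z + u *: z')).
  by apply: measurable_cVD; [exact: measurable_cst|apply: measurable_cVZ].
have key (s : R) (z : 'cV[R]_l) u : 2^-1 <= u ->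
   (\int[leb l]_z' ((r z)%:E * ((D * c)%:E * q (s *: z + u *: z')%R)) <=
    (r z)%:E * \int[leb l]_z ((D * 2 ^+ l * c * \1_K (rc y z))%:E * Q (rc y z)))%E.
  move=> u2; have mqc := measurableT_comp mq (mcomb z s u).
  rewrite ge0_integralZl ?lee_fin//; last 2 first.
  - by apply: emeasurable_funM => //; exact: measurable_cst.
  - by move=> z' _; rewrite mule_ge0// lee_fin mulr_ge0// ltW.
  rewrite ge0_integralZl ?lee_fin//; last by rewrite mulr_ge0// ltW.
  apply: lee_wpmul2l; first by rewrite lee_fin.
  apply: (@le_trans _ _ ((D * c)%:E * ((2 ^+ l)%:E * \int[leb l]_z q z)))%E.
    apply: lee_wpmul2l; first by rewrite lee_fin mulr_ge0// ltW.
    exact: integral_shrink_le.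
  rewrite muleA -EFinM -ge0_integralZl ?lee_fin//; last by rewrite mulr_ge0 ?exprn_ge0// mulr_ge0// ltW.
  rewrite le_eqVlt; apply/orP; left; apply/eqP; apply: eq_integral => z' _.
  by rewrite /q muleA -EFinM; congr (_%:E * _)%E; ring.
have fin I : (0 <= I)%E -> (\int[leb l]_z ((r z)%:E * I) <= I)%E.
  move=> I0; rewrite ge0_integralZr//; last by move=> z _; rewrite lee_fin.
  by rewrite -[leRHS]mul1e; apply: lee_wpmul2r => //; exact: integral_conditional_le1.
set I := (leRHS).
have I0 : (0 <= I)%E.
  by apply: integral_ge0 => z _; rewrite mule_ge0// lee_fin mulr_ge0// mulr_ge0 ?(ltW c0)// mulr_ge0// exprn_ge0.
apply: le_trans (fin I I0).
have [t2|t2] := leP 2^-1 t.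
  apply: ge0_le_integral_dom => z _; first by apply: integral_ge0 => z' _; exact: (F0 (z, z')).
  apply: le_trans (key (1 - t) z t t2).
  apply: ge0_le_integral_dom => z' _; first exact: (F0 (z, z')).
  exact: (Fle z z').1.
have -> := fubini_tonelli F mF F0.
apply: ge0_le_integral_dom => z' _; first by apply: integral_ge0 => z _; exact: (F0 (z, z')).
have t2' : 2^-1 <= 1 - t by lra.
apply: le_trans (key t z' (1 - t) t2').
apply: ge0_le_integral_dom => z _; first exact: (F0 (z, z')).
by rewrite (addrC (t *: z')); exact: (Fle z z').2.
Qed.

Variable d : R.
Hypothesis d0 : 0 < d.
Hypothesis Kd : K `<=` inner d (dsupp rho).

(** The density is the constant [c] at every point within the mollification radius of [K], so
    mollifying does not alter the weight. *)
Lemma pair_energy_smooth_convex :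
  (pair_energy W1 W2 rho K (smooth d h) <=
   (D * 2 ^+ l)%:E * \int[leb n]_x (grad2 W2 g x * rho x)%:E)%E.
Proof.
have C0 : 0 <= D * 2 ^+ l by rewrite mulr_ge0// exprn_ge0.
have mI := @measurable_indic _ 'cV[R]_n R setT _ mK.
pose s (x : 'cV[R]_n) := D * 2 ^+ l * c * \1_K x.
have s0 x : 0 <= s x by rewrite mulr_ge0// mulr_ge0 ?(ltW c0).
have ms : measurable_fun setT s by apply: measurable_funM.
have mQ := measurable_avg_grad2 W2 mg d0.
have Q0 := avg_grad2_ge0 W2 g d0.
pose J x := ((s x)%:E * avg_grad2 W2 g d x)%E.
apply: (@le_trans _ _ (\int[leb n]_x J x)%E); last first.
  apply: (integral_avg_grad2_le mrho rho0 mg d0 ms C0 s0) => x u ud.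
  rewrite /s mulrA -!mulrA !ler_wpM2l ?exprn_ge0//.
  rewrite indicE; case: (boolP (x \in K)) => [/set_mem Kx|_]; last by rewrite mul0r mulr0 mulr_ge0 ?nsq_ge0.
  by rewrite mul1r (rhoc (Kd Kx ud)).
apply: (@pair_energy_smooth_le _ _ _ _ _ _ _ oW _ mrho rho0 _ _ _ _ mh mg h0 hM dh g2 _ d0
  (fun t => 1 - t) id (fun=> -1) (fun=> 1) _ _ _ _ _ _ 3) => //.
- by apply: measurable_funB.
- by move=> r; rewrite -[X in is_derive _ _ _ X]add0r; apply: is_deriveB.
- move=> r /andP[r1 r2]; rewrite !ler_norml; split; apply/andP; split; lra.
- by rewrite subr0.
- by rewrite subrr.
- by apply: emeasurable_funM => //; exact/measurable_EFinP.
- by move=> x; rewrite mule_ge0 ?lee_fin.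
- move=> y z z' t Kz Kz' t01; rewrite recombine_segment; exact/Kd/Kconv.
- by move=> y t t01; exact: segment_energy_slice.
Qed.

End convex_energy.

Section convex_limit.
Variables (R : realType) (n k l : nat) (hkl : (k + l)%N = n).
Variables (W1 : 'M[R]_(n, k)) (W2 : 'M[R]_(n, l)).
Hypothesis oW : orthogonal_mx (castmx (erefl n, hkl) (row_mx W1 W2)).
Variable rho : 'cV[R]_n -> R.
Hypothesis mrho : measurable_fun setT rho.
Hypothesis rho0 : forall x, 0 <= rho x.
Local Notation leb := (lebesgue_cV R).

Lemma pair_energy_convex_le (h : 'cV[R]_n -> R) (g : 'I_n -> 'cV[R]_n -> R)
    (M c D d1 : R) (K : set 'cV[R]_n) :
  measurable_fun setT h -> (forall i, measurable_fun setT (g i)) ->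
  (forall x, 0 <= h x) -> (forall x, h x <= M) ->
  (forall x, dsupp rho x -> forall i, is_derive x (delta_mx i ord0) h (g i x)) ->
  (forall i, (\int[leb n]_x (g i x ^+ 2)%:E < +oo)%E) ->
  (forall x, dsupp rho x -> rho x = c) -> 0 < c -> 0 <= D -> measurable K ->
  (forall x x', K x -> K x' -> nsq (x' - x) <= D) ->
  (forall x x' t, K x -> K x' -> 0 <= t <= 1 -> K ((1 - t) *: x + t *: x')) ->
  0 < d1 -> K `<=` inner d1 (dsupp rho) ->
  (pair_energy W1 W2 rho K h <=
   (2 * D * 2 ^+ l)%:E * \int[leb n]_x (grad2 W2 g x * rho x)%:E)%E.
Proof.
move=> mh mg h0 hM dh g2 rhoc c0 D0 mK KD Kconv d10 Kd.
have Kin d : 0 < d -> d < d1 -> K `<=` inner d (dsupp rho).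
  by move=> d0 dd1 x Kx u ud; apply: Kd => //; apply: le_trans ud (ltW dd1).
rewrite -mulrA EFinM -muleA.
apply: (pair_energy_smooth_limit oW mrho rho0 mh mg h0 hM dh g2 (r := c) mK _ d10 Kin).
  by move=> x; have := rho0 x; rewrite le_eqVlt => /predU1P[<-|/rhoc ->//]; exact: ltW.
move=> d d0 dd1.
exact: (pair_energy_smooth_convex oW mrho rho0 mh mg h0 hM dh g2 rhoc c0 D0 mK KD Kconv d0 (Kin _ d0 dd1)).
Qed.

End convex_limit.

(** * Gaussian prior *)

(** The rotation of the pair (z, z') is an orthogonal map of the space of dimension 2l. *)
Lemma integral_rotation (R : realType) l (c s : R) (F : 'cV[R]_l * 'cV[R]_l -> \bar R) :
  c ^+ 2 + s ^+ 2 = 1 -> measurable_fun setT F -> (forall p, (0 <= F p)%E) ->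
  (\int[lebesgue_cV R l]_z \int[lebesgue_cV R l]_z' F (c *: z + s *: z', - s *: z + c *: z')%R =
   \int[lebesgue_cV R l]_z \int[lebesgue_cV R l]_z' F (z, z'))%E.
Proof.
move=> cs mF F0.
pose W : 'M[R]_(l + l) := block_mx c%:M s%:M (- s)%:M c%:M.
have oW : W^T *m W = 1%:M.
  rewrite /W tr_block_mx mulmx_block (scalar_mx_block l l (1 : R)) !tr_scalar_mx.
  rewrite -!scalar_mxM -!raddfD/=; congr block_mx; rewrite ?raddf0//.
  - by rewrite mulrNN -!expr2 cs.
  - by rewrite mulNr (mulrC s) subrr raddf0.
  - by rewrite mulrN (mulrC s) subrr raddf0.
  - by rewrite addrC -!expr2 cs.
pose H (x : 'cV[R]_(l + l)) := F (usubmx x, dsubmx x).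
have mH : measurable_fun setT H.
  apply: measurableT_comp mF _; apply: measurable_fun_pair; apply/measurable_fun_coorP => i;
    under eq_fun do rewrite mxE; exact: measurable_coor.
have H0 x : (0 <= H x)%E by exact: F0.
have HE (z z' : 'cV[R]_l) : F (z, z') = H (col_mx z z') by rewrite /H col_mxKu col_mxKd.
under eq_integral do under eq_integral do rewrite HE.
under [RHS]eq_integral do under eq_integral do rewrite HE.
transitivity (\int[lebesgue_cV R (l + l)]_x H x)%E; last exact: integral_col_mx.
have mHW : measurable_fun setT (fun x => H (W *m x)).
  by apply: measurableT_comp mH _; exact: measurable_mulmx.
transitivity (\int[lebesgue_cV R (l + l)]_x H (W *m x))%E; last exact: (integral_orthogonal oW mH H0).
transitivity (\int[lebesgue_cV R l]_z \int[lebesgue_cV R l]_z' H (W *m col_mx z z'))%E; last first.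
  by symmetry; apply: (integral_col_mx mHW).
apply: eq_integral => z _; apply: eq_integral => z' _.
by rewrite /W mul_block_col !mul_scalar_mx.
Qed.

Lemma nsqD_young (R : realType) n (x u : 'cV[R]_n) (e : R) : 0 < e ->
  nsq (x + u) <= (1 + e) * nsq x + (1 + e^-1) * nsq u.
Proof.
move=> e0; rewrite /nsq !mulr_sumr -big_split/=; apply: ler_sum => i _; rewrite mxE.
move: (x i ord0) (u i ord0) => p q.
rewrite -subr_ge0 (_ : _ - _ = (e * p - q) ^+ 2 / e); first by rewrite divr_ge0 ?sqr_ge0// ltW.
by field; rewrite gt_eqF.
Qed.

Lemma nsq_rotation (R : realType) n (z z' : 'cV[R]_n) (a b : R) : a ^+ 2 + b ^+ 2 = 1 ->
  nsq (a *: z + b *: z') + nsq (- b *: z + a *: z') = nsq z + nsq z'.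
Proof.
move=> ab; rewrite /nsq -!big_split/=; apply: eq_bigr => i _; rewrite !mxE.
by move: (z i ord0) (z' i ord0) => p p'; rewrite -[RHS]mul1r -ab; ring.
Qed.

Section gaussian_energy.
Variables (R : realType) (n k l : nat) (hkl : (k + l)%N = n).
Variables (W1 : 'M[R]_(n, k)) (W2 : 'M[R]_(n, l)).
Hypothesis oW : orthogonal_mx (castmx (erefl n, hkl) (row_mx W1 W2)).
Variable rho : 'cV[R]_n -> R.
Hypothesis mrho : measurable_fun setT rho.
Hypothesis rho0 : forall x, 0 <= rho x.
Hypothesis gauss : std_gaussian rho.
Local Notation leb := (lebesgue_cV R).
Local Notation rc := (recombine W1 W2).

Let gc := Num.sqrt (2 * pi : R) ^+ n.

Lemma gc_gt0 : 0 < gc.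
Proof. by rewrite exprn_gt0// sqrtr_gt0 mulr_gt0// pi_gt0. Qed.

Lemma gaussE x : rho x = expR (- (nsq x / 2)) / gc.
Proof. by rewrite gauss enorm_sqr. Qed.

Lemma gauss_split y z : rho (rc y z) = expR (- (nsq z / 2)) * (expR (- (nsq y / 2)) / gc).
Proof.
rewrite gaussE (nsq_recombine oW) mulrA -expRD; congr (expR _ / _); lra.
Qed.

(* [x exp(-x/2) <= 3 exp(-x/8)], and rescaling z by 1/2 costs 2 ^ l. *)
Lemma gauss_moment y :
  (\int[leb l]_z (rho (rc y z) / marginal W1 W2 rho y * nsq z)%:E <= (3 * 2 ^+ l)%:E)%E.
Proof.
pose c := expR (- (nsq y / 2)) / gc / marginal W1 W2 rho y.
have c0 : 0 <= c by rewrite divr_ge0 ?marginal_ge0// divr_ge0 ?expR_ge0// ltW// gc_gt0.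
pose e (z : 'cV[R]_l) := (c * expR (- (nsq z / 2)))%:E.
have e0 z : (0 <= e z)%E by rewrite lee_fin mulr_ge0 ?expR_ge0.
have me : measurable_fun setT e.
  apply/measurable_EFinP; apply: measurable_funM => //; apply: measurableT_comp => //.
  by apply: measurableT_comp => //; apply: measurable_funM => //; exact: measurable_nsq.
have eE z : e z = (rho (rc y z) / marginal W1 W2 rho y)%:E.
  by rewrite gauss_split /e /c; congr EFin; ring.
apply: (@le_trans _ _ (\int[leb l]_z (3%:E * e (2^-1 *: z)%R))%E).
  apply: ge0_le_integral_dom => z _; first by rewrite lee_fin mulr_ge0 ?nsq_ge0// divr_ge0 ?marginal_ge0.
  rewrite EFinM -eE /e -!EFinM lee_fin mulrCA -mulrA; apply: ler_wpM2l => //.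
  rewrite nsqZ; move: (nsq z) (nsq_ge0 z) => x x0.
  (* Splitting off exp(-x/2) leaves x <= 3 exp(3x/8), which follows from exp(v) >= 1 + v because 3
     (1 + 3x/8) >= x. *)
  have -> : - (2^-1 ^+ 2 * x / 2) = - (x / 2) + x * 3 / 8 by field.
  rewrite expRD mulrCA; apply: ler_wpM2l; first exact: expR_ge0.
  by have := expR_ge1Dx (x * 3 / 8); lra.
rewrite ge0_integralZl//; last first.
  by apply: measurableT_comp me _; exact: measurable_cVZ.
rewrite EFinM; apply: lee_wpmul2l; first by rewrite lee_fin.
rewrite integral_lebesgue_cVZ// invrK -[leRHS]mule1; apply: lee_wpmul2l; first by rewrite lee_fin exprn_ge0.
under eq_integral do rewrite eE; exact: integral_conditional_le1.
Qed.

(** Young's inequality with weight 1 / (4r + 1) shows that the shift raises the squared norm by at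
    most 1: each of its two error terms is at most 1/2, the second one thanks to the threshold on d.
    The density then drops by a factor no smaller than exp(-1/2) >= 1/2. *)
Lemma gauss_shift_le (r d : R) (x u : 'cV[R]_n) : 0 <= r ->
  nsq x <= 2 * r -> nsq u <= d -> d <= (8 * r + 4)^-1 -> rho x <= 2 * rho (x + u).
Proof.
move=> r0 xr ud dr; rewrite !gaussE mulrA ler_pM2r ?invr_gt0 ?gc_gt0//.
have r1 : 0 < 4 * r + 1 by lra.
have := nsqD_young x u (e := (4 * r + 1)^-1); rewrite invr_gt0 invrK => /(_ r1) xu.
have d2 : (1 + (4 * r + 1)) * nsq u <= 2^-1.
  have r2 : 0 < 8 * r + 4 by lra.
  have : nsq u * (8 * r + 4) <= 1 by rewrite -ler_pdivlMr// div1r; exact: le_trans ud dr.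
  lra.
have d1 : (4 * r + 1)^-1 * nsq x <= 2^-1 by rewrite ler_pdivrMl//; lra.
have -> : - (nsq (x + u) / 2) = - (nsq x / 2) + - ((nsq (x + u) - nsq x) / 2) by field.
have := expR_ge1Dx (- ((nsq (x + u) - nsq x) / 2)); rewrite expRD.
by have := expR_gt0 (- (nsq x / 2)); nra.
Qed.

(** The rotation of (z, z') preserves the product of the two Gaussian densities and sends the pair
    to position and normalised velocity on the path. In these variables the weight factors, so the
    squared speed is integrated separately by [gauss_moment]. *)
Lemma rotation_energy_slice (Q : 'cV[R]_n -> \bar R) (r a b C : R) y :
  measurable_fun setT Q -> (forall x, 0 <= Q x)%E -> a ^+ 2 + b ^+ 2 = 1 -> 0 <= C ->
  (\int[leb l]_z \int[leb l]_z' ((pair_weight W1 W2 rho (cball r) y z z' * nsq ((- (C * b)) *: z + (C * a) *: z'))%:E *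
      Q (rc y (a *: z + b *: z'))) <=
    \int[leb l]_z ((C ^+ 2 * (3 * 2 ^+ l) * (rho (rc y z) * \1_(cball (2 * r)) (rc y z)))%:E * Q (rc y z)))%E.
Proof.
move=> mQ Q0 ab C0.
pose r' z := rho (rc y z) / marginal W1 W2 rho y.
have r'0 z : 0 <= r' z by rewrite divr_ge0// marginal_ge0.
pose q z := ((rho (rc y z) * \1_(cball (2 * r)) (rc y z))%:E * Q (rc y z))%E.
have mrc : measurable_fun setT (fun z : 'cV[R]_l => rc y z).
  by apply: measurable_recombine => //; exact: measurable_cst.
have q0 z : (0 <= q z)%E by rewrite mule_ge0// lee_fin mulr_ge0.
have mI := @measurable_indic _ 'cV[R]_n R setT _ (@measurable_cball R n (2 * r)).
have mq : measurable_fun setT q.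
  apply: emeasurable_funM; last exact: measurableT_comp mQ mrc.
  apply/measurable_EFinP; apply: measurable_funM; first exact: measurableT_comp mrho mrc.
  exact: measurableT_comp mI mrc.
have mr : measurable_fun setT r'.
  by apply: measurable_funM => //; exact: measurableT_comp mrho mrc.
pose F (p : 'cV[R]_l * 'cV[R]_l) := ((C ^+ 2)%:E * q p.1 * (r' p.2 * nsq p.2)%:E)%E.
have F0 p : (0 <= F p)%E.
  by rewrite mule_ge0//; [rewrite mule_ge0// lee_fin sqr_ge0|rewrite lee_fin mulr_ge0 ?nsq_ge0].
have mF : measurable_fun setT F.
  apply: emeasurable_funM; first by apply: emeasurable_funM => //; exact: measurableT_comp mq _.
  apply/measurable_EFinP; apply: measurable_funM; first exact: measurableT_comp mr _.
  exact: measurableT_comp (@measurable_nsq R l) _.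
apply: (@le_trans _ _ (\int[leb l]_z \int[leb l]_z' F (a *: z + b *: z', - b *: z + a *: z')%R)%E).
  apply: ge0_le_integral_dom => z _.
    by apply: integral_ge0 => z' _; rewrite mule_ge0// lee_fin mulr_ge0 ?nsq_ge0 ?pair_weight_ge0.
  apply: ge0_le_integral_dom => z' _.
    by rewrite mule_ge0// lee_fin mulr_ge0 ?nsq_ge0 ?pair_weight_ge0.
  have [Kz|Kz] := pselect (cball r (rc y z) /\ cball r (rc y z')); last first.
    rewrite [X in X * _](_ : _ = 0) ?mul0r ?mul0e; first exact: F0.
    rewrite /pair_weight !indicE.
    by case/not_andP: Kz => Kz; rewrite (memNset Kz) ?mul0r !mulr0.
  have nzz := nsq_rotation z z' ab.
  (* The position takes at most the joint squared norm of z and z', and each of them together with y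
     is bounded by [r]. *)
  have KP : cball (2 * r) (rc y (a *: z + b *: z')).
    move: Kz; rewrite /cball/= !(nsq_recombine oW) => -[K1 K2].
    by have := nsq_ge0 (- b *: z + a *: z'); have := nsq_ge0 y; lra.
  rewrite /F /q /= /pair_weight !indicE (mem_set Kz.1) (mem_set Kz.2) (mem_set KP) !mulr1.
  rewrite (_ : - (C * b) *: z + (C * a) *: z' = C *: (- b *: z + a *: z')); last first.
    by rewrite scalerDr !scalerA mulrN.
  rewrite nsqZ muleAC !muleA -!EFinM le_eqVlt; apply/orP; left; apply/eqP.
  congr (_%:E * _)%E; rewrite /r'.
  have -> : rho (rc y z) * rho (rc y z') =
      rho (rc y (a *: z + b *: z')) * rho (rc y (- b *: z + a *: z')).
    rewrite !gauss_split; set e := expR (- (nsq y / 2)) / gc.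
    rewrite mulrACA [RHS]mulrACA -!expRD; congr (expR _ * _).
    by move: nzz; set A := nsq (_ + _); set B := nsq (_ + _); lra.
  by ring.
rewrite integral_rotation//.
apply: ge0_le_integral_dom => z _; first by apply: integral_ge0 => z' _; exact: (F0 (z, z')).
rewrite /F/= ge0_integralZl//; last 3 first.
- by apply/measurable_EFinP; apply: measurable_funM => //; exact: measurable_nsq.
- by move=> z' _; rewrite lee_fin mulr_ge0 ?nsq_ge0.
- by rewrite mule_ge0// lee_fin sqr_ge0.
apply: (@le_trans _ _ ((C ^+ 2)%:E * q z * (3 * 2 ^+ l)%:E)%E).
  apply: lee_wpmul2l; last exact: gauss_moment.
  by rewrite mule_ge0// lee_fin sqr_ge0.
rewrite le_eqVlt; apply/orP; left; apply/eqP.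
by rewrite /q muleAC !muleA -!EFinM.
Qed.

Variables (h : 'cV[R]_n -> R) (g : 'I_n -> 'cV[R]_n -> R) (M r : R).
Hypothesis mh : measurable_fun setT h.
Hypothesis mg : forall i, measurable_fun setT (g i).
Hypothesis h0 : forall x, 0 <= h x.
Hypothesis hM : forall x, h x <= M.
Hypothesis r0 : 0 <= r.
Hypothesis dh : forall x, cball (4 * r + 2) x -> forall i, is_derive x (delta_mx i ord0) h (g i x).
Hypothesis g2 : forall i, (\int[leb n]_x (g i x ^+ 2)%:E < +oo)%E.

(** By Young with weight 1, |x + u|^2 <= 2 (2r) + 2d, and d <= 1: hence the radius 4r + 2 on which
    derivatives are required. *)
Let inner_cball d (x : 'cV[R]_n) : d <= (8 * r + 4)^-1 -> cball (2 * r) x -> inner d (cball (4 * r + 2) : set 'cV[R]_n) x.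
Proof.
have r_ge0 := r0.
move=> dr xr u ud; rewrite /cball/=.
have := nsqD_young x u ltr01; rewrite invr1.
have d1 : d <= 1 by apply: le_trans dr _; rewrite invf_le1; lra.
by move: xr; rewrite /cball/=; lra.
Qed.

(** A quarter turn in unit time has angular speed pi/2, which enters squared; 3 * 2^l is the moment
    from [gauss_moment], and the leading 2 is the loss of density over the mollification radius in
    [gauss_shift_le]. *)
Lemma pair_energy_smooth_gaussian d : 0 < d -> d <= (8 * r + 4)^-1 ->
  (pair_energy W1 W2 rho (cball r) (smooth d h) <=
   (2 * ((pi / 2) ^+ 2 * (3 * 2 ^+ l)))%:E * \int[leb n]_x (grad2 W2 g x * rho x)%:E)%E.
Proof.
move=> d0 dr; set c := (pi / 2) ^+ 2 * _.
have c0 : 0 <= c by rewrite mulr_ge0 ?sqr_ge0// mulr_ge0// exprn_ge0.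
have cE : c = (pi / 2) ^+ 2 * (3 * 2 ^+ l) by []; clearbody c.
have mI := @measurable_indic _ 'cV[R]_n R setT _ (@measurable_cball R n (2 * r)).
pose s (x : 'cV[R]_n) := c * (rho x * \1_(cball (2 * r)) x).
have s0 x : 0 <= s x by rewrite mulr_ge0// mulr_ge0.
have ms : measurable_fun setT s by apply: measurable_funM => //; exact: measurable_funM.
have mQ := measurable_avg_grad2 W2 mg d0.
have Q0 := avg_grad2_ge0 W2 g d0.
pose J x := ((s x)%:E * avg_grad2 W2 g d x)%E.
apply: (@le_trans _ _ (\int[leb n]_x J x)%E); last first.
  apply: (integral_avg_grad2_le mrho rho0 mg d0 ms) => // [|x u ud]; first by rewrite mulr_ge0.
  rewrite /s (mulrC 2 c) -!mulrA; apply: ler_wpM2l => //.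
  rewrite !mulrA; apply: ler_wpM2r; first exact: nsq_ge0.
  rewrite indicE; case: (boolP (x \in _)) => [/set_mem Kx|_]; last by rewrite mulr0 mulr_ge0.
  by rewrite mulr1; apply: (gauss_shift_le r0 Kx ud dr).
have p20 : 0 <= pi / 2 :> R by rewrite divr_ge0// pi_ge0.
have mlin : measurable_fun setT (fun t : measurableTypeR R => pi / 2 * t) by apply: measurable_funM.
have mcos : measurable_fun setT (fun t : measurableTypeR R => cos (pi / 2 * t)).
  by apply: measurableT_comp mlin; apply: continuous_measurable_fun; exact: continuous_cos.
have msin : measurable_fun setT (fun t : measurableTypeR R => sin (pi / 2 * t)).
  by apply: measurableT_comp mlin; apply: continuous_measurable_fun; exact: continuous_sin.
have dlin (t : R) : is_derive t 1 (fun r : R => pi / 2 * r) (pi / 2).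
  by rewrite -[X in is_derive _ _ _ X]mulr1; apply: is_deriveZ.
apply: (@pair_energy_smooth_le _ _ _ _ _ _ _ oW _ mrho rho0 _ _ _ _ mh mg h0 hM dh g2 _ d0
  (fun t => cos (pi / 2 * t)) (fun t => sin (pi / 2 * t)) (fun t => - (pi / 2 * sin (pi / 2 * t)))
  (fun t => pi / 2 * cos (pi / 2 * t)) _ _ _ _ _ _ (1 + pi / 2)) => //.
- by apply: measurableT_comp => //; apply: measurable_funM.
- by apply: measurable_funM.
- move=> t; rewrite (_ : - _ = - sin (pi / 2 * t) * (pi / 2)); last by rewrite mulNr [_ * sin _]mulrC.
  have H := is_derive1_comp (is_derive_cos _) (dlin t); exact: H.
- move=> t; rewrite [_ * cos _]mulrC.
  have H := is_derive1_comp (is_derive_sin _) (dlin t); exact: H.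
- move=> t _; have c1 := cos_max (pi / 2 * t); have s1 := sin_max (pi / 2 * t).
  rewrite normrN (normrM (pi / 2)) (normrM (pi / 2) (cos _)) (ger0_norm p20).
  move: p20 c1 s1; move: (pi / 2) (`|cos _|) (`|sin _|) => p C S p0 c1 s1; split; nra.
- by rewrite mulr0 cos0 sin0.
- by rewrite mulr1 cos_pihalf sin_pihalf.
- exact: measurable_cball.
- by apply: emeasurable_funM => //; exact/measurable_EFinP.
- by move=> x; rewrite mule_ge0 ?lee_fin.
- move=> y z z' t; rewrite /cball/= => Kz Kz' _; apply: inner_cball => //.
  move: Kz Kz'; rewrite /cball/= !(nsq_recombine oW).
  have := nsq_rotation z z' (cos2Dsin2 (pi / 2 * t)).
  have := nsq_ge0 (- sin (pi / 2 * t) *: z + cos (pi / 2 * t) *: z').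
  by have := nsq_ge0 y; lra.
- move=> y t _; rewrite /J /s cE.
  exact: (rotation_energy_slice r y mQ Q0 (cos2Dsin2 (pi / 2 * t)) p20).
Qed.

Lemma pair_energy_gaussian_le :
  (pair_energy W1 W2 rho (cball r) h <=
   (4 * ((pi / 2) ^+ 2 * (3 * 2 ^+ l)))%:E * \int[leb n]_x (grad2 W2 g x * rho x)%:E)%E.
Proof.
have r2 : 0 < (8 * r + 4)^-1 by rewrite invr_gt0 ltr_wpDl// mulr_ge0.
rewrite (_ : 4 * _ = 2 * (2 * ((pi / 2) ^+ 2 * (3 * 2 ^+ l)))); last by ring.
rewrite EFinM -muleA.
apply: (pair_energy_smooth_limit oW mrho rho0 mh mg h0 hM dh g2 (r := gc^-1) (@measurable_cball R n r) _ r2).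
- move=> x; rewrite gaussE ler_piMl ?invr_ge0 ?(ltW gc_gt0)//.
  by rewrite -expR0 ler_expR oppr_le0 divr_ge0 ?nsq_ge0.
- move=> d d0 /ltW dr x xr; apply: inner_cball => //.
  by have r_ge0 := r0; move: xr; rewrite /cball/=; lra.
- move=> d d0 /ltW dr; exact: pair_energy_smooth_gaussian.
Qed.

End gaussian_energy.

(** * Truncation and exhaustion *)

Lemma cvg_integral_nondecreasing d (T : measurableType d) (R : realType)
    (m : {measure set T -> \bar R}) (F : (T -> \bar R)^nat) (f : T -> \bar R) :
  (forall j, measurable_fun setT (F j)) -> (forall j x, (0 <= F j x)%E) ->
  (forall x, {homo F^~ x : i j / (i <= j)%N >-> (i <= j)%E}) ->
  (forall x, F^~ x @ \oo --> f x) ->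
  (\int[m]_x F j x)%E @[j --> \oo] --> (\int[m]_x f x)%E.
Proof.
move=> mF F0 ndF Ff.
rewrite (_ : (\int[m]_x f x)%E = (\int[m]_x limn (F^~ x))%E); last first.
  by apply: eq_integral => x _; apply/esym/cvg_lim.
by apply: cvg_monotone_convergence.
Qed.

Lemma is_derive_cvg_seq (R : realType) (V : normedModType R) (f : V -> R) (x v : V) (a : R) :
  is_derive x v f a ->
  (fun j => (f (x + j.+1%:R^-1 *: v) - f x) * j.+1%:R) @ \oo --> a.
Proof.
move=> [/cvg_ex[l Hl] E].
have la : l = a by rewrite -E; apply/esym/cvg_lim.
rewrite {}la {E} in Hl.
have H : @harmonic R @ \oo --> (0 : R)^'.
  move=> A A0; have [N _ HN] := @cvg_harmonic R _ A0; exists N => // i Ni.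
  by apply: (HN i Ni); rewrite /harmonic/= invr_neq0.
have := cvg_comp _ _ H Hl; rewrite (_ : _ \o _ =
  (fun j => (f (x + j.+1%:R^-1 *: v) - f x) * j.+1%:R))//.
by apply/funext => j; rewrite /harmonic/= invrK (addrC x) [RHS]mulrC.
Qed.

(** A differentiable substitute for min(v, 1/e) on the nonnegative reals. It is bounded by 1/e, and
    the squared differences of its values increase to those of the identity as e decreases to 0, as
    monotone convergence requires. *)
Definition truncate (R : realType) (e v : R) : R := v / (1 + e * v).

Section truncate.
Variable R : realType.
Implicit Types e v w : R.

Lemma truncate_ge0 e v : 0 <= e -> 0 <= v -> 0 <= truncate e v.
Proof. by move=> e0 v0; rewrite divr_ge0// addr_ge0// mulr_ge0. Qed.

Lemma truncate_le e v : 0 < e -> 0 <= v -> truncate e v <= e^-1.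
Proof.
move=> e0 v0; rewrite /truncate ler_pdivrMr ?ltr_wpDr ?mulr_ge0 ?(ltW e0)//.
by rewrite mulrDr mulrA mulVf ?gt_eqF// mul1r mulr1 lerDr invr_ge0 ltW.
Qed.

Lemma truncateB e v w : 0 <= e -> 0 <= v -> 0 <= w ->
  truncate e v - truncate e w = (v - w) / ((1 + e * v) * (1 + e * w)).
Proof.
move=> e0 v0 w0; rewrite /truncate; have := mulr_ge0 e0 v0; have := mulr_ge0 e0 w0 => ev ew.
by field; apply/andP; split; lra.
Qed.

Lemma sqr_truncateB_nd e e' v w : 0 <= e -> e <= e' -> 0 <= v -> 0 <= w ->
  (truncate e' v - truncate e' w) ^+ 2 <= (truncate e v - truncate e w) ^+ 2.
Proof.
move=> e0 ee' v0 w0; have e'0 := le_trans e0 ee'.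
have ge1 (a b : R) : 0 <= a -> 0 <= b -> 1 <= 1 + a * b by move=> a0 b0; rewrite lerDl mulr_ge0.
have pos (a b : R) : 0 <= a -> 0 <= b -> 0 < 1 + a * b by move=> a0 b0; apply: lt_le_trans (ge1 _ _ a0 b0).
rewrite !truncateB// !exprMn ler_wpM2l ?sqr_ge0// lerXn2r ?nnegrE ?invr_ge0 ?mulr_ge0 ?(ltW (pos _ _ _ _))//.
rewrite lef_pV2 ?posrE ?mulr_gt0 ?pos//.
by apply: ler_pM; rewrite ?(ltW (pos _ _ _ _))// lerD2l ler_wpM2r.
Qed.

Lemma cvg_truncate v : (fun j => truncate j.+1%:R^-1 v) @ \oo --> v.
Proof.
have H : (fun j => 1 + @harmonic R j * v) @ \oo --> 1 + 0 * v.
  by apply: cvgD; [exact: cvg_cst|apply: cvgM; [exact: cvg_harmonic|exact: cvg_cst]].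
have H1 : 1 + 0 * v != 0 by rewrite mul0r addr0 oner_eq0.
have H2 := cvgM (@cvg_cst _ v nat \oo _) (cvgV H1 H).
by move: H2; rewrite mul0r addr0 invr1 mulr1; apply.
Qed.

Lemma measurable_truncate d (T : measurableType d) e (f : T -> R) : 0 <= e ->
  measurable_fun setT f -> (forall x, 0 <= f x) -> measurable_fun setT (fun x => truncate e (f x)).
Proof.
move=> e0 mf f0; apply: measurable_funM => //; apply: measurable_funV.
  by apply: measurable_funD => //; exact: measurable_funM.
by move=> x; rewrite addr_ge0// mulr_ge0.
Qed.

Lemma is_derive_truncate (V : normedModType R) e (f : V -> R) (x v : V) a : 0 < e -> 0 <= f x ->
  is_derive x v f a -> is_derive x v (fun y => truncate e (f y)) (a / (1 + e * f x) ^+ 2).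
Proof.
move=> e0 fx0 df; apply: is_derive_of_line.
have df' : is_derive (0 : R) 1 (fun t : R => f (x + t *: v)) a.
  by apply: is_derive_line; rewrite scale0r addr0.
have pos : 1 + e * f x != 0 by rewrite gt_eqF// ltr_wpDr// mulr_ge0// ltW.
have dg : is_derive (0 : R) 1 (fun t : R => 1 + e * f (x + t *: v)) (e * a).
  rewrite -[X in is_derive _ _ _ X]add0r; apply: is_deriveD; exact: is_deriveZ.
have nz : 1 + e * f (x + (0 : R) *: v) != 0 by rewrite scale0r addr0.
have dV := @is_deriveV R (fun t => 1 + e * f (x + t *: v)) 0 _ 1 nz dg.
have H := is_deriveM df' dV.
rewrite scale0r addr0 in H.
rewrite (_ : a / _ = f x *: (- (1 + e * f x) ^- 2 *: (e * a)) + (1 + e * f x)^-1 *: a).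
  exact: H.
by rewrite /GRing.scale/=; field.
Qed.

End truncate.

Section truncated_energy.
Variables (R : realType) (n k l : nat).
Variables (W1 : 'M[R]_(n, k)) (W2 : 'M[R]_(n, l)).
Variable rho : 'cV[R]_n -> R.
Hypothesis mrho : measurable_fun setT rho.
Hypothesis rho0 : forall x, 0 <= rho x.
Local Notation leb := (lebesgue_cV R).
Variable f : 'cV[R]_n -> R.
Hypothesis mf : measurable_fun setT f.
Hypothesis f0 : forall x, 0 <= f x.
Hypothesis df : has_partials_on (dsupp rho) f.
Hypothesis df2 : partials_square_integrable rho f.

Definition partial (i : 'I_n) (x : 'cV[R]_n) : R := gradient f x i ord0.

Lemma measurable_dsupp : measurable (dsupp rho).
Proof.
rewrite (_ : dsupp rho = setT `&` rho @^-1` [set` `]0%R, +oo[]).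
  by apply: mrho => //; exact: measurable_itv.
by rewrite setTI; apply/seteqP; split=> x /=; rewrite in_itv/= andbT.
Qed.

Lemma partialE i x : dsupp rho x -> is_derive x (delta_mx i ord0) f (partial i x).
Proof. by move=> Xx; rewrite /partial mxE; apply: derivableP; exact: df. Qed.

(** On the support the partial derivative is a limit of measurable difference quotients along the
    steps 1/(j + 1); the indicator makes the sequence converge everywhere. *)
Lemma measurable_partial i : measurable_fun setT (fun x => \1_(dsupp rho) x * partial i x).
Proof.
have mI := @measurable_indic _ 'cV[R]_n R setT _ measurable_dsupp.
apply: (measurable_fun_cvg (h := fun j x =>
  \1_(dsupp rho) x * ((f (x + j.+1%:R^-1 *: delta_mx i ord0) - f x) * j.+1%:R))).
- move=> j; apply: measurable_funM => //; apply: measurable_funM => //; apply: measurable_funB => //.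
  by apply: measurableT_comp mf _; apply: measurable_cVD => //; exact: measurable_cst.
- move=> x _; rewrite indicE; case: (boolP (x \in dsupp rho)) => [/set_mem Xx|_].
    under eq_fun do rewrite mul1r.
    by rewrite mul1r; apply: is_derive_cvg_seq; exact: partialE.
  under eq_fun do rewrite mul0r.
  by rewrite mul0r; exact: cvg_cst.
Qed.

Lemma integral_partial_sqr_lty i : (\int[leb n]_x ((\1_(dsupp rho) x * partial i x) ^+ 2 * rho x)%:E < +oo)%E.
Proof.
have /integrableP[_] := df2 i; rewrite integral_indicE; apply: le_lt_trans.
apply: ge0_le_integral_dom => x _; first by rewrite lee_fin mulr_ge0 ?sqr_ge0.
rewrite /partial abse_EFin -EFinM lee_fin ger0_norm; last by rewrite mulr_ge0 ?sqr_ge0.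
rewrite indicE; case: (x \in _); first by rewrite mul1r mulr1.
by rewrite mul0r expr0n mul0r mulr0.
Qed.

(** Reduction to the class of functions that can be mollified. Truncation bounds [f]; the lower
    bound [c] of the density on [U] turns square integrability against [rho] into square
    integrability against Lebesgue measure; the chain rule factor (1 + e f)^-2 is at most 1, so the
    gradient term does not grow. *)
Lemma truncated_energy_le (U K : set 'cV[R]_n) (C c e : R) :
  measurable U -> U `<=` dsupp rho -> 0 < c -> (forall x, U x -> c <= rho x) -> 0 < e -> 0 <= C ->
  (forall (h : 'cV[R]_n -> R) (g : 'I_n -> 'cV[R]_n -> R) (M : R),
    measurable_fun setT h -> (forall i : 'I_n, measurable_fun setT (g i)) ->
    (forall x, 0 <= h x) -> (forall x, h x <= M) ->
    (forall x, U x -> forall i, is_derive x (delta_mx i ord0) h (g i x)) ->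
    (forall i, (\int[leb n]_x (g i x ^+ 2)%:E < +oo)%E) ->
    (pair_energy W1 W2 rho K h <= C%:E * \int[leb n]_x (grad2 W2 g x * rho x)%:E)%E) ->
  (pair_energy W1 W2 rho K (fun x => truncate e (f x)) <=
   C%:E * \int[leb n]_x (grad2 W2 partial x * rho x)%:E)%E.
Proof.
move=> mU UX c0 Uc e0 C0 H.
have mIU := @measurable_indic _ 'cV[R]_n R setT _ mU.
pose s x := \1_U x / (1 + e * f x) ^+ 2.
have ef x : 1 <= 1 + e * f x by rewrite lerDl mulr_ge0// ltW.
have ef2 x : 1 <= (1 + e * f x) ^+ 2 by rewrite exprn_ege1.
have ef2i x : 0 <= ((1 + e * f x) ^+ 2)^-1 by rewrite invr_ge0 sqr_ge0.
have s0 x : 0 <= s x by rewrite mulr_ge0.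
have s1 x : s x <= \1_U x.
  by rewrite /s ler_piMr// invf_le1// (lt_le_trans ltr01).
have s11 x : s x <= 1 by apply: le_trans (s1 x) _; rewrite indicE; case: (_ \in _).
pose g i x := s x * partial i x.
have gE i x : g i x = s x * (\1_(dsupp rho) x * partial i x).
  rewrite /g /s !indicE; case: (boolP (x \in U)) => [/set_mem Ux|_]; last by rewrite !mul0r.
  by rewrite (mem_set (UX _ Ux)) !mul1r.
have ms : measurable_fun setT s.
  apply: measurable_funM => //; apply: measurable_funV; last by move=> x; exact: sqr_ge0.
  by apply: measurable_funX; apply: measurable_funD => //; exact: measurable_funM.
have mg i : measurable_fun setT (g i).
  by rewrite (funext (gE i)); apply: measurable_funM => //; exact: measurable_partial.
apply: le_trans (H _ g e^-1 _ mg _ _ _ _) _.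
- exact: measurable_truncate (ltW e0) mf f0.
- by move=> x; rewrite truncate_ge0 ?(ltW e0).
- by move=> x; exact: truncate_le.
- move=> x Ux i; rewrite /g /s indicE (mem_set Ux) mul1r mulrC.
  by apply: is_derive_truncate => //; exact/partialE/UX.
- move=> i; apply: (@le_lt_trans _ _ (c^-1%:E *
    \int[leb n]_x ((\1_(dsupp rho) x * partial i x) ^+ 2 * rho x)%:E)%E).
    rewrite -ge0_integralZl ?lee_fin ?invr_ge0 ?(ltW c0)//; last 2 first.
    + apply/measurable_EFinP; apply: measurable_funM => //; apply: measurable_funX; exact: measurable_partial.
    + by move=> x _; rewrite lee_fin mulr_ge0 ?sqr_ge0.
    apply: ge0_le_integral_dom => x _; first by rewrite lee_fin sqr_ge0.
    rewrite gE exprMn -EFinM lee_fin; set p := (_ * _) ^+ 2; have p0 : 0 <= p by exact: sqr_ge0.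
    case: (boolP (x \in U)) => [/set_mem Ux|xU].
      rewrite [leRHS]mulrCA [leLHS]mulrC; apply: ler_wpM2l; first exact: p0.
      apply: (@le_trans _ _ 1); first by rewrite expr_le1.
      by rewrite -(mulVf (lt0r_neq0 c0)) ler_wpM2l ?invr_ge0 ?(ltW c0)// Uc.
    by rewrite /s indicE (negbTE xU) mul0r expr0n mul0r mulr_ge0 ?invr_ge0 ?(ltW c0)// mulr_ge0.
  by rewrite lte_mul_pinfty ?lee_fin ?invr_ge0 ?(ltW c0)// integral_partial_sqr_lty.
apply: lee_wpmul2l; first by rewrite lee_fin.
apply: ge0_le_integral_dom => x _; first by rewrite lee_fin mulr_ge0 ?nsq_ge0.
rewrite lee_fin; apply: ler_wpM2r => //.
rewrite /grad2 (_ : \col_i g i x = s x *: \col_i partial i x); last first.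
  by apply/colP => i; rewrite !mxE.
rewrite -scalemxAr nsqZ ler_piMl ?nsq_ge0// expr_le1//.
Qed.

(** Monotone convergence in each of the three integrals: the weights grow with the nested sets
    [K j], the squared differences grow as the truncation level 1/(j + 1) decreases. Points where
    [rho] vanishes carry no weight, so exhausting the support is enough. *)
Lemma pair_energy_limit (K : (set 'cV[R]_n)^nat) (B : \bar R) :
  (forall j, measurable (K j)) -> (forall i j, (i <= j)%N -> K i `<=` K j) ->
  (forall x, dsupp rho x -> exists j, K j x) ->
  (forall j, (pair_energy W1 W2 rho (K j) (fun x => truncate j.+1%:R^-1 (f x)) <= B)%E) ->
  (pair_energy W1 W2 rho setT f <= B)%E.
Proof.
move=> mK ndK exK HB.
pose e j : R := j.+1%:R^-1.
have e0 j : 0 < e j by rewrite invr_gt0.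
pose t j x := truncate (e j) (f x).
pose F j (p : ('cV[R]_k * 'cV[R]_l) * 'cV[R]_l) := (pair_weight W1 W2 rho (K j) p.1.1 p.1.2 p.2 *
  (t j (recombine W1 W2 p.1.1 p.1.2) - t j (recombine W1 W2 p.1.1 p.2)) ^+ 2)%:E : \bar R.
pose F' (p : ('cV[R]_k * 'cV[R]_l) * 'cV[R]_l) := (pair_weight W1 W2 rho setT p.1.1 p.1.2 p.2 *
  (f (recombine W1 W2 p.1.1 p.1.2) - f (recombine W1 W2 p.1.1 p.2)) ^+ 2)%:E : \bar R.
have F0 j p : (0 <= F j p)%E by rewrite lee_fin mulr_ge0 ?sqr_ge0 ?pair_weight_ge0.
have mF j : measurable_fun setT (F j).
  have mt : measurable_fun setT (t j) by exact: measurable_truncate (ltW (e0 j)) mf f0.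
  have := @measurable_energy_density R n k l W1 W2 rho mrho rho0 (K j) (t j) 1 (mK j) mt.
  by under eq_fun do rewrite mul1r.
have ndF p : {homo F^~ p : i j / (i <= j)%N >-> (i <= j)%E}.
  move=> i j ij; rewrite lee_fin; apply: ler_pM; rewrite ?sqr_ge0 ?pair_weight_ge0//.
    have m0 := marginal_ge0 W1 W2 rho0 p.1.1.
    rewrite /pair_weight; apply: ler_wpM2l; first by rewrite divr_ge0// mulr_ge0.
    have IK x : \1_(K i) x <= \1_(K j) x :> R.
      rewrite !indicE; case: (boolP (x \in K i)) => [/set_mem /(ndK _ _ ij)/mem_set ->//|_]; exact: ler0n.
    by apply: ler_pM => //; exact: ler0n.
  by apply: sqr_truncateB_nd => //; [exact/ltW|rewrite lef_pV2 ?posrE// ler_nat].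
have cvgF p : F^~ p @ \oo --> F' p.
  apply: cvg_EFin.
    by apply: nearW => j.
  apply: cvgM; last first.
    rewrite expr2; apply: cvgM; apply: cvgB; exact: cvg_truncate.
  apply: cvg_near_cst.
  set x := recombine W1 W2 p.1.1 p.1.2; set x' := recombine W1 W2 p.1.1 p.2.
  have [|rx] := eqVneq (rho x) 0.
    by rewrite /pair_weight => ->; apply: nearW => j; rewrite !mul0r.
  have [|rx'] := eqVneq (rho x') 0.
    by rewrite /pair_weight => ->; apply: nearW => j; rewrite mulr0 !mul0r.
  have [i Ki] : exists j, K j x by apply: exK; rewrite /dsupp/= lt_def rx rho0.
  have [i' Ki'] : exists j, K j x' by apply: exK; rewrite /dsupp/= lt_def rx' rho0.
  exists (maxn i i') => // j /=; rewrite geq_max => /andP[ij ij'].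
  rewrite /pair_weight -/x -/x' !indicE !in_setT.
  by rewrite (mem_set (ndK _ _ ij _ Ki)) (mem_set (ndK _ _ ij' _ Ki')).
have mF1 j := measurable_triple1 (mF j) (F0 j).
have mF2 j := measurable_triple2 (mF j) (F0 j).
have H3 : pair_energy W1 W2 rho (K j) (t j) @[j --> \oo] --> pair_energy W1 W2 rho setT f.
  rewrite /pair_energy.
  apply: (@cvg_integral_nondecreasing _ _ _ (leb k)
    (fun j y => \int[leb l]_z \int[leb l]_z' F j ((y, z), z'))%E) => //.
  - by move=> j y; apply: integral_ge0 => z _; exact: integral_ge0.
  - move=> y i j ij; apply: ge0_le_integral_dom => z _; first exact: integral_ge0.
    by apply: ge0_le_integral_dom => z' _; [exact: F0|exact: ndF].
  move=> y; apply: (@cvg_integral_nondecreasing _ _ _ (leb l)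
    (fun j z => \int[leb l]_z' F j ((y, z), z'))%E) => //.
  - by move=> j; exact: measurableT_comp (mF1 j) (measurable_pair1 _).
  - by move=> j z; exact: integral_ge0.
  - move=> z i j ij; by apply: ge0_le_integral_dom => z' _; [exact: F0|exact: ndF].
  move=> z; apply: (@cvg_integral_nondecreasing _ _ _ (leb l) (fun j z' => F j ((y, z), z'))%E) => //.
  by move=> j; exact: measurableT_comp (mF j) (measurable_pair1 _).
rewrite -(cvg_lim _ H3)//; apply: lime_le; first by apply/cvg_ex; eexists; exact: H3.
exact: nearW.
Qed.

End truncated_energy.

(** * Poincare inequality *)

Section euclidean_balls.
Variables (R : realType) (n : nat).
Implicit Types (x v : 'cV[R]_n) (X : set 'cV[R]_n).

Lemma open_nsq_ball X x : open X -> X x -> exists2 r : R, 0 < r & forall v, nsq v <= r -> X (x + v).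
Proof.
move=> oX Xx; have /nbhs_ballP[e /= e0 He] : nbhs x X by exact: open_nbhs_nbhs.
exists ((e / 2) ^+ 2) => [|v ve]; first by rewrite exprn_gt0// divr_gt0.
apply: He; split => // i j; rewrite ord1 !mxE.
rewrite -ball_normE/= opprD addrA subrr add0r normrN.
apply: (@le_lt_trans _ _ (e / 2)); last by rewrite ltr_pdivrMr// mulr_natr mulr2n ltrDl.
have e20 : 0 <= e / 2 by rewrite divr_ge0// ltW.
rewrite -ler_sqr ?nnegrE// real_normK ?num_real//; apply: le_trans ve; exact: coor_nsq.
Qed.

Lemma bounded_nsq X : bounded_set X -> exists2 D : R, 0 <= D & forall x v, X x -> X v -> nsq (v - x) <= D.
Proof.
move=> [M [Mreal HM]].
have {HM} := HM (`|M| + 1); rewrite (le_lt_trans (real_ler_norm Mreal)) ?ltrDl// => /(_ isT).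
set B := `|M| + 1 => HB; have B0 : 0 <= B by rewrite addr_ge0.
have coor x i : X x -> `|x i ord0| <= B.
  move=> Xx; apply: le_trans (HB x Xx).
  rewrite [leRHS]/Num.norm/= mx_normrE.
  exact: (le_bigmax _ (fun ij : 'I_n * 'I_1 => `|x ij.1 ij.2|) (i, ord0)).
exists (n%:R * (2 * B) ^+ 2) => [|x v Xx Xv]; first by rewrite mulr_ge0// sqr_ge0.
rewrite /nsq -[n in n%:R]card_ord mulr_natl -sumr_const; apply: ler_sum => i _.
rewrite !mxE -(real_normK (num_real _)) lerXn2r ?nnegrE ?mulr_ge0//.
apply: le_trans (ler_normB _ _) _; rewrite mulr_natl mulr2n.
by apply: lerD; exact: coor.
Qed.

Lemma convex_segment X x v (t : R) : convex_set X -> X x -> X v -> 0 <= t <= 1 ->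
  X ((1 - t) *: x + t *: v).
Proof.
move=> cX Xx Xv t01.
have t01' : 0 <= 1 - t <= 1 by lra.
have := cX x v (Itv01 (andP t01').1 (andP t01').2) (mem_set Xx) (mem_set Xv).
rewrite inE; congr (X _); rewrite -[X in _ = _ + X *: v](subKr 1 t); exact: erefl.
Qed.

End euclidean_balls.

Section shrunk_convex.
Variables (R : realType) (n : nat) (X : set 'cV[R]_n) (c : 'cV[R]_n).
Hypotheses (oX : open X) (cX : convex_set X) (Xc : X c).

(* Dilation of X about c by a factor slightly below 1. *)
Definition shrunk (j : nat) : set 'cV[R]_n := [set x | X (x + j.+1%:R^-1 *: (x - c))].

Lemma measurable_shrunk j : measurable X -> measurable (shrunk j).
Proof.
move=> mX; rewrite -[shrunk j]setTI.
have m : measurable_fun setT (fun x : 'cV[R]_n => x + j.+1%:R^-1 *: (x - c)).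
  apply: measurable_cVD => //; apply: measurable_cVZ => //; apply: measurable_cVB => //; exact: measurable_cst.
exact: m.
Qed.

Lemma shrunk_segment j x v (t : R) : shrunk j x -> shrunk j v -> 0 <= t <= 1 ->
  shrunk j ((1 - t) *: x + t *: v).
Proof.
move=> Xx Xv t01; have := convex_segment cX Xx Xv t01; rewrite /shrunk/=; congr (X _).
by apply/colP => i; rewrite !mxE; ring.
Qed.

Lemma shrunk_nd i j : (i <= j)%N -> shrunk i `<=` shrunk j.
Proof.
move=> ij x Xx.
(* The dilated point c + (1 + 1/(j+1)) (x - c) divides the segment from c to c + (1 + 1/(i+1)) (x -
   c) in this ratio. *)
pose t : R := (1 + j.+1%:R^-1) / (1 + i.+1%:R^-1).
have i0 : 0 < i.+1%:R^-1 :> R by rewrite invr_gt0.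
have j0 : 0 < j.+1%:R^-1 :> R by rewrite invr_gt0.
have t01 : 0 <= t <= 1.
  rewrite divr_ge0 ?ler_pdivrMr ?mul1r ?lerD2l ?lef_pV2 ?posrE ?ler_nat ?addr_ge0 ?ltr_wpDl//; exact: ltW.
have := convex_segment cX Xc Xx t01; rewrite /shrunk/=; congr (X _).
apply/colP => m; rewrite !mxE /t; move: i0 j0; move: (i.+1%:R^-1) (j.+1%:R^-1) => a b a0 b0.
by field; lra.
Qed.

Lemma shrunk_exhaust x : X x -> exists j, shrunk j x.
Proof.
move=> Xx; have [r r0 Hr] := open_nsq_ball oX Xx.
exists (Num.truncn (nsq (x - c) / r)); apply: Hr.
set N := Num.truncn _; have HN : nsq (x - c) < r * N.+1%:R.
  by rewrite mulrC -ltr_pdivrMr// truncnS_gt.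
rewrite nsqZ exprVn ler_pdivrMl ?exprn_gt0//.
apply: le_trans (ltW HN) _; rewrite mulrC ler_wpM2r ?(ltW r0)// -natrX ler_nat.
by rewrite expnS expn1 leq_pmulr.
Qed.

(** With weight (j+1)/(j+2), the point x + u is a convex combination of the dilated point x + (x -
    c)/(j+1), in X by definition, and of c + (j+2) u, in X when u is small. The admissible size of u
    does not depend on x. *)
Lemma shrunk_inner j : exists2 d : R, 0 < d & shrunk j `<=` inner d X.
Proof.
have [r r0 Hr] := open_nsq_ball oX Xc.
have j0 : 0 < j.+1%:R :> R by [].
exists (r / j.+2%:R ^+ 2); first by rewrite divr_gt0// exprn_gt0.
move=> x Xx u ud.
have Xcu : X (c + j.+2%:R *: u).
  by apply: Hr; rewrite nsqZ mulrC -ler_pdivlMr// exprn_gt0.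
have t01 : 0 <= (j.+1%:R / j.+2%:R : R) <= 1.
  by rewrite divr_ge0//= ler_pdivrMr// mul1r ler_nat.
have := convex_segment cX Xcu Xx t01; congr (X _).
apply/colP => m; rewrite !mxE -[j.+2]addn1 natrD.
by field; rewrite ?pnatr_eq0 /=; apply/andP; split; lra.
Qed.

End shrunk_convex.

Section poincare.
Variables (R : realType) (n : nat) (rho : 'cV[R]_n -> R).
Hypothesis mrho : measurable_fun setT rho.
Hypothesis rho0 : forall x, 0 <= rho x.
Hypothesis rho1 : (\int[lebesgue_cV R n]_x (rho x)%:E = 1)%E.
Hypothesis oX : open (dsupp rho).
Local Notation leb := (lebesgue_cV R).

(** The constant precedes the function, the dimensions and the frame, which gives the uniformity
    claimed by the theorem. The case k = 0 is included and serves to show that [f] has finite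
    mean. *)
Definition poincare_with (C : R) := forall f : 'cV[R]_n -> R,
  measurable_fun setT f -> (forall x, 0 <= f x) ->
  has_partials_on (dsupp rho) f -> partials_square_integrable rho f ->
  forall (k l : nat) (hkl : (k + l)%N = n) (W1 : 'M[R]_(n, k)) (W2 : 'M[R]_(n, l)),
  orthogonal_mx (castmx (erefl n, hkl) (row_mx W1 W2)) ->
  (pair_energy W1 W2 rho setT f <=
   C%:E * \int[leb n]_x (grad2 W2 (partial f) x * rho x)%:E)%E.

Lemma dsupp_nonempty : exists x, dsupp rho x.
Proof.
apply: contrapT => /forallNP H.
have : (\int[leb n]_x (rho x)%:E = 0)%E.
  by apply: integral0_eq => x _; congr EFin; apply/eqP; move/negP: (H x); rewrite lt_def rho0 andbT negbK.
by rewrite rho1 => /eqP; rewrite eqe oner_eq0.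
Qed.

Lemma pow2_le k l : (k + l)%N = n -> 2 ^+ l <= 2 ^+ n :> R.
Proof. by move=> <-; rewrite ler_eXn2l ?leq_addl// ltr1n. Qed.

Lemma poincare_convex : uniform_on_convex rho -> exists2 C : R, 0 < C & poincare_with C.
Proof.
move=> [bX cX rhoE]; have [c0 Xc0] := dsupp_nonempty.
have [D D0 HD] := bounded_nsq bX.
set c := (fine _)^-1 in rhoE.
have c_gt0 : 0 < c by rewrite -(rhoE _ Xc0).
have mX := measurable_dsupp mrho.
(* The summand 1 secures positivity, as [D] may be 0. *)
exists (2 * D * 2 ^+ n + 1) => [|f mf f0 df df2 k l hkl W1 W2 oW].
  by rewrite ltr_wpDl// !mulr_ge0 ?exprn_ge0.
apply: (pair_energy_limit mrho rho0 mf f0 (K := shrunk (dsupp rho) c0)) => [j|||j].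
- exact: measurable_shrunk.
- exact: shrunk_nd.
- exact: shrunk_exhaust.
have [d1 d10 Kd] := shrunk_inner oX cX Xc0 j.
have KX : shrunk (dsupp rho) c0 j `<=` dsupp rho.
  by move=> x /Kd /(_ 0); rewrite nsq0 addr0; apply; exact: ltW.
(* The density equals [c] on its support, so the whole support serves as the set where it is bounded
   below. *)
apply: (truncated_energy_le mrho rho0 mf f0 df df2 mX (@subset_refl _ _) c_gt0) => //.
- by move=> x /rhoE ->.
- by rewrite addr_ge0// !mulr_ge0 ?exprn_ge0.
move=> h g M mh mg h0 hM dh g2.
apply: (@le_trans _ _ ((2 * D * 2 ^+ l)%:E * \int[leb n]_x (grad2 W2 g x * rho x)%:E)%E).
  apply: (pair_energy_convex_le oW mrho rho0 mh mg h0 hM dh g2 rhoE c_gt0 D0 _ _ _ d10 Kd).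
  - exact: measurable_shrunk.
  - by move=> x x' /KX Xx /KX Xx'; exact: HD.
  - by move=> x x' t; exact: shrunk_segment.
apply: lee_wpmul2r.
  by apply: integral_ge0 => x _; rewrite lee_fin mulr_ge0 ?nsq_ge0.
by rewrite lee_fin ler_wpDr// ler_wpM2l ?mulr_ge0// (pow2_le hkl).
Qed.

Lemma poincare_gaussian : std_gaussian rho -> exists2 C : R, 0 < C & poincare_with C.
Proof.
move=> gauss.
have X_all x : dsupp rho x.
  by rewrite /dsupp/= (gaussE gauss) divr_gt0 ?expR_gt0// exprn_gt0// sqrtr_gt0 mulr_gt0// pi_gt0.
exists (4 * ((pi / 2) ^+ 2 * (3 * 2 ^+ n))) => [|f mf f0 df df2 k l hkl W1 W2 oW].
  by rewrite !mulr_gt0 ?exprn_gt0 ?divr_gt0 ?pi_gt0.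
have p20 : 0 <= (pi / 2 : R) ^+ 2 by exact: sqr_ge0.
apply: (pair_energy_limit mrho rho0 mf f0 (K := fun j => cball (j%:R))) => [j|i j ij x|x _|j].
- exact: measurable_cball.
- by rewrite /cball/= => /le_trans; apply; rewrite ler_nat.
- by exists (Num.truncn (nsq x)).+1; rewrite /cball/= ltW// truncnS_gt.
(* A lower bound of the density on the ball of squared radius 4j + 2, the set on which the estimate
   for [cball j] uses derivatives. *)
pose c := expR (- ((4 * j%:R + 2) / 2)) / Num.sqrt (2 * pi : R) ^+ n.
have s0 : 0 < Num.sqrt (2 * pi : R) ^+ n by rewrite exprn_gt0// sqrtr_gt0 mulr_gt0// pi_gt0.
have c_gt0 : 0 < c by rewrite divr_gt0 ?expR_gt0.
apply: (truncated_energy_le mrho rho0 mf f0 df df2 (@measurable_cball R n (4 * j%:R + 2)) _ c_gt0) => //.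
- move=> x; rewrite /cball/= => xU; rewrite (gaussE gauss) /c.
  by rewrite ler_pM2r ?invr_gt0// ler_expR lerN2 ler_pM2r.
- by rewrite mulr_ge0// mulr_ge0// mulr_ge0// exprn_ge0.
move=> h g M mh mg h0 hM dh g2.
apply: (@le_trans _ _ ((4 * ((pi / 2) ^+ 2 * (3 * 2 ^+ l)))%:E * \int[leb n]_x (grad2 W2 g x * rho x)%:E)%E).
  by apply: (pair_energy_gaussian_le oW mrho rho0 gauss mh mg h0 hM _ dh g2); rewrite ler0n.
apply: lee_wpmul2r.
  by apply: integral_ge0 => x _; rewrite lee_fin mulr_ge0 ?nsq_ge0.
by rewrite lee_fin ler_pM2l// ler_wpM2l// ler_pM2l ?(pow2_le hkl).
Qed.

End poincare.

(** * Perturbed eigenspaces *)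

Lemma enorm_ge0 (R : realType) n (x : 'cV[R]_n) : 0 <= enorm x.
Proof. exact: sqrtr_ge0. Qed.

Lemma nsq_mulmx_le (R : realType) m n (A : 'M[R]_(m, n)) (x : 'cV[R]_n) :
  nsq (A *m x) <= (\sum_i \sum_j A i j ^+ 2) * nsq x.
Proof.
rewrite /nsq mulr_suml; apply: ler_sum => i _; rewrite mxE; exact: cauchy_schwarz_sum.
Qed.

Lemma enorm_le_opnorm (R : realType) m n (A : 'M[R]_(m, n)) (x : 'cV[R]_n) :
  enorm x <= 1 -> enorm (A *m x) <= opnorm A.
Proof.
move=> x1; apply: ub_le_sup; last by exists x.
(* The Frobenius norm only certifies that the set behind the supremum [opnorm] is bounded; the 1
   avoids a square root. *)
exists (1 + \sum_i \sum_j A i j ^+ 2) => _ [v v1 <-].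
set S := \sum_i _; have S0 : 0 <= S by do 2 (apply: sumr_ge0 => ? _); exact: sqr_ge0.
rewrite -ler_sqr ?nnegrE ?enorm_ge0 ?addr_ge0// enorm_sqr.
apply: le_trans (nsq_mulmx_le _ _) _.
have : nsq v <= 1 by rewrite -enorm_sqr expr_le1 ?enorm_ge0.
by have := nsq_ge0 v; rewrite -/S; nra.
Qed.

Section eigenvalue_bound.
Variables (R : realType) (n k l : nat) (hkl : (k + l)%N = n).
Variables (W1 : 'M[R]_(n, k)) (W2 : 'M[R]_(n, l)).
Local Notation Wh := (castmx (erefl n, hkl) (row_mx W1 W2)).
Hypothesis oW : orthogonal_mx Wh.

Lemma nsq_block_le (v : 'cV[R]_n) : nsq (W2^T *m v) <= nsq v.
Proof.
move: W1 W2 oW v; case: n / hkl => V1 V2; rewrite castmx_id => oV v.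
have oV' : ((row_mx V1 V2)^T)^T *m (row_mx V1 V2)^T = 1%:M by rewrite trmxK (mulmx1C oV).
rewrite -[leRHS](nsq_orthogonal v oV') tr_row_mx mul_col_mx nsq_col_mx lerDr; exact: nsq_ge0.
Qed.

Lemma block_col_eq0 (i : 'I_n) : (i < k)%N -> W2^T *m col i Wh = 0.
Proof.
have [_ _ W21 _] := orthogonal_blocks oW.
move: W1 W2 W21 i; case: n / hkl => V1 V2 V21 i ik; rewrite castmx_id.
have -> : i = lshift l (Ordinal ik) by exact: val_inj.
by rewrite colKl colE mulmxA V21 mul0mx.
Qed.

Lemma trace_block_le (W : 'M[R]_n) (lam : 'rV[R]_n) (eps : R) : orthogonal_mx W ->
  (forall i, 0 <= lam ord0 i) -> 0 <= eps -> opnorm (W - Wh) <= eps ->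
  \tr (W2^T *m (W *m diag_mx lam *m W^T) *m W2) <=
  eps ^+ 2 * (\sum_(i < n | (i < k)%N) lam ord0 i) + \sum_(i < n | (k <= i)%N) lam ord0 i.
Proof.
move=> oW' lam0 eps0 We.
(* Each eigenvalue is weighted by the squared length of the component of its eigenvector in the
   range of [W2]; this is at most eps^2 for a leading eigenvector and at most 1 for any. *)
have -> : \tr (W2^T *m (W *m diag_mx lam *m W^T) *m W2) = \sum_i lam ord0 i * nsq (W2^T *m col i W).
  have -> : W2^T *m (W *m diag_mx lam *m W^T) *m W2 = (W2^T *m W) *m diag_mx lam *m (W2^T *m W)^T.
    by rewrite trmx_mul trmxK !mulmxA.
  rewrite /mxtrace; under eq_bigr do rewrite mxE.
  rewrite exchange_big/=; apply: eq_bigr => i _; rewrite /nsq mulr_sumr; apply: eq_bigr => a _.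
  by rewrite mul_mx_diag colE mulmxA -colE [col _ _ _ _]mxE mxE [_^T i a]mxE mulrAC mulrC -expr2.
rewrite (bigID (fun i : 'I_n => (i < k)%N))/= mulr_sumr; apply: lerD.
  apply: ler_sum => i ik; rewrite mulrC ler_wpM2r//.
  have -> : W2^T *m col i W = W2^T *m ((W - Wh) *m delta_mx i ord0).
    by rewrite mulmxBl -!colE mulmxBr block_col_eq0// subr0.
  apply: le_trans (nsq_block_le _) _.
  rewrite -enorm_sqr lerXn2r ?nnegrE ?enorm_ge0//; apply: le_trans We; apply: enorm_le_opnorm.
  rewrite -(ler_sqr (enorm_ge0 _)) ?nnegrE// enorm_sqr expr1n.
  rewrite /nsq (bigD1 i)//= big1 ?addr0 => [|j ji]; rewrite !mxE ?eqxx/= ?expr1n//.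
  by rewrite (negbTE ji) expr0n.
under [leRHS]eq_bigl do rewrite leqNgt.
apply: ler_sum => i _; rewrite ler_piMr//; apply: le_trans (nsq_block_le _) _.
rewrite colE nsq_orthogonal//.
by rewrite /nsq (bigD1 i)//= big1 ?addr0 => [|j ji]; rewrite !mxE ?eqxx/= ?expr1n// (negbTE ji) expr0n.
Qed.

End eigenvalue_bound.

Section gradient_matrix.
Variables (R : realType) (n : nat) (rho f : 'cV[R]_n -> R).
Hypothesis mrho : measurable_fun setT rho.
Hypothesis rho0 : forall x, 0 <= rho x.
Hypothesis mf : measurable_fun setT f.
Hypothesis df : has_partials_on (dsupp rho) f.
Hypothesis df2 : partials_square_integrable rho f.
Local Notation leb := (lebesgue_cV R n).

Lemma dsupp_eq0 x : x \notin dsupp rho -> rho x = 0.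
Proof.
move=> /negP; rewrite inE /dsupp/= lt_def rho0 andbT => /negP; rewrite negbK.
by move/eqP.
Qed.

Let cross (i j : 'I_n) (x : 'cV[R]_n) : R := partial f i x * partial f j x * rho x.

Let crossE i j x : cross i j x =
  (\1_(dsupp rho) x * partial f i x) * (\1_(dsupp rho) x * partial f j x) * rho x.
Proof.
rewrite indicE; case: (boolP (x \in dsupp rho)) => [_|/dsupp_eq0]; first by rewrite !mul1r.
by rewrite /cross => ->; rewrite !mulr0.
Qed.

Let integrable_cross i j : leb.-integrable setT (EFin \o cross i j).
Proof.
have msq a : measurable_fun setT (fun x => (\1_(dsupp rho) x * partial f a x) ^+ 2 * rho x).
  by apply: measurable_funM => //; apply: measurable_funX; exact: measurable_partial.
have isq a : leb.-integrable setT (EFin \o (fun x => (\1_(dsupp rho) x * partial f a x) ^+ 2 * rho x)).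
  apply/integrableP; split; first exact/measurable_EFinP.
  rewrite (eq_integral (fun x => ((\1_(dsupp rho) x * partial f a x) ^+ 2 * rho x)%:E)).
    exact: integral_partial_sqr_lty.
  by move=> x _; rewrite /= ger0_norm// mulr_ge0 ?sqr_ge0.
apply: (le_integrable measurableT _ _ (integrableD measurableT (isq i) (isq j))).
  apply/measurable_EFinP; rewrite (funext (crossE i j)).
  by apply: measurable_funM => //; apply: measurable_funM; exact: measurable_partial.
move=> x _; rewrite /= lee_fin crossE.
set a := (_ * partial f i x); set b := (_ * partial f j x); move: a b (rho x) (rho0 x) => a b r r0.
rewrite -mulrDl (normrM (a * b)) (normrM (_ + _)) (ger0_norm r0); apply: ler_wpM2r => //.
rewrite [leRHS]ger0_norm ?addr_ge0 ?sqr_ge0// (normrM a b) -(real_normK (num_real a)) -(real_normK (num_real b)).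
by have := sqr_ge0 (`|a| - `|b|); have := normr_ge0 a; have := normr_ge0 b; rewrite sqrrB; nra.
Qed.

Lemma weighted_grad2E l (W2 : 'M[R]_(n, l)) :
  (\int[leb]_x (grad2 W2 (partial f) x * rho x)%:E = (\tr (W2^T *m gradient_mx rho f *m W2))%:E)%E.
Proof.
pose q (a : 'I_l) x := \sum_i W2 i a * (\sum_j W2 j a * cross i j x).
have iq a : leb.-integrable setT (EFin \o q a).
  by apply: integrable_sumZ => i; apply: integrable_sumZ => j; exact: integrable_cross.
have gq x : grad2 W2 (partial f) x * rho x = \sum_(a < l) 1 * q a x.
  rewrite /grad2 /nsq mulr_suml; apply: eq_bigr => a _; rewrite mul1r /q mxE.
  rewrite expr2 mulr_suml mulr_suml; apply: eq_bigr => i _.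
  rewrite [X in X * rho x]mulr_sumr mulr_suml [RHS]mulr_sumr; apply: eq_bigr => j _.
  by rewrite !mxE /cross; ring.
rewrite (eq_integral _ _ (fun x _ => congr1 EFin (gq x))).
have isum := integrable_sumZ (fun=> 1) iq.
rewrite -(fineK (integrable_fin_num measurableT isum)); congr EFin.
rewrite -[LHS]/(\int[leb]_x \sum_(a < l) 1 * q a x) Rintegral_sumZ//.
rewrite /mxtrace; apply: eq_bigr => a _; rewrite mul1r /q Rintegral_sumZ => [|i]; last exact: integrable_sumZ.
rewrite mxE [RHS](eq_bigr (fun j => \sum_i W2 i a * (W2 j a * gradient_mx rho f i j))); last first.
  move=> j _; rewrite mxE mulr_suml; apply: eq_bigr => i _; rewrite [_^T a i]mxE; ring.
rewrite exchange_big/=; apply: eq_bigr => i _; rewrite -mulr_sumr; congr (_ * _).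
rewrite Rintegral_sumZ//; apply: eq_bigr => j _; congr (_ * _).
rewrite [RHS]mxE /Rintegral; congr fine; rewrite [RHS]integral_indicE; apply: eq_integral => x _.
rewrite mxE big_ord1 [_^T _ _]mxE -EFinM; congr EFin; rewrite /cross /partial indicE.
by case: (boolP (x \in dsupp rho)) => [_|/dsupp_eq0 ->]; rewrite ?mulr1// !mulr0.
Qed.

End gradient_matrix.

(** * Finiteness of the prior mean *)

Section finite_mean.
Variables (R : realType) (n : nat) (rho f : 'cV[R]_n -> R) (C : R).
Hypothesis mrho : measurable_fun setT rho.
Hypothesis rho0 : forall x, 0 <= rho x.
Hypothesis rho1 : (\int[lebesgue_cV R n]_x (rho x)%:E = 1)%E.
Hypothesis mf : measurable_fun setT f.
Hypothesis f0 : forall x, 0 <= f x.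
Hypothesis df : has_partials_on (dsupp rho) f.
Hypothesis df2 : partials_square_integrable rho f.
Hypothesis poincare : poincare_with rho C.
Local Notation leb := (lebesgue_cV R).

(* The Poincare inequality with no conditioning variable bounds the variance of f, which forces its mean to be finite. *)
Lemma integral_density_lty : (\int[leb n]_x (f x * rho x)%:E < +oo)%E.
Proof.
have oI : orthogonal_mx (castmx (erefl n, erefl n : (0 + n)%N = n) (row_mx (0 : 'M[R]_(n, 0)) 1%:M)).
  rewrite castmx_id /orthogonal_mx.
  have H : (row_mx (0 : 'M[R]_(n, 0)) 1%:M)^T *m row_mx (0 : 'M[R]_(n, 0)) 1%:M = 1%:M.
    rewrite tr_row_mx mul_col_row [RHS](scalar_mx_block 0 n (1 : R)).
    congr block_mx; last by rewrite trmx1 mulmx1.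
    - by rewrite [LHS]flatmx0 [RHS]flatmx0.
    - exact: flatmx0.
    - exact: thinmx0.
  exact: H.
have := poincare mf f0 df df2 oI; rewrite (weighted_grad2E mrho rho0 mf df df2) -EFinM => Hp.
rewrite ltey; apply/eqP => foo.
have rcE y (z : 'cV[R]_n) : recombine (0 : 'M[R]_(n, 0)) 1%:M y z = z.
  by rewrite /recombine mul0mx add0r mul1mx.
have mE y : marginal (0 : 'M[R]_(n, 0)) 1%:M rho y = 1.
  by rewrite /marginal /Rintegral; under eq_integral do rewrite rcE; rewrite rho1.
have : (+oo <= pair_energy (0 : 'M[R]_(n, 0)) 1%:M rho setT f)%E.
  pose F (p : ('cV[R]_0 * 'cV[R]_n) * 'cV[R]_n) :=
    (pair_weight (0 : 'M[R]_(n, 0)) 1%:M rho setT p.1.1 p.1.2 p.2 *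
      (f (recombine (0 : 'M[R]_(n, 0)) 1%:M p.1.1 p.1.2) - f (recombine (0 : 'M[R]_(n, 0)) 1%:M p.1.1 p.2)) ^+ 2)%:E : \bar R.
  have F0 p : (0 <= F p)%E by rewrite lee_fin mulr_ge0 ?sqr_ge0 ?pair_weight_ge0.
  have mF : measurable_fun setT F.
    have := @measurable_energy_density R n 0 n (0 : 'M[R]_(n, 0)) 1%:M rho mrho rho0 setT f 1 measurableT mf.
    by under eq_fun do rewrite mul1r.
  have -> : pair_energy (0 : 'M[R]_(n, 0)) 1%:M rho setT f =
      (\int[leb n]_z \int[leb n]_z' F (((0 : 'cV[R]_0)%R, z), z'))%E.
    rewrite /pair_energy -[LHS]/(\int[leb 0]_y \int[leb n]_z \int[leb n]_z' F ((y, z), z'))%E.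
    by rewrite integral_dirac ?diracT ?mul1e//; exact: measurable_triple2.
  have FE z z' : F (((0 : 'cV[R]_0)%R, z), z') = ((rho z)%:E * (rho z' * (f z - f z') ^+ 2)%:E)%E.
    rewrite /F /= /pair_weight !rcE mE !indicE !in_setT /= divr1 !mulr1 -EFinM.
    by congr EFin; rewrite -!mulrA.
  have msq z : measurable_fun setT (fun z' => (rho z' * (f z - f z') ^+ 2)%:E).
    apply/measurable_EFinP; apply: measurable_funM => //; apply: measurable_funX.
    exact: measurable_funB.
  have inner z : (\int[leb n]_z' (rho z' * (f z - f z') ^+ 2)%:E = +oo)%E.
    have I0 : (0 <= \int[leb n]_z' (rho z' * (f z - f z') ^+ 2)%:E)%E.
      by apply: integral_ge0 => z' _; rewrite lee_fin mulr_ge0 ?sqr_ge0.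
    (* From (a + 1/2)^2 >= 0 with a = f z - f x one gets f x <= (f z + 1) + (f z - f x)^2, so an
       infinite mean makes the inner integral infinite for every z. *)
    have H : (+oo <= (f z + 1)%:E + \int[leb n]_z' (rho z' * (f z - f z') ^+ 2)%:E)%E.
      have fz1 : 0 <= f z + 1 by rewrite addr_ge0.
      rewrite -foo -[X in (X + _)%E]mule1 -rho1 -ge0_integralZl//; last 2 first.
      - exact/measurable_EFinP.
      - by move=> x _; rewrite lee_fin.
      rewrite -ge0_integralD//; last 3 first.
      - by move=> x _; rewrite -EFinM lee_fin mulr_ge0.
      - by apply: emeasurable_funM => //; exact/measurable_EFinP.
      - by move=> x _; rewrite lee_fin mulr_ge0 ?sqr_ge0.
      apply: ge0_le_integral_dom => x _; first by rewrite lee_fin mulr_ge0.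
      rewrite -EFinM -EFinD lee_fin (mulrC (rho x)) -mulrDl; apply: ler_wpM2r => //.
      by have := sqr_ge0 (f z - f x + 2^-1); rewrite sqrrD; lra.
    by move: I0 H; case: (integral _ _ _).
  rewrite (eq_integral (fun z => (rho z)%:E * +oo)%E); last first.
    move=> z _; under eq_integral do rewrite FE.
    rewrite ge0_integralZl ?inner ?lee_fin//.
    by move=> x _; rewrite lee_fin mulr_ge0 ?sqr_ge0.
  by rewrite ge0_integralZr ?rho1 ?mul1e// => [|x _]; [exact/measurable_EFinP|rewrite lee_fin].
by move/le_trans => /(_ _ Hp); rewrite leye_eq.
Qed.

End finite_mean.

(** * Hellinger distance and Monte Carlo error *)

Lemma expRN_lip (R : realType) (u v : R) : 0 <= u -> 0 <= v ->
  (expR (- u) - expR (- v)) ^+ 2 <= (u - v) ^+ 2.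
Proof.
move=> u0 v0.
have key (a b : R) : 0 <= a -> a <= b -> 0 <= expR (- a) - expR (- b) <= b - a.
  move=> a0 ab; rewrite subr_ge0 ler_expR lerN2 ab/=.
  have e1 : expR (- a) <= 1 by rewrite -expR0 ler_expR oppr_le0.
  have := expR_ge1Dx (- (b - a)).
  have -> : expR (- b) = expR (- a) * expR (- (b - a)) by rewrite -expRD; congr expR; lra.
  by have := expR_ge0 (- a); nra.
have [uv|/ltW vu] := leP u v.
  have /andP[h1 h2] := key _ _ u0 uv.
  by rewrite -(sqrrN (u - v)) opprB lerXn2r ?nnegrE ?(le_trans h1 h2).
have /andP[h1 h2] := key _ _ v0 vu.
by rewrite -(sqrrN (expR _ - _)) opprB lerXn2r ?nnegrE ?(le_trans h1 h2).
Qed.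

Section hellinger_bound.
Variables (R : realType) (n : nat) (rho f : 'cV[R]_n -> R).
Hypothesis mrho : measurable_fun setT rho.
Hypothesis rho0 : forall x, 0 <= rho x.
Hypothesis rho1 : (\int[lebesgue_cV R n]_x (rho x)%:E = 1)%E.
Hypothesis mf : measurable_fun setT f.
Hypothesis f0 : forall x, 0 <= f x.
Local Notation leb := (lebesgue_cV R n).
Local Notation mean F := (\int[leb]_x (F x * rho x)).

Lemma Rintegral_dsupp (F : 'cV[R]_n -> R) :
  \int[leb]_(x in dsupp rho) (F x * rho x) = mean F.
Proof.
rewrite /Rintegral; congr fine; rewrite integral_indicE; apply: eq_integral => x _.
rewrite -EFinM indicE; congr EFin.
by case: (boolP (x \in dsupp rho)) => [_|/(dsupp_eq0 rho0) ->]; rewrite ?mulr1// !mulr0.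
Qed.

Lemma integrable_weighted (F : 'cV[R]_n -> R) (M : R) : measurable_fun setT F ->
  (forall x, `|F x| <= M) -> leb.-integrable setT (EFin \o (fun x => F x * rho x)).
Proof.
move=> mF FM.
have irho : leb.-integrable setT (EFin \o rho).
  apply/integrableP; split; first exact/measurable_EFinP.
  by under eq_integral do rewrite /= ger0_norm//; rewrite rho1 ltry.
apply: (le_integrable measurableT _ _ (integrableZl measurableT M irho)).
  by apply/measurable_EFinP; exact: measurable_funM.
move=> x _; rewrite -EFinM /= lee_fin !normrM (ger0_norm (rho0 x)) ler_wpM2r//.
exact: le_trans (FM x) (ler_norm _).
Qed.

Lemma mean_expRN_gt0 (g : 'cV[R]_n -> R) : measurable_fun setT g -> (forall x, 0 <= g x) ->
  0 < mean (fun x => expR (- g x)).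
Proof.
move=> mg g0.
have me : measurable_fun setT (fun x => expR (- g x)).
  by apply: measurableT_comp => //; exact: measurableT_comp.
have ie : leb.-integrable setT (EFin \o (fun x => expR (- g x) * rho x)).
  apply: (integrable_weighted (M := 1) me) => x.
  by rewrite ger0_norm ?expR_ge0// -expR0 ler_expR oppr_le0.
rewrite lt_def; apply/andP; split; last first.
  by apply: fine_ge0; apply: integral_ge0 => x _; rewrite lee_fin mulr_ge0 ?expR_ge0.
apply/eqP => E0.
have I0 : (\int[leb]_x `|(expR (- g x) * rho x)%:E| = 0)%E.
  transitivity (\int[leb]_x (expR (- g x) * rho x)%:E)%E.
    by apply: eq_integral => x _; rewrite gee0_abs// lee_fin mulr_ge0 ?expR_ge0.
  by rewrite -(fineK (integrable_fin_num measurableT ie)); congr EFin.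
have := (ae_eq_integral_abs leb measurableT (measurable_int _ ie)).1 I0.
move=> ae0.
have ae1 : ae_eq leb setT (EFin \o rho) (cst 0%E).
  apply: filterS ae0 => x /= /(_ I) /eqP; rewrite eqe mulf_eq0 gt_eqF ?expR_gt0//=.
  by move=> /eqP -> _.
have mr : measurable_fun setT (EFin \o rho) by exact/measurable_EFinP.
have E := ae_eq_integral _ _ measurableT mr (measurable_cst _) ae1.
have : 1%E = 0%E :> \bar R by rewrite -rho1 -[RHS](integral0 leb setT); exact: E.
by move=> /eqP; rewrite eqe oner_eq0.
Qed.

Let measurable_expRN (g : 'cV[R]_n -> R) (c : R) : measurable_fun setT g ->
  measurable_fun setT (fun x => expR (- (g x / c))).
Proof.
move=> mg; apply: measurableT_comp => //; apply: measurableT_comp => //.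
exact: measurable_funM.
Qed.

Let expRN_le1 (u : R) : 0 <= u -> expR (- u) <= 1.
Proof. by move=> u0; rewrite -expR0 ler_expR oppr_le0. Qed.

Hypothesis fmean : (\int[leb]_x (f x * rho x)%:E < +oo)%E.

Let integrable_f : leb.-integrable setT (EFin \o (fun x => f x * rho x)).
Proof.
apply/integrableP; split; first by apply/measurable_EFinP; exact: measurable_funM.
by under eq_integral do rewrite /= ger0_norm ?mulr_ge0//.
Qed.

(** Integrates the tangent inequality exp(-f) >= exp(-m) (1 + m - f) at the mean m. *)
Lemma jensen_expRN : expR (- mean f) <= mean (fun x => expR (- f x)).
Proof.
set m := mean f.
have i1 : leb.-integrable setT (EFin \o (fun x => (expR (- m) * (1 + m)) * rho x)).
  by apply: (integrable_weighted (M := `|expR (- m) * (1 + m)|)) => // x.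
have i2 : leb.-integrable setT (EFin \o (fun x => expR (- m) * (f x * rho x))).
  exact: (integrableZl measurableT _ integrable_f).
have ie : leb.-integrable setT (EFin \o (fun x => expR (- f x) * rho x)).
  apply: (integrable_weighted (M := 1)) => [|x]; last by rewrite ger0_norm ?expR_ge0 ?expRN_le1.
  by apply: measurableT_comp => //; exact: measurableT_comp.
apply: (@le_trans _ _ (\int[leb]_x ((expR (- m) * (1 + m)) * rho x - expR (- m) * (f x * rho x)))).
  rewrite RintegralB// !RintegralZl//; last first.
    by have := integrable_weighted (@measurable_cst _ _ _ _ setT (1 : R)) (fun x => lexx `|1 : R|); under eq_fun do rewrite mul1r.
  have -> : \int[leb]_x rho x = 1 by rewrite /Rintegral rho1.
  by rewrite -/m; lra.
apply: le_Rintegral => //; first exact: (integrableB measurableT i1 i2).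
move=> x _; rewrite mulrA -mulrBl; apply: ler_wpM2r => //.
have -> : expR (- f x) = expR (- m) * expR (- (f x - m)) by rewrite -expRD; congr expR; lra.
rewrite -mulrBr; apply: ler_wpM2l; first exact: expR_ge0.
by have := expR_ge1Dx (- (f x - m)); lra.
Qed.

(* With c the Bhattacharyya coefficient and r^2 the ratio of the normalizing constants,
   1 - c <= 1 - c^2 <= 1 - 2 c r + r^2, which is a multiple of the integral of
   (exp(-f/2) - exp(-g/2))^2 rho; so the constant of g needs no lower bound. *)
Lemma hellinger_sqr_le (g : 'cV[R]_n -> R) : measurable_fun setT g -> (forall x, 0 <= g x) ->
  ((hellinger (dsupp rho) (posterior rho f) (posterior rho g) ^+ 2)%:E <=
   (4^-1 * (evidence rho f * expR (- mean f)) `^ (- 2^-1))%:E *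
   \int[leb]_x ((f x - g x) ^+ 2 * rho x)%:E)%E.
Proof.
move=> mg g0.
have [Z EZ] : exists Z, evidence rho f = Z by eexists.
have [Y EY] : exists Y, evidence rho g = Y by eexists.
have ZE : Z = mean (fun x => expR (- f x)) by rewrite -EZ; exact: Rintegral_dsupp.
have YE : Y = mean (fun x => expR (- g x)) by rewrite -EY; exact: Rintegral_dsupp.
rewrite EZ.
have Z0 : 0 < Z by rewrite ZE mean_expRN_gt0.
have Y0 : 0 < Y by rewrite YE mean_expRN_gt0.
pose u x := expR (- (f x / 2)); pose v x := expR (- (g x / 2)).
have mu_ : measurable_fun setT u by exact: measurable_expRN.
have mv : measurable_fun setT v by exact: measurable_expRN.
have u01 x : 0 <= u x <= 1 by rewrite expR_ge0 expRN_le1// divr_ge0.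
have v01 x : 0 <= v x <= 1 by rewrite expR_ge0 expRN_le1// divr_ge0.
have u2 x : u x ^+ 2 = expR (- f x) by rewrite /u expr2 -expRD; congr expR; lra.
have v2 x : v x ^+ 2 = expR (- g x) by rewrite /v expr2 -expRD; congr expR; lra.
have sq (s : 'cV[R]_n -> R) (w : 'cV[R]_n -> R) (A : R) x : 0 < A -> 0 <= w x -> w x ^+ 2 = expR (- s x) -> evidence rho s = A ->
    Num.sqrt (posterior rho s x) = w x / Num.sqrt A * Num.sqrt (rho x).
  move=> A0 w0 w2 EA; rewrite /posterior EA -w2 sqrtrM ?mulr_ge0 ?sqr_ge0// sqrtrM ?sqr_ge0//.
  by rewrite sqrtr_sqr ger0_norm// sqrtrV ?(ltW A0)// mulrAC.
have [a aE] : exists a, Num.sqrt Z = a by eexists.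
have [b bE] : exists b, Num.sqrt Y = b by eexists.
have a0 : 0 < a by rewrite -aE sqrtr_gt0.
have b0 : 0 < b by rewrite -bE sqrtr_gt0.
have a2 : a ^+ 2 = Z by rewrite -aE sqr_sqrtr// ltW.
have b2 : b ^+ 2 = Y by rewrite -bE sqr_sqrtr// ltW.
have [p pE] : exists p, \int[leb]_x (u x * v x * rho x) = p by eexists.
have p0 : 0 <= p.
  by rewrite -pE; apply: fine_ge0; apply: integral_ge0 => x _; rewrite lee_fin mulr_ge0// mulr_ge0// expR_ge0.
pose c := p / (a * b).
have c0 : 0 <= c by rewrite divr_ge0// mulr_ge0// ltW.
have bounded_weight (w w' : 'cV[R]_n -> R) : measurable_fun setT w -> measurable_fun setT w' ->
    (forall x, 0 <= w x <= 1) -> (forall x, 0 <= w' x <= 1) ->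
    leb.-integrable setT (EFin \o (fun x => w x * w' x * rho x)).
  move=> mw mw' w01 w'01; apply: (integrable_weighted (M := 1)); first exact: measurable_funM.
  move=> x; have /andP[h1 h2] := w01 x; have /andP[h3 h4] := w'01 x.
  by rewrite ger0_norm ?mulr_ge0// mulr_ile1.
have iuu := bounded_weight _ _ mu_ mu_ u01 u01.
have iuv := bounded_weight _ _ mu_ mv u01 v01.
have ivv := bounded_weight _ _ mv mv v01 v01.
(* The square of s u + t v has three integrable terms. The one formula [quadE] serves both the
   Hellinger integral, with the normalised weights, and the unnormalised difference u - v. *)
pose coef (s t : R) (i : 'I_3) : R := nth 0 [:: s ^+ 2; 2 * (s * t); t ^+ 2] i.
pose quad (i : 'I_3) x : R := nth 0 [:: u x * u x * rho x; u x * v x * rho x; v x * v x * rho x] i.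
have iquad i : leb.-integrable setT (EFin \o quad i).
  by case: i => [[|[|[|//]]] Hi].
have quadE s t : mean (fun x => (s * u x + t * v x) ^+ 2) = s ^+ 2 * Z + 2 * (s * t) * p + t ^+ 2 * Y.
  transitivity (\int[leb]_x \sum_i coef s t i * quad i x).
    apply: eq_Rintegral => x _; rewrite !big_ord_recr big_ord0/= /coef /quad/=; ring.
  rewrite (Rintegral_sumZ _ iquad) !big_ord_recr big_ord0/= /coef /quad/= add0r.
  rewrite ZE YE pE; congr (_ * _ + _ + _ * _).
    by apply: eq_Rintegral => x _; rewrite -u2 expr2.
  by apply: eq_Rintegral => x _; rewrite -v2 expr2.
have dE : hellinger (dsupp rho) (posterior rho f) (posterior rho g) ^+ 2 = 1 - c.
  rewrite /hellinger sqr_sqrtr; last first.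
    by rewrite mulr_ge0// fine_ge0//; apply: integral_ge0 => x _; rewrite lee_fin sqr_ge0.
  transitivity (2^-1 * mean (fun x => (a^-1 * u x + - b^-1 * v x) ^+ 2)).
    congr (_ * _); rewrite -Rintegral_dsupp; apply: eq_Rintegral => x _.
    rewrite (sq f u Z)// ?(andP (u01 x)).1// (sq g v Y)// ?(andP (v01 x)).1//.
    by rewrite -mulrBl exprMn sqr_sqrtr//; congr (_ * _); rewrite aE bE; congr (_ ^+ 2); ring.
  rewrite quadE /c -a2 -b2; field; lra.
have c1 : 0 <= 1 - c by rewrite -dE sqr_ge0.
have SE : mean (fun x => (u x - v x) ^+ 2) = Z - 2 * p + Y.
  transitivity (mean (fun x => (1 * u x + - 1 * v x) ^+ 2)).
    by apply: eq_Rintegral => x _; rewrite mul1r mulN1r.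
  by rewrite quadE; ring.
have d_le : 1 - c <= mean (fun x => (u x - v x) ^+ 2) / Z.
  rewrite SE -a2 -b2; have -> : p = c * (a * b) by rewrite /c; field; lra.
  have -> : (a ^+ 2 - 2 * (c * (a * b)) + b ^+ 2) / a ^+ 2 = 1 - 2 * c * (b / a) + (b / a) ^+ 2 by field; lra.
  by move: (b / a) => r; have := sqr_ge0 (r - c); rewrite sqrrB; nra.
(* The square roots of the likelihoods are exponentials of -f/2 and -g/2; halving the exponents
   before using the Lipschitz bound yields the 1/4. *)
have S_le : ((mean (fun x => (u x - v x) ^+ 2))%:E <=
    4^-1%:E * \int[leb]_x ((f x - g x) ^+ 2 * rho x)%:E)%E.
  have iS : leb.-integrable setT (EFin \o (fun x => (u x - v x) ^+ 2 * rho x)).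
    apply: (integrable_weighted (M := 1)); first by apply: measurable_funX; exact: measurable_funB.
    move=> x; have /andP[h1 h2] := u01 x; have /andP[h3 h4] := v01 x.
    by rewrite ger0_norm ?sqr_ge0//; nra.
  rewrite /Rintegral (fineK (integrable_fin_num measurableT iS)).
  rewrite -ge0_integralZl//; last 2 first.
  - by apply/measurable_EFinP; apply: measurable_funM => //; apply: measurable_funX; exact: measurable_funB.
  - by move=> x _; rewrite lee_fin mulr_ge0 ?sqr_ge0.
  apply: ge0_le_integral_dom => x _; first by rewrite lee_fin mulr_ge0 ?sqr_ge0.
  rewrite -EFinM lee_fin mulrA ler_wpM2r//.
  have := @expRN_lip R (f x / 2) (g x / 2); rewrite !divr_ge0// => /(_ isT isT)/le_trans; apply.
  by rewrite le_eqVlt; apply/orP; left; apply/eqP; field.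
set S := (\int[leb]_x _)%E in S_le *.
have S0 : (0 <= S)%E by apply: integral_ge0 => x _; rewrite lee_fin mulr_ge0 ?sqr_ge0.
(* By Jensen exp(- mean f) <= Z, hence Z exp(- mean f) <= Z^2; taking inverse square roots brings in
   the expression that defines L. *)
have Zpow : Z^-1 <= (Z * expR (- mean f)) `^ (- 2^-1).
  have Ze0 : 0 < Z * expR (- mean f) by rewrite mulr_gt0 ?expR_gt0.
  rewrite powRN powR12_sqrt ?(ltW Ze0)// lef_pV2 ?posrE ?sqrtr_gt0//.
  rewrite -[leRHS](ger0_norm (ltW Z0)) -sqrtr_sqr ler_sqrt ?sqr_ge0//.
  by rewrite expr2 ler_pM2l// ZE; exact: jensen_expRN.
apply: (@le_trans _ _ (Z^-1%:E * (4^-1%:E * S))%E).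
  apply: le_trans (lee_wpmul2l _ S_le); last by rewrite lee_fin invr_ge0 ltW.
  by rewrite -EFinM lee_fin dE mulrC.
rewrite muleA -EFinM; apply: lee_wpmul2r => //; rewrite lee_fin mulrC.
by apply: ler_wpM2l.
Qed.

End hellinger_bound.

Import HBNNSimple.

(** A density relation known on sets extends to nonnegative integrands through simple functions and
    monotone convergence. *)
Lemma ge0_integral_density d (T : measurableType d) (R : realType)
    (nu mu : {measure set T -> \bar R}) (r : T -> R) (f : T -> \bar R) :
  measurable_fun setT r -> (forall x, 0 <= r x) ->
  (forall A, measurable A -> nu A = (\int[mu]_(x in A) (r x)%:E)%E) ->
  measurable_fun setT f -> (forall x, 0 <= f x)%E ->
  (\int[nu]_x f x = \int[mu]_x (f x * (r x)%:E))%E.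
Proof.
move=> mr r0 nuE mf f0.
have mrE : measurable_fun setT (EFin \o r) by exact/measurable_EFinP.
have indicE' E : measurable E -> (\int[nu]_x (\1_E x)%:E = \int[mu]_x ((r x)%:E * (\1_E x)%:E))%E.
  by move=> mE; rewrite integral_indic// setIT nuE// integral_indicE.
pose h := nnsfun_approx measurableT mf.
have hE j : (\int[nu]_x (h j x)%:E = \int[mu]_x ((h j x)%:E * (r x)%:E))%E.
  under [LHS]eq_integral do rewrite fimfunE -fsumEFin//.
  rewrite [LHS]ge0_integral_fsum//; last 2 first.
  - by move=> y; exact/measurable_EFinP/measurableT_comp.
  - by move=> y x _; rewrite EFinM nnfun_muleindic_ge0.
  under [RHS]eq_integral.
    move=> x _; rewrite muleC fimfunE -fsumEFin// ge0_mule_fsumr; last first.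
      by move=> y; rewrite EFinM nnfun_muleindic_ge0.
    over.
  rewrite [RHS]ge0_integral_fsum//; last 2 first.
  - move=> y; apply: emeasurable_funM => //.
    by apply/measurable_EFinP; exact/measurableT_comp.
  - by move=> y x _; rewrite EFinM mule_ge0 ?nnfun_muleindic_ge0// lee_fin.
  apply: eq_fsbigr => y _.
  have [y0|y0] := leP 0 y; last first.
    by rewrite preimage_nnfun0// indic0; under [RHS]eq_integral do rewrite mulr0 mule0;
      under eq_integral do rewrite mulr0; rewrite !integral0.
  have mE : measurable (h j @^-1` [set y]) by exact: measurable_sfunP.
  under [RHS]eq_integral do rewrite EFinM muleCA.
  rewrite integralZl_indic_nnsfun// indicE'// ge0_integralZl//.
  - by apply: emeasurable_funM => //; apply/measurable_EFinP; exact: measurable_indic.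
  - by move=> x _; rewrite mule_ge0 ?lee_fin.
have H1 : (\int[nu]_x (h j x)%:E)%E @[j --> \oo] --> (\int[nu]_x f x)%E.
  apply: cvg_integral_nondecreasing => //.
  - by move=> j; exact/measurable_EFinP.
  - by move=> j x; rewrite lee_fin.
  - by move=> x i j ij; rewrite lee_fin; exact/lefP/nd_nnsfun_approx.
  - by move=> x; exact: cvg_nnsfun_approx.
have H2 : (\int[nu]_x (h j x)%:E)%E @[j --> \oo] --> (\int[mu]_x (f x * (r x)%:E))%E.
  under eq_fun do rewrite hE.
  apply: cvg_integral_nondecreasing => //.
  - by move=> j; apply: emeasurable_funM => //; exact/measurable_EFinP.
  - by move=> j x; rewrite mule_ge0 ?lee_fin.
  - by move=> x i j ij; rewrite lee_wpmul2r ?lee_fin//; exact/lefP/nd_nnsfun_approx.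
  - move=> x; apply: cvgeZr => //; exact: cvg_nnsfun_approx.
exact: (cvg_unique _ H1 H2).
Qed.

(** * Expected error of the sampled conditional mean *)

Section monte_carlo.
Variables (R : realType) (n k l : nat) (hkl : (k + l)%N = n).
Variables (W1 : 'M[R]_(n, k)) (W2 : 'M[R]_(n, l)).
Hypothesis oW : orthogonal_mx (castmx (erefl n, hkl) (row_mx W1 W2)).
Variables rho f : 'cV[R]_n -> R.
Hypothesis mrho : measurable_fun setT rho.
Hypothesis rho0 : forall x, 0 <= rho x.
Hypothesis mf : measurable_fun setT f.
Local Notation leb := (lebesgue_cV R).
Local Notation rc := (recombine W1 W2).
Local Notation m := (marginal W1 W2 rho).
Local Notation Y := (active_set W1 (dsupp rho)).
Variable Pcond : 'cV[R]_k -> probability 'cV[R]_l R.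
Hypothesis Pcond_density : forall y, Y y -> has_density (Pcond y) (conditional W1 W2 rho y).

Lemma trmx_recombine y z : W1^T *m rc y z = y.
Proof.
have [W11 W12 _ _] := orthogonal_blocks oW.
by rewrite /recombine mulmxDr !mulmxA W11 W12 mul1mx mul0mx addr0.
Qed.

Lemma rho_off_active y z : ~ Y y -> rho (rc y z) = 0.
Proof.
move=> Yy; apply: (dsupp_eq0 rho0); apply/negP => /set_mem Xx; apply: Yy.
by exists (rc y z) => //; rewrite trmx_recombine.
Qed.

(** If the marginal were 0, the conditional density would vanish identically by the convention for
    division by 0, against the total mass 1 of [Pcond y]. *)
Lemma marginal_gt0 y : Y y -> 0 < m y.
Proof.
move=> Yy; rewrite lt_def marginal_ge0// andbT; apply/eqP => my0.
have := Pcond_density Yy measurableT; rewrite probability_setT integral0_eq.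
  by move=> /eqP; rewrite eqe oner_eq0.
by move=> z _; rewrite /conditional my0 invr0 mulr0.
Qed.

(** An image under a linear map, whose measurability is not automatic; it coincides with the set
    where the marginal is positive. *)
Lemma measurable_active_set : measurable Y.
Proof.
rewrite (_ : Y = setT `&` m @^-1` [set` `]0%R, +oo[]).
  by apply: (measurable_marginal W1 W2 mrho rho0) => //; exact: measurable_itv.
rewrite setTI; apply/seteqP; split=> y /=; rewrite in_itv/= andbT; first exact: marginal_gt0.
apply: contraPP => Yy; apply/negP; rewrite -leNgt /marginal /Rintegral integral0_eq//.
by move=> z _; rewrite rho_off_active.
Qed.

Variables (disp : measure_display) (Omega : measurableType disp) (P : probability Omega R).
Variables (N : nat) (Zh : 'I_N -> 'cV[R]_k -> Omega -> 'cV[R]_l).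
Hypothesis N0 : (0 < N)%N.
Hypothesis mZh : forall j, measurable_fun (Y `*` [set: Omega])
    (fun p : 'cV[R]_k * Omega => Zh j p.1 p.2).
Hypothesis Zh_law : forall y, Y y -> forall (j : 'I_N) (A : set 'cV[R]_l), measurable A ->
    P (Zh j y @^-1` A) = Pcond y A.

(** Extension by 0 off the active set, where [Zh] carries no assumption; it makes the samples
    jointly measurable on the whole product. *)
Definition sample (j : 'I_N) (y : 'cV[R]_k) (w : Omega) : 'cV[R]_l :=
  if y \in Y then Zh j y w else 0.

Lemma sampleE j y w : Y y -> sample j y w = Zh j y w.
Proof. by move=> Yy; rewrite /sample mem_set. Qed.

Lemma measurable_sample j : measurable_fun setT (fun p : 'cV[R]_k * Omega => sample j p.1 p.2).
Proof.
have mY := measurable_active_set.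
have E : (fun t : 'cV[R]_k * Omega => t.1 \in Y) @^-1` [set true] = Y `*` setT.
  apply/seteqP; split=> -[y w] /=; first by move/set_mem.
  by move=> [/mem_set].
apply: measurable_fun_if => //; last by rewrite setTI E.
by apply: (measurable_fun_bool true); rewrite setTI E; exact: measurableX.
Qed.

Lemma integral_sample y j (h : 'cV[R]_l -> \bar R) : Y y ->
  measurable_fun setT h -> (forall z, 0 <= h z)%E ->
  (\int[P]_w h (sample j y w) = \int[leb l]_z (h z * (conditional W1 W2 rho y z)%:E))%E.
Proof.
move=> Yy mh h0.
have ms : measurable_fun setT (sample j y).
  exact: measurableT_comp (measurable_sample j) (measurable_pair1 y).
have mc : measurable_fun setT (conditional W1 W2 rho y).
  apply: measurable_funM => //; apply: measurableT_comp mrho _.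
  by apply: measurable_recombine => //; exact: measurable_cst.
rewrite -(@ge0_integral_density _ _ _ (Pcond y) (leb l) (conditional W1 W2 rho y) h mc)//; last 2 first.
- by move=> z; rewrite divr_ge0// marginal_ge0.
- exact: Pcond_density.
have := ge0_integral_pushforward ms P measurableT mh (fun z _ => h0 z).
rewrite preimage_setT => <-; apply: eq_measure_integral => A mA _.
rewrite /= /pushforward -(Zh_law Yy j mA); congr (P _).
by apply/seteqP; split=> w/=; rewrite sampleE.
Qed.

Lemma measurable_mc_average :
  measurable_fun setT (fun p : 'cV[R]_n * Omega => mc_average W1 W2 f sample (W1^T *m p.1) p.2).
Proof.
have mW1 : measurable_fun setT (fun p : 'cV[R]_n * Omega => W1^T *m p.1).
  by apply: measurable_mulmx; exact: measurable_fst.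
apply: measurable_funM => //; apply: measurable_sum => j.
apply: measurableT_comp mf _; apply: measurable_recombine => //.
have mp : measurable_fun setT (fun p : 'cV[R]_n * Omega => (W1^T *m p.1, p.2)).
  by apply: measurable_fun_pair.
exact: measurableT_comp (measurable_sample j) mp.
Qed.

Lemma expected_sqr_error_le :
  (\int[P]_w \int[leb n]_x ((f x - mc_average W1 W2 f sample (W1^T *m x) w) ^+ 2 * rho x)%:E <=
   pair_energy W1 W2 rho setT f)%E.
Proof.
pose G (p : 'cV[R]_n * Omega) :=
  ((f p.1 - mc_average W1 W2 f sample (W1^T *m p.1) p.2) ^+ 2 * rho p.1)%:E : \bar R.
have G0 p : (0 <= G p)%E by rewrite lee_fin mulr_ge0 ?sqr_ge0.
have mG : measurable_fun setT G.
  apply/measurable_EFinP; apply: measurable_funM; last exact: measurableT_comp mrho _.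
  apply: measurable_funX; apply: measurable_funB; first exact: measurableT_comp mf _.
  exact: measurable_mc_average.
rewrite -(fubini_tonelli G mG G0) (integral_recombine oW); last 2 first.
- exact: (measurable_fun_fubini_tonelli_F G).
- by move=> x; exact: integral_ge0.
apply: ge0_le_integral_dom => y _; first by do 2 apply: integral_ge0 => ? _.
apply: ge0_le_integral_dom => z _; first exact: integral_ge0.
have [Yy|Yy] := pselect (Y y); last first.
  rewrite integral0_eq; first by apply: integral_ge0 => z' _; rewrite lee_fin mulr_ge0 ?sqr_ge0 ?pair_weight_ge0.
  by move=> w _; rewrite /G/= rho_off_active// mulr0.
pose q z' := (f (rc y z) - f (rc y z')) ^+ 2.
have mrc : measurable_fun setT (fun z : 'cV[R]_l => rc y z).
  by apply: measurable_recombine => //; exact: measurable_cst.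
have mq : measurable_fun setT (fun z' => (q z')%:E).
  apply/measurable_EFinP; apply: measurable_funX; apply: measurable_funB => //.
  exact: measurableT_comp mf mrc.
have q0 z' : (0 <= (q z')%:E)%E by rewrite lee_fin sqr_ge0.
pose c := rho (rc y z) / N%:R.
have c0 : 0 <= c by rewrite divr_ge0.
have Nn0 : N%:R != 0 :> R by rewrite pnatr_eq0 -lt0n.
have mqs (j : 'I_N) : measurable_fun setT (fun w => (q (sample j y w))%:E).
  apply: measurableT_comp mq _.
  exact: measurableT_comp (measurable_sample j) (measurable_pair1 y).
(* For each sample point, Cauchy-Schwarz bounds the squared mean deviation by the mean of the
   squared deviations. The N terms have equal expectations, so the weights 1/N add up to 1. *)
apply: (@le_trans _ _ (\int[P]_w \sum_(j < N) (c%:E * (q (sample j y w))%:E))%E).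
  apply: ge0_le_integral_dom => w _; first exact: G0.
  rewrite /G/= trmx_recombine; under eq_bigr do rewrite -EFinM.
  rewrite sumEFin lee_fin -mulr_sumr /c -(mulrA (rho _)) [leLHS]mulrC; apply: ler_wpM2l => //.
  have -> : f (rc y z) - mc_average W1 W2 f sample y w =
      N%:R^-1 * \sum_(j < N) (f (rc y z) - f (rc y (sample j y w))) * 1.
    under eq_bigr do rewrite mulr1.
    by rewrite sumrB mulrBr sumr_const card_ord -(mulr_natl (f _) N) mulrA mulVf// mul1r.
  rewrite expr2 -!mulrA; apply: ler_wpM2l; first by rewrite invr_ge0.
  rewrite mulrCA -expr2 ler_pdivrMl ?ltr0n//.
  apply: le_trans (cauchy_schwarz_sum _ _) _; rewrite mulrC.
  by under eq_bigr do rewrite expr1n; rewrite sumr_const card_ord.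
rewrite ge0_integral_sum//; last 2 first.
- by move=> j; apply: emeasurable_funM.
- by move=> j w _; rewrite mule_ge0 ?lee_fin ?sqr_ge0.
under eq_bigr => j _.
  rewrite ge0_integralZl ?lee_fin// (integral_sample j Yy mq q0); over.
rewrite /= -ge0_sume_distrl => [|j _]; last by rewrite lee_fin.
rewrite sumEFin sumr_const card_ord (_ : c *+ N = rho (rc y z)); last first.
  by rewrite /c -(mulr_natl (_ / _) N) mulrCA mulfV// mulr1.
have mcond : measurable_fun setT (fun z' => (conditional W1 W2 rho y z')%:E).
  apply/measurable_EFinP; apply: measurable_funM => //; exact: measurableT_comp mrho mrc.
have cond0 z' : (0 <= (conditional W1 W2 rho y z')%:E)%E by rewrite lee_fin divr_ge0// marginal_ge0.
rewrite -ge0_integralZl ?lee_fin//; last 2 first.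
- exact: emeasurable_funM.
- by move=> z' _; rewrite mule_ge0.
apply: ge0_le_integral_dom => z' _; first by apply: mule_ge0; [rewrite lee_fin|apply: mule_ge0].
rewrite -!EFinM lee_fin /pair_weight !indicE !in_setT /= !mulr1 /conditional /q.
by rewrite le_eqVlt; apply/orP; left; apply/eqP; ring.
Qed.

End monte_carlo.

(* Integrate [2 a <= S / s + s] for every [s > t], so that [d] itself needs no measurability. *)
Lemma expectation_le_of_sqr disp (Omega : measurableType disp) (R : realType)
    (P : probability Omega R) (a : Omega -> R) (S : Omega -> \bar R) (t : R) :
  (forall w, 0 <= a w) -> measurable_fun setT S -> (forall w, (0 <= S w)%E) ->
  (forall w, ((a w ^+ 2)%:E <= S w)%E) -> 0 <= t -> (\int[P]_w S w <= (t ^+ 2)%:E)%E ->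
  (\int[P]_w (a w)%:E <= t%:E)%E.
Proof.
move=> a0 mS S0 aS t0 St; apply/lee_addgt0Pr => e e0.
pose s : R := t + e; have s0 : 0 < s by rewrite ltr_wpDl.
have s20 : 0 <= (2 * s)^-1 by rewrite invr_ge0 mulr_ge0// ltW.
apply: (@le_trans _ _ (\int[P]_w ((2 * s)^-1%:E * S w + (s / 2)%:E))%E).
  apply: ge0_le_integral_dom => w _; first by rewrite lee_fin.
  apply: (@le_trans _ _ ((2 * s)^-1%:E * (a w ^+ 2)%:E + (s / 2)%:E)%E); last first.
    by apply: leeD => //; apply: lee_wpmul2l.
  rewrite -EFinM -EFinD lee_fin -subr_ge0.
  rewrite (_ : _ - _ = (a w - s) ^+ 2 / (2 * s)); first by rewrite divr_ge0 ?sqr_ge0// mulr_ge0// ltW.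
  by field; rewrite gt_eqF.
rewrite ge0_integralD//; last 3 first.
- by move=> w _; rewrite mule_ge0 ?lee_fin.
- by apply: emeasurable_funM => //; exact: measurable_cst.
- by move=> w _; rewrite lee_fin divr_ge0// ltW.
rewrite ge0_integralZl ?lee_fin// [X in (_ + X)%E](_ : _ = (s / 2)%:E); last first.
  rewrite (integral_cst P measurableT) -[RHS]mule1; congr (_ * _)%E; exact: probability_setT.
apply: (@le_trans _ _ ((2 * s)^-1%:E * (t ^+ 2)%:E + (s / 2)%:E)%E).
  by apply: leeD => //; apply: lee_wpmul2l.
rewrite -EFinM -EFinD lee_fin -/s.
have ts : t <= s by rewrite lerDl ltW.
have : (2 * s)^-1 * t ^+ 2 <= s / 2; last by lra.
by rewrite ler_pdivrMl ?mulr_gt0//; nra.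
Qed.

Lemma measurable_misfit (R : realType) n m (X : set 'cV[R]_n) (S : 'M[R]_m) dat G :
  measurable X -> measurable_fun X (misfit X S dat G) -> measurable_fun setT (misfit X S dat G).
Proof.
move=> mX mf; set f := misfit _ _ _ _ in mf *.
rewrite (_ : f = fun x => if x \in X then f x else 0); last first.
  by apply/funext => x; rewrite /f /misfit; case: (x \in X).
have E : (fun x => x \in X) @^-1` [set true] = X by apply/seteqP; split=> x /=; [exact: set_mem|exact: mem_set].
apply: measurable_fun_if => //; last by rewrite setTI E.
by apply: (measurable_fun_bool true); rewrite setTI E.
Qed.

Lemma misfit_ge0 (R : realType) n m (X : set 'cV[R]_n) (S : 'M[R]_m) dat G x :
  0 <= misfit X S dat G x.
Proof. by rewrite /misfit; case: ifP => // _; rewrite mulr_ge0 ?sqr_ge0. Qed.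

Lemma eq_posterior (R : realType) n (rho f g : 'cV[R]_n -> R) x :
  (forall y, y \in dsupp rho -> f y = g y) -> x \in dsupp rho ->
  posterior rho f x = posterior rho g x.
Proof.
move=> fg Xx; have E : evidence rho f = evidence rho g.
  by apply: eq_Rintegral => y Xy; rewrite (fg y Xy).
by rewrite /posterior E (fg x Xx).
Qed.

Lemma eq_hellinger (R : realType) n (X : set 'cV[R]_n) (p q q' : 'cV[R]_n -> R) :
  (forall x, x \in X -> q x = q' x) -> hellinger X p q = hellinger X p q'.
Proof.
move=> qq'; have E : \int[lebesgue_cV R n]_(x in X) (Num.sqrt (p x) - Num.sqrt (q x)) ^+ 2 =
    \int[lebesgue_cV R n]_(x in X) (Num.sqrt (p x) - Num.sqrt (q' x)) ^+ 2.
  by apply: eq_Rintegral => x Xx; rewrite (qq' x Xx).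
by rewrite /hellinger E.
Qed.

Lemma mc_average_ge0 (R : realType) n k l (W1 : 'M[R]_(n, k)) (W2 : 'M[R]_(n, l)) f
    (Omega : Type) N (Z : 'I_N -> 'cV[R]_k -> Omega -> 'cV[R]_l) y w :
  (forall x, 0 <= f x) -> 0 <= mc_average W1 W2 f Z y w.
Proof. by move=> f0; rewrite mulr_ge0 ?invr_ge0// sumr_ge0. Qed.

Theorem theorem5p3 (R : realType) (n : nat) (rho : 'cV[R]_n -> R) :
  (2 <= n)%N ->
  prior_assumptions rho ->
  uniform_on_convex rho \/ std_gaussian rho ->
  exists2 C : R, 0 < C &
  forall (disp : measure_display) (Omega : measurableType disp)
    (P : probability Omega R) (X : {RV P >-> 'cV[R]_n}),
  has_density (distribution P X) rho ->
  forall (m : nat) (G : 'cV[R]_n -> 'cV[R]_m) (dat : 'cV[R]_m)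
    (Gamma Gis : 'M[R]_m),
  spd_mx Gamma -> inv_sqrt_mx Gamma Gis ->
  let f := misfit (dsupp rho) Gis dat G in
  measurable_fun (dsupp rho) f ->
  has_partials_on (dsupp rho) f ->
  partials_square_integrable rho f ->
  forall (W : 'M[R]_n) (lambda : 'rV[R]_n),
  orthogonal_mx W ->
  (forall i j : 'I_n, (i <= j)%N -> lambda ord0 j <= lambda ord0 i) ->
  (forall i : 'I_n, 0 <= lambda ord0 i) ->
  gradient_mx rho f = W *m diag_mx lambda *m W^T ->
  forall (k l : nat) (hkl : (k + l)%N = n), (0 < k)%N -> (0 < l)%N ->
  forall (Wh1 : 'M[R]_(n, k)) (Wh2 : 'M[R]_(n, l)),
  let Wh : 'M[R]_n := castmx (erefl n, hkl) (row_mx Wh1 Wh2) in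
  orthogonal_mx Wh ->
  let Yhat := active_set Wh1 (dsupp rho) in
  forall Pcond : 'cV[R]_k -> probability 'cV[R]_l R,
  (forall y, Yhat y -> has_density (Pcond y) (conditional Wh1 Wh2 rho y)) ->
  (forall y, Yhat y ->
    (Pcond y).-integrable setT (fun z => (f (recombine Wh1 Wh2 y z))%:E)) ->
  forall (N : nat) (Zh : 'I_N -> 'cV[R]_k -> Omega -> 'cV[R]_l), (0 < N)%N ->
  (forall j, measurable_fun (Yhat `*` [set: Omega])
    (fun p : 'cV[R]_k * Omega => Zh j p.1 p.2)) ->
  (forall y, Yhat y -> forall (j : 'I_N) (A : set 'cV[R]_l), measurable A ->
    P (Zh j y @^-1` A) = Pcond y A) ->
  (forall y, Yhat y -> mutually_independent P (fun j => Zh j y)) ->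
  forall eps : R, 0 < eps -> opnorm (W - Wh) <= eps ->
  forall L : R, 0 < L ->
  L ^+ 2 = 8^-1 * (evidence rho f *
    expR (- \int[lebesgue_cV R n]_(x in dsupp rho) (f x * rho x)))
      `^ (- 2^-1) ->
  ('E_P[fun w => hellinger (dsupp rho) (posterior rho f)
      (posterior rho (fun x => mc_average Wh1 Wh2 f Zh (Wh1^T *m x) w))]
   <= (Num.sqrt C * L * (1 + N%:R `^ (- 2^-1)) *
       (eps * Num.sqrt (\sum_(i < n | (i < k)%N) lambda ord0 i) +
        Num.sqrt (\sum_(i < n | (k <= i)%N) lambda ord0 i)))%:E)%E.
Proof.
move=> n2 [[mrho rho0 rho1] oX _ _ _] cases.
have [C C0 poincare] : exists2 C : R, 0 < C & poincare_with rho C.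
  case: cases => [unif|gauss]; first exact: poincare_convex.
  exact: poincare_gaussian.
(* The 2 comes from the Hellinger bound 2 L^2 S, the C from the Poincare inequality. *)
exists (2 * C) => [|disp Omega P X _ m G dat Gamma Gis _ _ f mfX df df2 W lam oW _ lam0 gE]; first by rewrite mulr_gt0.
move=> k l hkl _ _ Wh1 Wh2 Wh oWh Yhat Pcond Pd _ N Zh N0 mZh law _ eps eps0 We L L0 LE.
have mX := measurable_dsupp mrho.
have mf : measurable_fun setT f by exact: measurable_misfit.
have f0 x : 0 <= f x by exact: misfit_ge0.
pose Z := sample Wh1 rho Zh.
pose g w x := mc_average Wh1 Wh2 f Z (Wh1^T *m x) w.
have mG : measurable_fun setT (fun p : 'cV[R]_n * Omega => g p.2 p.1).
  exact: (measurable_mc_average oWh mrho rho0 mf Pd mZh).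
have mg w : measurable_fun setT (g w) by exact: measurableT_comp mG (measurable_pair2 w).
have g0 w x : 0 <= g w x by exact: mc_average_ge0.
(* Only points W1^T x with x in the support are evaluated, and these are active, so replacing [Zh]
   by its extension changes neither the posterior on the support nor the distance. *)
have hE w : hellinger (dsupp rho) (posterior rho f)
      (posterior rho (fun x => mc_average Wh1 Wh2 f Zh (Wh1^T *m x) w)) =
    hellinger (dsupp rho) (posterior rho f) (posterior rho (g w)).
  apply: eq_hellinger => x Xx; apply: eq_posterior Xx => x' /set_mem Xx'; rewrite /g /mc_average; congr (_ * _).
  by apply: eq_bigr => j _; rewrite /Z sampleE//; exists x'.
have fmean := integral_density_lty mrho rho0 rho1 mf f0 df df2 poincare.
have hell w := hellinger_sqr_le mrho rho0 rho1 mf f0 fmean (mg w) (g0 w).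
rewrite unlock; under eq_integral do rewrite hE.
rewrite (Rintegral_dsupp rho0) in LE.
have KE : 4^-1 * (evidence rho f * expR (- \int[lebesgue_cV R n]_x (f x * rho x))) `^ (- 2^-1) = 2 * L ^+ 2.
  by rewrite LE; field.
rewrite {}KE in hell.
pose S w := (\int[lebesgue_cV R n]_x ((f x - g w x) ^+ 2 * rho x)%:E)%E.
have S0 w : (0 <= S w)%E by apply: integral_ge0 => x _; rewrite lee_fin mulr_ge0 ?sqr_ge0.
have mS : measurable_fun setT S.
  apply: (measurable_fun_fubini_tonelli_G
    (fun p : 'cV[R]_n * Omega => ((f p.1 - g p.2 p.1) ^+ 2 * rho p.1)%:E)).
    apply/measurable_EFinP; apply: measurable_funM; last exact: measurableT_comp mrho _.
    by apply: measurable_funX; apply: measurable_funB => //; exact: measurableT_comp mf _.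
  by move=> p; rewrite lee_fin mulr_ge0 ?sqr_ge0.
have L20 : 0 <= 2 * L ^+ 2 by rewrite mulr_ge0// sqr_ge0.
set A := \sum_(i < n | (i < k)%N) _; set B := \sum_(i < n | (k <= i)%N) _.
have A0 : 0 <= A by apply: sumr_ge0.
have B0 : 0 <= B by apply: sumr_ge0.
have ES : (\int[P]_w S w <= (C * (eps ^+ 2 * A + B))%:E)%E.
  apply: le_trans (expected_sqr_error_le oWh mrho rho0 mf Pd N0 mZh law) _.
  apply: le_trans (poincare f mf f0 df df2 k l hkl Wh1 Wh2 oWh) _.
  rewrite (weighted_grad2E mrho rho0 mf df df2) -EFinM lee_fin gE; apply: ler_wpM2l; first exact: ltW.
  by apply: (trace_block_le oWh oW lam0 _ We); exact: ltW.
apply: (@expectation_le_of_sqr _ _ _ _ _ (fun w => (2 * L ^+ 2)%:E * S w)%E).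
- by move=> w; exact: sqrtr_ge0.
- by apply: emeasurable_funM => //; exact: measurable_cst.
- by move=> w; rewrite mule_ge0 ?lee_fin.
- by [].
- by rewrite !mulr_ge0 ?sqrtr_ge0 ?addr_ge0 ?mulr_ge0 ?sqrtr_ge0 ?powR_ge0// ltW.
rewrite ge0_integralZl ?lee_fin//.
apply: (@le_trans _ _ ((2 * L ^+ 2)%:E * (C * (eps ^+ 2 * A + B))%:E)%E); first exact: lee_wpmul2l.
rewrite -EFinM lee_fin !exprMn sqr_sqrtr; last by rewrite mulr_ge0// ltW.
rewrite (_ : 2 * L ^+ 2 * _ = 2 * C * L ^+ 2 * (eps ^+ 2 * A + B)); last by ring.
have CL0 : 0 <= 2 * C * L ^+ 2 by rewrite mulr_ge0 ?sqr_ge0// mulr_ge0// ltW.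
(* Two comparisons of squares remain: the factor 1 + N^(-1/2) is at least 1, and eps^2 A + B is at
   most the square of eps sqrt(A) + sqrt(B), whose cross term is nonnegative. *)
apply: ler_pM => //; first by rewrite addr_ge0// mulr_ge0 ?sqr_ge0.
  by rewrite ler_peMr// exprn_ege1// lerDl powR_ge0.
rewrite sqrrD exprMn !sqr_sqrtr// -addrA lerD2l lerDr mulrn_wge0//.
by rewrite !mulr_ge0 ?sqrtr_ge0// ltW.
Qed.
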